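(* Let $X=(X_t)_{t\ge0}$ be a real-valued stable Lévy process with index $\alpha\in(1,2]$, that is, a Lévy process, not identically zero, such that for every $c>0$ the processes $(X_{ct})_{t\ge0}$ and $(c^{1/\alpha}X_t)_{t\ge0}$ have the same law. Let $\rho=P(X_1\ge0)$. There exists a constant $k^*>0$ such that for all $x>0$ and $\mu>0$, as $\lambda\to0+$: (i) $P(S_{\mathbf e_\lambda}\le x)\sim k^*\,x^{\alpha\rho}\,\lambda^{\rho}$; (ii) $\displaystyle\int_x^{+\infty}\mu e^{-\mu v}P(S_{\mathbf e_\lambda}\le v)\,dv\sim k^*\left(\int_{\mu x}^{+\infty}e^{-y}y^{\alpha\rho}\,dy\right)\mu^{-\alpha\rho}\lambda^{\rho}$; (iii) $E\left[e^{-\mu S_{\mathbf e_\lambda}}\right]\sim k^*\,\Gamma(1+\alpha\rho)\,\mu^{-\alpha\rho}\,\lambda^{\rho}$; (iv) $\displaystyle E\left[e^{-\mu S_{\mathbf e_\lambda}}1_{\{S_{\mathbf e_\lambda}\ge x\}}\right]\sim k^*\,\alpha\rho\left(\int_{\mu x}^{+\infty}e^{-y}y^{\alpha\rho-1}\,dy\right)\mu^{-\alpha\rho}\lambda^{\rho}$.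
   Context: $X$ has càdlàg paths and $X_0=0$. For $t\ge0$, $S_t=\sup_{0\le s\le t}X_s$. For $\lambda>0$, $\mathbf e_\lambda$ is an exponential random variable with parameter $\lambda$ (mean $1/\lambda$), independent of $X$. It is known that $\rho\in[1-1/\alpha,1/\alpha]\subset(0,1)$. $\Gamma$ is the Gamma function, and $a(\lambda)\sim b(\lambda)$ means $a(\lambda)/b(\lambda)\to1$. *)

(* Defs.v *)
From HB Require Import structures.
From mathcomp Require Import all_boot all_order all_algebra.
From mathcomp Require Import all_classical all_reals all_analysis.
Set Implicit Arguments.
Unset Strict Implicit.
Unset Printing Implicit Defensive.
Import Order.TTheory GRing.Theory Num.Theory.
Import numFieldNormedType.Exports.

Local Open Scope classical_set_scope.
Local Open Scope ring_scope.

(* A real process (X_t)_{t >= 0} is a function X : R -> Omega -> R, X t w being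
   the value of X_t at w; only its restriction to times t >= 0 is ever used. *)

(* The product sigma-algebra of R^[0, +oo[, generated by the coordinates. *)
Definition path_sigma (R : realType) : set_system (R -> R) :=
  <<s \bigcup_(t in [set t : R | 0 <= t])
        preimage_set_system setT (fun f : R -> R => f t) measurable >>.

Section processes.
Context {d : measure_display} {Omega : measurableType d} {R : realType}.
Variable P : probability Omega R.
Implicit Types X Y : R -> Omega -> R.

Definition sample_path X (w : Omega) : R -> R := fun t => X t w.

Definition same_law X Y : Prop := forall A : set (R -> R), path_sigma A ->
  P (sample_path X @^-1` A) = P (sample_path Y @^-1` A).

Definition indep_systems (F G : set_system Omega) : Prop :=
  forall A B, F A -> G B -> P (A `&` B) = (P A * P B)%E.

(* sigma(X) and sigma(Y) are independent. *)
Definition indep_process_rv X (Y : Omega -> R) : Prop :=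
  indep_systems (preimage_set_system setT (sample_path X) (@path_sigma R))
                (preimage_set_system setT Y measurable).

(* The product rule over subfamilies is included: take B i = setT. *)
Definition mutually_independent (n : nat) (Y : 'I_n -> Omega -> R) : Prop :=
  forall B : 'I_n -> set R, (forall i, measurable (B i)) ->
    P (\bigcap_(i in [set: 'I_n]) (Y i @^-1` B i)) =
    (\prod_(i < n) P (Y i @^-1` B i))%E.

Definition cadlag (f : R -> R) : Prop :=
  (forall t, 0 <= t -> f s @[s --> t^'+] --> f t) /\
  (forall t, 0 < t -> cvg (f s @[s --> t^'-])).

Record levy_process X : Prop := LevyProcess {
  levy_measurable : forall t, 0 <= t -> measurable_fun [set: Omega] (X t) ;
  levy_start : forall w, X 0 w = 0 ;
  levy_cadlag : forall w, cadlag (sample_path X w) ;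
  levy_indep : forall (n : nat) (t : nat -> R), 0 <= t 0%N ->
    {homo t : i j / (i <= j)%N >-> i <= j} ->
    mutually_independent (fun (i : 'I_n) w => X (t i.+1) w - X (t i) w) ;
  levy_stationary : forall s t, 0 <= s -> 0 <= t ->
    forall B : set R, measurable B ->
      P ((fun w => X (s + t) w - X s w) @^-1` B) = P (X t @^-1` B) }.

Record stable_levy_process (alpha : R) X : Prop := StableLevyProcess {
  stable_levy : levy_process X ;
  stable_nonzero : ~ {ae P, forall w, forall t, 0 <= t -> X t w = 0} ;
  stable_scaling : forall c, 0 < c ->
    same_law (fun t => X (c * t)) (fun t w => c `^ alpha^-1 * X t w) }.

(* On cadlag paths and for t >= 0 this is the sup of a nonempty bounded set;
   for t < 0 it is sup set0 = 0. *)
Definition running_sup X (t : R) (w : Omega) : R :=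
  sup [set X s w | s in [set s | 0 <= s <= t]].

(* Equality of measures is only required on measurable sets, where the
   functions set R -> \bar R are meaningful. *)
Definition exponential_rv (lambda : R) (Y : {RV P >-> R}) : Prop :=
  forall B : set R, measurable B ->
    distribution P Y B = exponential_prob lambda B.

End processes.

Definition Gamma (R : realType) (s : R) : R :=
  (\int[lebesgue_measure]_(t in `]0%R, +oo[) (t `^ (s - 1) * expR (- t)))%R.

(* a(lambda) ~ b(lambda) as lambda -> 0+. *)
Definition equiv_at0 (R : realType) (a b : R -> R) : Prop :=
  a l / b l @[l --> (0 : R)^'+] --> (1 : R).

(* Main.v *)
(* The skeleton of X on a grid of mesh h is a random walk with P(walk j >= 0) =
   rho for all j > 0.  A cyclic shift of the increments shows that the mean of
   the last argmax of n steps is the sum of P(walk j >= 0) over 0 < j <= n, that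
   is n rho; splitting the walk at its last argmax turns this into a
   differential equation for generating functions, whose solution is the
   Sparre Andersen identity (1 - q) sum_n P(stay negative for n steps) q^n =
   (1 - q)^rho.  By the same splitting, the distribution function at x of the
   maximum up to a geometric time is (1 - q)^rho times a power series in q with
   nonnegative coefficients.  An exponential time sees the grid at a geometric
   time; letting the mesh tend to 0, l^(-rho) P(S_l <= x) is nonincreasing in
   the rate l, and scaling makes it x^(alpha rho) K(l x^alpha).  Forcing the
   first step below -x turns {max <= x} into {stay negative}, so K is bounded,
   and k is its limit at 0+.
   That P(X_1 < 0) > 0 and rho > 0 comes from alpha > 1: a nonnegative variable
   xi with xi + xi' equal in law to c xi for an independent copy xi' and some
   1 < c < 2 vanishes.  Then (ii) is dominated convergence, with K <= k; (iii)
   follows from exp(-mu max(S,x)) = int_{max(S,x)}^oo mu exp(-mu v) dv at x = 0,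
   and (iv) from the same identity, the absence of atoms in the law of S_l and
   an integration by parts. *)
Require Import Defs.
From HB Require Import structures.
From mathcomp Require Import all_boot all_order all_algebra.
From mathcomp Require Import all_classical all_reals all_analysis.
From mathcomp Require Import measurable_realfun ring lra.
Set Implicit Arguments.
Unset Strict Implicit.
Unset Printing Implicit Defensive.
Import Order.TTheory GRing.Theory Num.Theory.
Import numFieldNormedType.Exports.

Local Open Scope classical_set_scope.
Local Open Scope ring_scope.

(** * Independent identically distributed sequences *)

(** Two facts have to survive the passage to mesh 0. The exact factor (1 - exp(-l h))^rho depends on
    the mesh h; by concavity the ratio of two such factors is at least (l / l')^rho whatever h is,
    and the comparison of two rates is used in that form, free of h. Secondly, the grid points up to
    T may miss the value of the path at T, which right-continuity recovers only from later grid
    points. The horizon is therefore enlarged to c T with c > 1: this is again an exponential time,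
    of rate l / c, so the same comparison of rates bounds the cost of the enlargement by a factor c,
    and c tends to 1. The constant k must be fixed before the family of exponential times is given.
    The grid formula shows that P(S_l <= x) depends on l and x only, so k can be read off from any
    one such family. *)

Definition box (R : realType) (n : nat) (B : nat -> set R) : set (nat -> R) :=
  [set f | forall i, (i < n)%N -> B i (f i)].

(** A pi-system. The index n records that only the first n coordinates are consulted, which is what
    independence of successive blocks refers to. *)
Definition boxes (R : realType) (n : nat) : set_system (nat -> R) :=
  [set A | exists2 B : nat -> set R, (forall i, measurable (B i)) & A = box n B].

(** Every factor is taken in the law of [xi 0], so a single product formula expresses independence
    and equality of the marginals together. *)
Definition iid (d : measure_display) (Omega : measurableType d) (R : realType)
    (P : probability Omega R) (xi : nat -> Omega -> R) :=
  (forall i, measurable_fun setT (xi i)) /\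
  forall n (B : nat -> set R), (forall i, measurable (B i)) ->
    P [set w | box n B (xi ^~ w)] = (\prod_(i < n) P (xi 0%N @^-1` B i))%E.

Section sequence_space.
Context (d : measure_display) (Omega : measurableType d) (R : realType).
Variable P : probability Omega R.
Implicit Types (xi eta : nat -> Omega -> R).

Lemma boxesT n : boxes (R := R) n setT.
Proof.
exists (fun=> setT) => //.
by apply/seteqP; split.
Qed.

Lemma boxesI n : setI_closed (boxes (R := R) n).
Proof.
move=> _ _ [B mB ->] [C mC ->]; exists (fun i => B i `&` C i).
  by move=> i; apply: measurableI.
apply/seteqP; split => f /=.
  by move=> [hB hC] i lin; split; [apply: hB | apply: hC].
by move=> h; split => i lin; case: (h i lin).
Qed.

Lemma measurable_box xi n (B : nat -> set R) :
  (forall i, (i < n)%N -> measurable_fun setT (xi i)) ->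
  (forall i, measurable (B i)) -> measurable [set w | box n B (xi ^~ w)].
Proof.
move=> mxi mB.
have -> : [set w | box n B (xi ^~ w)] =
    \bigcap_(i in `I_n) (xi i @^-1` B i).
  by apply/seteqP; split.
apply: bigcap_measurableType => // i /= lin.
by rewrite -[X in measurable X]setTI; apply: mxi.
Qed.

Lemma measurable_seq xi n A :
  (forall i, (i < n)%N -> measurable_fun setT (xi i)) ->
  <<s boxes n >> A -> measurable [set w | A (xi ^~ w)].
Proof.
move=> mxi sA.
pose phi (w : Omega) : g_sigma_algebraType (boxes (R := R) n) := xi ^~ w.
have mphi : measurable_fun setT phi.
  apply: (@measurability _ _ _ _ setT phi (boxes n)) => //.
  move=> _ [_ [B mB ->] <-]; rewrite setTI.
  exact: measurable_box.
have := mphi measurableT _ sA.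
by rewrite setTI.
Qed.

(** Uniqueness of finite measures on a pi-system. The event [E] lets one statement serve two
    purposes: equality in law when [E] is [setT], and independence from [E] otherwise. *)
Lemma law_unique n xi eta (E : set Omega) (mE : measurable E) :
  (forall i, (i < n)%N -> measurable_fun setT (xi i)) ->
  (forall i, (i < n)%N -> measurable_fun setT (eta i)) ->
  (forall A, boxes n A -> P ([set w | A (xi ^~ w)] `&` E) =
     (P E * P [set w | A (eta ^~ w)])%E) ->
  forall A, <<s boxes n >> A -> P ([set w | A (xi ^~ w)] `&` E) =
     (P E * P [set w | A (eta ^~ w)])%E.
Proof.
move=> mxi meta hbox A sA.
pose T' := g_sigma_algebraType (boxes (R := R) n).
pose phi (w : Omega) : T' := xi ^~ w.
pose psi (w : Omega) : T' := eta ^~ w.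
have mphi : measurable_fun setT phi.
  by move=> _ B sB; rewrite setTI; apply: measurable_seq sB.
have mpsi : measurable_fun setT psi.
  by move=> _ B sB; rewrite setTI; apply: measurable_seq sB.
have PE : (0 <= fine (P E))%R by rewrite fine_ge0.
pose m1 : {measure set T' -> \bar R} := pushforward (mrestr P mE) phi.
pose m2 : {measure set T' -> \bar R} :=
  mscale (NngNum PE) (pushforward P psi).
have : m1 mphi A = m2 mpsi A.
  apply: (@g_sigma_algebra_measure_unique _ R T' (boxes n) _ (fun=> setT)) => //.
  - by move=> B; exact: sub_sigma_algebra.
  - by move=> _; exact: boxesT.
  - by rewrite bigcup_const//; exists 0%N.
  - exact: boxesI.
  - move=> B hB.
    transitivity (P ([set w | B (xi ^~ w)] `&` E)); first by [].
    rewrite (hbox B hB) -[P E]fineK ?fin_num_measure//.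
  - move=> _; apply: (@le_lt_trans _ _ 1%E); last exact: ltry.
    apply: (@probability_le1 _ _ _ P (phi @^-1` setT `&` E)).
    by rewrite preimage_setT setTI.
move=> m12; transitivity (m1 mphi A); first by [].
rewrite m12; transitivity ((fine (P E))%:E * P [set w | A (eta ^~ w)])%E => //.
by rewrite fineK// fin_num_measure.
Qed.

Definition shift (k : nat) (f : nat -> R) : nat -> R := fun i => f (k + i)%N.

(** A rotation of the first n+1 coordinates; values at later indices never matter. *)
Definition cyc (n : nat) (f : nat -> R) : nat -> R :=
  fun i => if i == n then f 0%N else f i.+1.

Variable xi : nat -> Omega -> R.
Hypothesis ixi : iid P xi.

Let mxi i : measurable_fun setT (xi i). Proof. by case: ixi. Qed.

Let boxE n (B : nat -> set R) : (forall i, measurable (B i)) ->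
  P [set w | box n B (xi ^~ w)] = (\prod_(i < n) P (xi 0%N @^-1` B i))%E.
Proof. by case: ixi => _; apply. Qed.

Lemma iid_indep_box k n A B : boxes k A -> boxes n B ->
  P ([set w | A (xi ^~ w)] `&` [set w | B (shift k (xi ^~ w))]) =
  (P [set w | B (xi ^~ w)] * P [set w | A (xi ^~ w)])%E.
Proof.
move=> [A' mA ->] [B' mB ->]; rewrite !boxE//.
pose C i := if (i < k)%N then A' i else B' (i - k)%N.
have mC i : measurable (C i) by rewrite /C; case: ifP.
have -> : [set w | box k A' (xi ^~ w)] `&`
    [set w | box n B' (shift k (xi ^~ w))] =
    [set w | box (k + n) C (xi ^~ w)].
  apply/seteqP; split => w /=.
    move=> [hA hB] i ikn; rewrite /C; case: ltnP => ik; first exact: hA.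
    by have := hB (i - k)%N; rewrite /shift subnKC// ltn_subLR//; apply.
  move=> h; split => i ik.
    by have := h i; rewrite /C ik; apply; rewrite ltn_addr.
  by have := h (k + i)%N; rewrite /C [(k + i < k)%N]ltnNge leq_addr/= addKn ltn_add2l; apply.
rewrite boxE// big_split_ord/= muleC; congr (_ * _)%E; apply: eq_bigr => i _.
  by rewrite /C ltnNge leq_addr/= addKn.
by rewrite /C ltn_ord.
Qed.

Lemma iid_shift k n A : <<s boxes n >> A ->
  P [set w | A (shift k (xi ^~ w))] = P [set w | A (xi ^~ w)].
Proof.
move=> sA; pose eta i := xi (k + i)%N.
have := @law_unique n eta xi setT measurableT _ _ _ A sA.
rewrite setIT probability_setT mul1e.
apply=> [i _|i _|B hB]; [exact: mxi|exact: mxi|].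
have := iid_indep_box (boxesT k) hB.
have -> : [set w | [set: nat -> R] (xi ^~ w)] = setT by apply/seteqP.
by rewrite setTI setIT probability_setT mule1 mul1e.
Qed.

(** Boxes are extended to the generated sigma-algebras one event at a time: [law_unique] is applied
    to [A] with the event of [B] fixed, then to [B] with a box fixed in place of [A]. *)
Lemma iid_indep k n A B : <<s boxes k >> A -> <<s boxes n >> B ->
  P ([set w | A (xi ^~ w)] `&` [set w | B (shift k (xi ^~ w))]) =
  (P [set w | A (xi ^~ w)] * P [set w | B (xi ^~ w)])%E.
Proof.
move=> sA sB; pose eta i := xi (k + i)%N.
have mB : measurable [set w | B (shift k (xi ^~ w))].
  by apply: (@measurable_seq eta n B) => // i _; exact: mxi.
rewrite -(iid_shift k sB) muleC; apply: (@law_unique k xi xi _ mB _ _ _ A sA) => //.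
move=> A' bA'; rewrite setIC.
have mA' : measurable [set w | A' (xi ^~ w)].
  by apply: (@measurable_seq xi k) => //; exact: sub_sigma_algebra.
rewrite [in LHS]/= (iid_shift k sB) muleC.
apply: (@law_unique n eta xi _ mA' _ _ _ B sB) => [i _|i _|B' bB']; [exact: mxi|exact: mxi|].
by rewrite setIC (iid_indep_box bA' bB') muleC.
Qed.

(** On boxes this is commutativity of the product: rotating the coordinates rotates identical
    one-dimensional factors. *)
Lemma iid_cyc n A : <<s boxes n.+1 >> A ->
  P [set w | A (cyc n (xi ^~ w))] = P [set w | A (xi ^~ w)].
Proof.
move=> sA; pose eta i w := cyc n (xi ^~ w) i.
have meta i : measurable_fun setT (eta i).
  by rewrite /eta /cyc; case: (i == n).
have := @law_unique n.+1 eta xi setT measurableT _ _ _ A sA.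
rewrite setIT probability_setT mul1e.
apply=> [i _|i _|_ [B mB ->]]; [exact: meta|exact: mxi|].
rewrite setIT mul1e boxE//.
pose C i := if i is j.+1 then B j else B n.
have mC i : measurable (C i) by case: i => [|j]; exact: mB.
transitivity (P [set w | box n.+1 C (xi ^~ w)]).
  congr (P _); apply/seteqP; split => w /= h i.
    case: i => [_|i]; first by have := h n (ltnSn n); rewrite /eta /cyc eqxx.
    rewrite ltnS => lin; have := h i (ltn_trans lin (ltnSn n)).
    by rewrite /eta /cyc /= (ltn_eqF lin).
  rewrite /eta /cyc /= ltnS leq_eqVlt => /orP[/eqP ->|lin].
    by rewrite eqxx; exact: (h 0%N).
  by rewrite (ltn_eqF lin); exact: (h i.+1).
by rewrite boxE// big_ord_recl big_ord_recr/= muleC.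
Qed.

End sequence_space.

(** * Last argmax and the Sparre Andersen identity *)

Section walk_combinatorics.
Context (R : realType).
Implicit Types (f : nat -> R) (n k m : nat).

Definition walk f n : R := \sum_(i < n) f i.

(** Weak inequalities before k and strict ones after it select the last maximiser, so that for fixed
    n these events form a partition. *)
Definition last_argmax n k : set (nat -> R) := [set f | [/\ (k <= n)%N,
  (forall j, (j <= k)%N -> walk f j <= walk f k) &
  (forall j, (k < j <= n)%N -> walk f j < walk f k)]].

Definition end_max k : set (nat -> R) :=
  [set f | forall j, (j <= k)%N -> walk f j <= walk f k].

Definition stay_neg m : set (nat -> R) :=
  [set f | forall j, (0 < j <= m)%N -> walk f j < 0].

Definition stay_le n (x : R) : set (nat -> R) :=
  [set f | forall j, (j <= n)%N -> walk f j <= x].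

Lemma walk0 f : walk f 0 = 0. Proof. by rewrite /walk big_ord0. Qed.

Lemma walk_shift k f j : walk (shift k f) j = walk f (k + j) - walk f k.
Proof. by rewrite /walk big_split_ord/= addrAC subrr add0r. Qed.

Lemma walk_cyc n f : walk (cyc n f) n.+1 = walk f n.+1.
Proof.
rewrite /walk big_ord_recr big_ord_recl/= addrC /cyc eqxx; congr (_ + _).
by apply: eq_bigr => i _; rewrite (ltn_eqF (ltn_ord i)).
Qed.

Lemma walk_cyc_lt n f j : (j <= n)%N -> walk (cyc n f) j = walk (shift 1 f) j.
Proof.
move=> jn; apply: eq_bigr => i _; rewrite /cyc /shift add1n ifF//.
by rewrite ltn_eqF// (leq_trans (ltn_ord i)).
Qed.

Lemma last_argmax_le n k f j : last_argmax n k f -> (j <= n)%N ->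
  walk f j <= walk f k.
Proof.
move=> [kn hle hlt] jn; case: (leqP j k) => jk; first exact: hle.
by apply/ltW/hlt; rewrite jk.
Qed.

(** The two conditions consult disjoint blocks of steps, the first k and the following n - k, hence
    are independent for an iid sequence. *)
Lemma last_argmax_split n k f : (k <= n)%N ->
  last_argmax n k f <-> end_max k f /\ stay_neg (n - k) (shift k f).
Proof.
move=> kn; split=> [[_ hle hlt]|[hle hneg]]; split => //.
  move=> j /andP[j0 jnk]; rewrite walk_shift subr_lt0; apply: hlt.
  by rewrite -[X in (X < _)%N]addn0 ltn_add2l j0/= -leq_subRL.
move=> j /andP[kj jn]; have := hneg (j - k)%N.
by rewrite walk_shift subnKC ?(ltnW kj)// subr_lt0; apply; rewrite subn_gt0 kj leq_sub2r.
Qed.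

Lemma last_argmax_neg n k f : walk f n.+1 < 0 ->
  last_argmax n.+1 k f <-> last_argmax n k f.
Proof.
move=> s0; split=> [[kn hle hlt]|[kn hle hlt]].
  have {}kn : (k <= n)%N.
    move: kn hle; rewrite leq_eqVlt => /orP[/eqP->|//] /(_ 0%N isT).
    by rewrite walk0 leNgt s0.
  by split => // j /andP[kj jn]; apply: hlt; rewrite kj ltnW.
split; [exact: leqW|by []|move=> j /andP[kj]].
rewrite leq_eqVlt ltnS => /orP[/eqP->|jn]; last by apply: hlt; rewrite kj.
by apply: lt_le_trans s0 _; rewrite -(walk0 f); exact: hle.
Qed.

Lemma last_argmax_ge0_0 n f : 0 <= walk f n.+1 -> ~ last_argmax n.+1 0 f.
Proof.
by move=> s0 [_ _ /(_ n.+1)]; rewrite ltnSn walk0 ltNge s0 => /(_ isT).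
Qed.

Lemma last_argmax_ge0 n k f : 0 <= walk f n.+1 ->
  last_argmax n.+1 k.+1 f <-> last_argmax n k (shift 1 f).
Proof.
move=> s0; split=> [[kn hle hlt]|h].
  split => // j => [jk|/andP[kj jn]]; rewrite !walk_shift !add1n.
    by rewrite lerD2r; exact: hle.
  by rewrite ltrD2r; apply: hlt; rewrite !ltnS kj jn.
case: (h) => [kn hle hlt]; split => //.
  case=> [_|j jk]; last by have := hle j jk; rewrite !walk_shift !add1n lerD2r.
  rewrite walk0; apply: le_trans s0 _.
  have := last_argmax_le h (leqnn n).
  by rewrite !walk_shift !add1n lerD2r.
case=> // j /andP[kj jn]; have := hlt j.
by rewrite !walk_shift !add1n ltrD2r; apply; rewrite -ltnS kj.
Qed.

Lemma last_argmax_exists n f : exists k, last_argmax n k f.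
Proof.
elim: n f => [|n IH] f.
  by exists 0%N; split => // j; [rewrite leqn0 => /eqP->|case: j].
have [s0|s0] := ltP (walk f n.+1) 0.
  by have [k hk] := IH f; exists k; apply/last_argmax_neg.
by have [k hk] := IH (shift 1 f); exists k.+1; apply/last_argmax_ge0.
Qed.

Lemma last_argmax_unique n k k' f :
  last_argmax n k f -> last_argmax n k' f -> k = k'.
Proof.
wlog kk : k k' / (k <= k')%N.
  move=> H h h'; case: (leqP k k') => kk; first exact: H.
  by apply/esym/H => //; exact: ltnW.
move=> [_ _ hlt] [k'n hle _]; apply/eqP; move: kk.
rewrite leq_eqVlt => /orP[//|kk].
have := hlt k'; rewrite kk k'n => /(_ isT).
by rewrite ltNge hle// ltnW.
Qed.

Lemma measurable_coord n i : (i < n)%N ->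
  measurable_fun setT (fun f : g_sigma_algebraType (boxes (R := R) n) => f i).
Proof.
move=> lin _ B mB; rewrite setTI.
apply: sub_sigma_algebra; exists (fun k => if k == i then B else setT).
  by move=> k; case: ifP.
apply/seteqP; split => f /=.
  by move=> Bf k kn; case: eqP => // ->.
by move=> /(_ i lin); rewrite eqxx.
Qed.

Lemma measurable_walk n j : (j <= n)%N ->
  measurable_fun setT (walk^~ j : g_sigma_algebraType (boxes (R := R) n) -> R).
Proof.
move=> jn; apply: measurable_sum => i; apply: measurable_coord.
by apply: leq_trans (ltn_ord i) jn.
Qed.

Lemma boxes_le n (u v : (nat -> R) -> R) :
  measurable_fun setT (u : g_sigma_algebraType (boxes (R := R) n) -> R) ->
  measurable_fun setT (v : g_sigma_algebraType (boxes (R := R) n) -> R) ->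
  <<s boxes n >> [set f | u f <= v f].
Proof.
move=> mu mv; have /(_ measurableT [set true]) := measurable_fun_ler mu mv.
by rewrite setTI; apply.
Qed.

Lemma boxes_lt n (u v : (nat -> R) -> R) :
  measurable_fun setT (u : g_sigma_algebraType (boxes (R := R) n) -> R) ->
  measurable_fun setT (v : g_sigma_algebraType (boxes (R := R) n) -> R) ->
  <<s boxes n >> [set f | u f < v f].
Proof.
move=> mu mv; have /(_ measurableT [set true]) := measurable_fun_ltr mu mv.
by rewrite setTI; apply.
Qed.

Lemma boxes_bigcap n (D : set nat) (F : nat -> set (nat -> R)) :
  (forall i, D i -> <<s boxes n >> (F i)) ->
  <<s boxes n >> [set f | forall i, D i -> F i f].
Proof.
exact: (@bigcap_measurableType _ (g_sigma_algebraType (boxes (R := R) n)) F D).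
Qed.

Lemma boxes_setI n (A B : set (nat -> R)) :
  <<s boxes n >> A -> <<s boxes n >> B -> <<s boxes n >> (A `&` B).
Proof. exact: (@measurableI _ (g_sigma_algebraType (boxes (R := R) n))). Qed.

Lemma boxes_end_max k n : (k <= n)%N -> <<s boxes n >> (end_max k).
Proof.
move=> kn; apply: (@boxes_bigcap n (fun j => (j <= k)%N)
  (fun j => [set f | walk f j <= walk f k])) => j jk.
by apply: boxes_le; apply: measurable_walk => //; apply: leq_trans jk kn.
Qed.

Lemma boxes_stay_neg n : <<s boxes n >> (stay_neg n).
Proof.
apply: (@boxes_bigcap n (fun j => (0 < j <= n)%N)
  (fun j => [set f | walk f j < 0])) => j /andP[_ jn].
by apply: boxes_lt; [exact: measurable_walk|exact: measurable_cst].
Qed.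

Lemma boxes_stay_le n x : <<s boxes n >> (stay_le n x).
Proof.
apply: (@boxes_bigcap n (fun j => (j <= n)%N)
  (fun j => [set f | walk f j <= x])) => j jn.
by apply: boxes_le; [exact: measurable_walk|exact: measurable_cst].
Qed.

Lemma boxes_last_argmax k n N : (n <= N)%N -> <<s boxes N >> (last_argmax n k).
Proof.
move=> nN.
case: (leqP k n) => kn; last first.
  rewrite (_ : last_argmax n k = set0).
    exact: (@measurable0 _ (g_sigma_algebraType (boxes (R := R) N))).
  by rewrite -subset0 => f [] /=; rewrite leqNgt kn.
have -> : last_argmax n k = end_max k `&`
    [set f | forall j, (k < j <= n)%N -> walk f j < walk f k].
  by apply/seteqP; split => [f [_ ? ?]|f [? ?]].
apply: boxes_setI; first by apply: boxes_end_max; exact: leq_trans kn nN.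
apply: (@boxes_bigcap N (fun j => (k < j <= n)%N)
  (fun j => [set f | walk f j < walk f k])) => j /andP[_ jn].
by apply: boxes_lt; apply: measurable_walk; apply: leq_trans nN.
Qed.

End walk_combinatorics.

(** * Probabilities of the argmax events *)

Section sparre_andersen.
Context (d : measure_display) (Omega : measurableType d) (R : realType).
Variables (P : probability Omega R) (xi : nat -> Omega -> R).
Hypothesis ixi : iid P xi.

Definition pr (A : set (nat -> R)) : R := fine (P [set w | A (xi ^~ w)]).

Let mseq n A : <<s boxes n >> A -> measurable [set w | A (xi ^~ w)].
Proof. by move=> sA; apply: measurable_seq sA => i _; case: ixi. Qed.

Lemma prK n A : <<s boxes n >> A -> (pr A)%:E = P [set w | A (xi ^~ w)].
Proof. by move=> sA; rewrite /pr fineK// fin_num_measure//; exact: mseq sA. Qed.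

Lemma pr_ge0 A : 0 <= pr A. Proof. exact/fine_ge0/measure_ge0. Qed.

Lemma pr_le1 n A : <<s boxes n >> A -> pr A <= 1.
Proof.
by move=> sA; rewrite -lee_fin (prK sA) probability_le1//; exact: mseq sA.
Qed.

Lemma pr_le n A B : <<s boxes n >> A -> <<s boxes n >> B -> A `<=` B ->
  pr A <= pr B.
Proof.
move=> sA sB AB; rewrite -lee_fin (prK sA) (prK sB) le_measure ?inE//.
- exact: mseq sA.
- exact: mseq sB.
- by move=> w /=; exact: AB.
Qed.

(** [A] may consult more coordinates than the argmax does, as the sign of the walk at n+1 will in
    [mean_last_argmax]. *)
Lemma pr_partition (n N : nat) (A : set (nat -> R)) : (n <= N)%N -> <<s boxes N >> A ->
  pr A = \sum_(k < n.+1) pr (A `&` last_argmax n k).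
Proof.
move=> nN sA; apply: EFin_inj; rewrite (prK sA) -sumEFin.
have sAk k : <<s boxes N >> (A `&` last_argmax n k).
  by apply: boxes_setI => //; by apply: boxes_last_argmax.
under eq_bigr do rewrite (prK (sAk _)).
have hU : [set w | A (xi ^~ w)] =
    \big[setU/set0]_(k < n.+1) [set w | (A `&` last_argmax n k) (xi ^~ w)].
  rewrite -(bigcup_mkord n.+1 (fun k => [set w | (A `&` last_argmax n k) (xi ^~ w)])).
  apply/seteqP; split => w /= => [Aw|[k _ []//]].
  by have [k hk] := last_argmax_exists n (xi ^~ w); exists k => //; case: (hk).
rewrite hU (@measure_semi_additive_ord _ _ _ P n.+1
  (fun k : 'I_n.+1 => [set w | (A `&` last_argmax n k) (xi ^~ w)]))//.
- by move=> k; apply: mseq (sAk k).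
- move=> i j _ _ [w [[_ hi] [_ hj]]]; apply/val_inj.
  exact: last_argmax_unique hi hj.
- by rewrite -hU; apply: mseq sA.
Qed.

Lemma pr_indep k n A B : <<s boxes k >> A -> <<s boxes n >> B ->
  pr (A `&` (fun f => B (shift k f))) = pr A * pr B.
Proof.
move=> sA sB; rewrite {1}/pr.
have -> : [set w | (A `&` (fun f => B (shift k f))) (xi ^~ w)] =
  [set w | A (xi ^~ w)] `&` [set w | B (shift k (xi ^~ w))] by [].
by rewrite (iid_indep ixi sA sB) fineM// fin_num_measure//;
  [exact: mseq sA|exact: mseq sB].
Qed.

Lemma pr_last_argmax n k : (k <= n)%N ->
  pr (last_argmax n k) = pr (end_max k) * pr (stay_neg (n - k)).
Proof.
move=> kn; rewrite -(pr_indep (boxes_end_max (leqnn k)) (@boxes_stay_neg R (n - k))).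
by congr pr; apply/seteqP; split => f /(last_argmax_split _ kn).
Qed.

Lemma end_max_stay_neg_sum n :
  \sum_(k < n.+1) pr (end_max k) * pr (stay_neg (n - k)) = 1.
Proof.
have sT : <<s boxes (R := R) n >> setT.
  exact: (@measurableT _ (g_sigma_algebraType (boxes (R := R) n))).
have : pr setT = 1.
  rewrite /pr (_ : [set w | _] = setT) ?probability_setT//.
rewrite (pr_partition (leqnn n) sT) => <-; apply: eq_bigr => k _.
by rewrite setTI pr_last_argmax// -ltnS.
Qed.

(** The maximum is the value at the last argmax, so the level x constrains only the block before it;
    the factor [stay_neg] is the same for all x. *)
Lemma stay_le_sum n (x : R) :
  pr (stay_le n x) = \sum_(k < n.+1)
    pr (end_max k `&` [set f | walk f k <= x]) * pr (stay_neg (n - k)).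
Proof.
rewrite (pr_partition (leqnn n) (boxes_stay_le x (n := n))); apply: eq_bigr => k _.
have kn : (k <= n)%N by rewrite -ltnS.
have s1 : <<s boxes k >> (end_max k `&` [set f : nat -> R | walk f k <= x]).
  apply: boxes_setI; first exact: boxes_end_max.
  by apply: boxes_le; [exact: measurable_walk|exact: measurable_cst].
rewrite -(pr_indep s1 (@boxes_stay_neg R (n - k))); congr pr.
apply/seteqP; split => f.
  move=> [hx hL]; split; last by have /(last_argmax_split _ kn)[] := hL.
  by split; [have /(last_argmax_split _ kn)[] := hL|exact: hx].
move=> [[hm hx] hn]; have hL : last_argmax n k f.
  by apply/last_argmax_split.
split => // j jn; apply: le_trans hx; exact: last_argmax_le hL jn.
Qed.

Lemma pr_split_sign n A : <<s boxes n >> A ->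
  pr A = pr ((fun f => walk f n < 0) `&` A) + pr ((fun f => 0 <= walk f n) `&` A).
Proof.
move=> sA; have sneg : <<s boxes n >> [set f : nat -> R | walk f n < 0].
  by apply: boxes_lt; [exact: measurable_walk|exact: measurable_cst].
have sge0 : <<s boxes n >> [set f : nat -> R | 0 <= walk f n].
  by apply: boxes_le; [exact: measurable_cst|exact: measurable_walk].
apply: EFin_inj; rewrite EFinD (prK sA) !(prK (boxes_setI _ sA))//.
rewrite -measureU//.
- congr (P _); apply/seteqP; split => w /=; last by move=> [[]|[]].
  by move=> hw; case: (ltP (walk (xi ^~ w) n) 0) => h; [left|right].
- exact: mseq (boxes_setI sneg sA).
- exact: mseq (boxes_setI sge0 sA).
- by rewrite -subset0 => w [[/= h _] [h' _]]; move: h; rewrite ltNge h'.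
Qed.

(** When the end value is at least 0, the first step can be removed from the argmax event. The
    rotation [cyc] carries that step to the end: it changes neither the end value nor the law, and
    the argmax event becomes one about the first n steps of the same walk, jointly with the sign of
    the walk at n+1. *)
Lemma last_argmax_recr n k :
  pr (last_argmax n.+1 k) =
    pr ((fun f => walk f n.+1 < 0) `&` last_argmax n k) +
    (if k is j.+1 then pr ((fun f => 0 <= walk f n.+1) `&` last_argmax n j) else 0).
Proof.
have sge0 : <<s boxes n.+1 >> [set f : nat -> R | 0 <= walk f n.+1].
  by apply: boxes_le; [exact: measurable_cst|exact: measurable_walk].
rewrite (pr_split_sign (boxes_last_argmax k (leqnn n.+1))).
congr (_ + _).
  by congr pr; apply/seteqP; split => f [/= s0 h]; split => //; apply/last_argmax_neg.
case: k => [|k].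
  rewrite (_ : _ `&` _ = set0) /pr.
    by rewrite (_ : [set w | _] = set0) ?measure0//; apply/seteqP.
  by rewrite -subset0 => f [/= s0]; exact: last_argmax_ge0_0.
have sL' : <<s boxes n.+1 >> (last_argmax (R := R) n k).
  by apply: boxes_last_argmax.
have last_argmax_cyc f : last_argmax n k (cyc n f) <-> last_argmax n k (shift 1 f).
  split=> -[kn hle hlt]; split=> // j hj.
  - by have := hle j hj; rewrite !walk_cyc_lt// (leq_trans hj).
  - by have := hlt j hj; rewrite !walk_cyc_lt//; case/andP: hj.
  - by have := hle j hj; rewrite !walk_cyc_lt// (leq_trans hj).
  - by have := hlt j hj; rewrite !walk_cyc_lt//; case/andP: hj.
rewrite /pr -(iid_cyc ixi (boxes_setI sge0 sL')); congr (fine (P _)).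
apply/seteqP; split => w [/= s0 h].
  split => /=; first by rewrite walk_cyc.
  exact/last_argmax_cyc/(last_argmax_ge0 _ s0).
move: s0; rewrite walk_cyc => s0; split => //=.
exact/(last_argmax_ge0 _ s0)/last_argmax_cyc.
Qed.

(** By [last_argmax_recr], passing from n to n+1 steps raises the argmax by one exactly on an event
    with the probability of {walk (n+1) >= 0}, and leaves it unchanged in law otherwise. *)
Lemma mean_last_argmax n :
  \sum_(k < n.+1) k%:R * pr (last_argmax n k) =
  \sum_(1 <= j < n.+1) pr [set f | 0 <= walk f j].
Proof.
elim: n => [|n IH]; first by rewrite big_ord1 mul0r big_nil.
rewrite big_nat_recr//= -IH.
pose a k := pr ((fun f => walk f n.+1 < 0) `&` last_argmax n k).
pose e k := pr ((fun f => 0 <= walk f n.+1) `&` last_argmax n k).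
have last_argmax0 : last_argmax (R := R) n n.+1 = set0.
  by rewrite -subset0 => f []; rewrite ltnn.
have pr0 : pr set0 = 0.
  by rewrite /pr (_ : [set w | _] = set0) ?measure0//; apply/seteqP.
under [in RHS]eq_bigr => k _.
  rewrite (pr_split_sign (boxes_last_argmax k (leqnSn n))) -/(a k) -/(e k).
  over.
have -> : pr [set f | 0 <= walk f n.+1] = \sum_(k < n.+1) e k.
  have sge0 : <<s boxes n.+1 >> [set f : nat -> R | 0 <= walk f n.+1].
    by apply: boxes_le; [exact: measurable_cst|exact: measurable_walk].
  by rewrite (pr_partition (leqnSn n) sge0).
have a0 : a n.+1 = 0.
  by rewrite /a last_argmax0 setI0.
rewrite big_ord_recl/= mul0r add0r.
under eq_bigr => k _ do rewrite /bump leq0n add1n last_argmax_recr -/(a _) -/(e _) mulrDr.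
rewrite big_split/=.
have -> : \sum_(k < n.+1) k.+1%:R * a k.+1 = \sum_(k < n.+1) k%:R * a k.
  rewrite [RHS]big_ord_recl/= mul0r add0r big_ord_recr/= a0 mulr0 addr0.
  by apply: eq_bigr => k _; rewrite /bump leq0n add1n.
under [in RHS]eq_bigr do rewrite mulrDr.
rewrite big_split/= -addrA; congr (_ + _); rewrite -big_split/=.
by apply: eq_bigr => k _; rewrite -[X in _ = _ + X]mul1r -mulrDl -natr1.
Qed.

End sparre_andersen.

(** * Power series with bounded coefficients and Cauchy products *)

Section generating_functions.
Context (R : realType).
Implicit Types (u v b c : nat -> R) (q s : R).

(** Each of the n terms s^i with i < n is at least s^n, and their sum is at most 1 / (1 - s). *)
Lemma natmul_expr_le s n : 0 <= s < 1 -> n%:R * s ^+ n <= (1 - s)^-1.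
Proof.
move=> /andP[s0 s1]; have s1' : 0 < 1 - s by rewrite subr_gt0.
rewrite -[leRHS]mul1r ler_pdivlMr//.
apply: (@le_trans _ _ ((\sum_(i < n) s ^+ i) * (1 - s))).
  rewrite ler_wpM2r//; first exact: ltW.
  rewrite (_ : n%:R * s ^+ n = \sum_(i < n) s ^+ n); last first.
    by rewrite sumr_const card_ord mulr_natl.
  by apply: ler_sum => i _; rewrite ler_wiXn2l ?(ltW s1)// ltnW.
by rewrite mulrC -[1 - s]opprB mulNr -subrX1 opprB gerBl exprn_ge0.
Qed.

Lemma cvg_pseries_geometric u q (M s : R) : 0 <= s < 1 ->
  (forall n, `|u n * q ^+ n| <= M * s ^+ n) -> cvgn (pseries u q).
Proof.
move=> /andP[s0 s1] hu; apply: normed_cvg.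
apply: (@series_le_cvg _ _ (geometric M s)) => //.
- by move=> n /=.
- by move=> n; exact: (le_trans (normr_ge0 _) (hu n)).
- by apply: is_cvg_geometric_series; rewrite ger0_norm.
Qed.

Lemma bounded_pseries_cvg u q : (forall n, `|u n| <= 1) -> 0 <= q < 1 ->
  cvgn (pseries u q).
Proof.
move=> hu /andP[q0 q1]; apply: (@cvg_pseries_geometric _ _ 1 q); first by rewrite q0.
by move=> n; rewrite normrM [`|q ^+ n|]ger0_norm ?ler_wpM2r ?exprn_ge0.
Qed.

Lemma bounded_pseries_diffs_cvg u q : (forall n, `|u n| <= 1) -> 0 < q < 1 ->
  cvgn (pseries (pseries_diffs u) q) /\
  cvgn (pseries (pseries_diffs (pseries_diffs u)) q).
Proof.
(* With t = (1 - q) / 4 one has q = 1 - 4 t <= (1 - t)^3 = s^3. Two factors s^n absorb the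
   polynomial coefficients n+1 and n+2, and the third leaves a geometric series. *)
move=> hu /andP[q0 q1]; pose s := 1 - (1 - q) / 4.
have s0 : 0 < s by rewrite /s; lra.
have s1 : s < 1 by rewrite /s; lra.
have s01 : 0 <= s < 1 by rewrite (ltW s0) s1.
have qs n : q ^+ n <= s ^+ n * s ^+ n * s ^+ n.
  rewrite -!exprMn lerXn2r ?nnegrE ?(ltW q0)//; first by rewrite !mulr_ge0// ltW.
  have -> : q = 1 - 4 * ((1 - q) / 4) by lra.
  rewrite /s; set t := (1 - q) / 4.
  have t0 : 0 <= t by rewrite /t; lra.
  have t1 : 0 <= t * t * (3 - t) by rewrite !mulr_ge0// /t; lra.
  by rewrite -subr_ge0; apply: le_trans (addr_ge0 t0 t1) _; lra.
have sn1 n : 0 <= s ^+ n <= 1 by rewrite exprn_ge0 ?(ltW s0)// exprn_ile1// ltW.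
have hS k n : (n + k)%:R * s ^+ n <= (s ^+ k)^-1 * (1 - s)^-1.
  rewrite ler_pdivlMl ?exprn_gt0// mulrCA -exprD addnC.
  exact: natmul_expr_le.
split.
  apply: (@cvg_pseries_geometric _ _ ((s ^+ 1)^-1 * (1 - s)^-1) s) => // n.
  rewrite /pseries_diffs !normrM normr_nat [`|q ^+ n|]ger0_norm ?exprn_ge0 ?(ltW q0)//.
  have := hS 1%N n; have := qs n; have := hu n.+1; have := sn1 n.
  have := exprn_ge0 n (ltW q0); have := normr_ge0 (u n.+1).
  rewrite addn1; set a := s ^+ n; set w := q ^+ n; set M := _ * _^-1.
  set N : R := n.+1%:R => u0 w0 /andP[a0 a1] u1 wa Na.
  apply: (@le_trans _ _ (N * (a * a * a))).
    by rewrite -mulrA ler_wpM2l// (le_trans _ wa)// ler_piMl.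
  rewrite !mulrA ler_wpM2r// (le_trans _ Na)// -[leRHS]mulr1.
  by rewrite ler_wpM2l// mulr_ge0.
apply: (@cvg_pseries_geometric _ _ (((s ^+ 1)^-1 * (1 - s)^-1) * ((s ^+ 2)^-1 * (1 - s)^-1)) s) => // n.
rewrite /pseries_diffs !normrM !normr_nat [`|q ^+ n|]ger0_norm ?exprn_ge0 ?(ltW q0)//.
have := hS 1%N n; have := hS 2%N n; have := qs n; have := hu n.+2.
have := sn1 n; have := exprn_ge0 n (ltW q0); have := normr_ge0 (u n.+2).
rewrite addn1 addn2; set a := s ^+ n; set w := q ^+ n.
set M1 := _ * _^-1; set M2 := _ * _^-1.
set N1 : R := n.+1%:R; set N2 : R := n.+2%:R => u0 w0 /andP[a0 a1] u1 wa NM2 NM1.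
apply: (@le_trans _ _ (N1 * N2 * (a * a * a))).
  rewrite -!mulrA ler_wpM2l// ler_wpM2l// !mulrA (le_trans _ wa)// ler_piMl//.
rewrite [leLHS](_ : _ = (N1 * a) * (N2 * a) * a); last by ring.
by rewrite ler_wpM2r// ler_pM// mulr_ge0.
Qed.

Lemma is_derive_bounded_pseries u q : (forall n, `|u n| <= 1) -> `|q| < 1 ->
  is_derive q (1 : R) (fun x => limn (pseries u x)) (limn (pseries (pseries_diffs u) q)).
Proof.
move=> hu q1; pose K := (`|q| + 1) / 2.
have K01 : 0 < K < 1 by rewrite /K; have := normr_ge0 q; lra.
have [h1 h2] := bounded_pseries_diffs_cvg hu K01.
apply: (pseries_snd_diffs (K := K)) => //.
- by apply: bounded_pseries_cvg => //; case/andP: K01 => /ltW -> ->.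
- by rewrite (ger0_norm (ltW (proj1 (andP K01)))) /K; lra.
Qed.

Lemma pseries_nneseries u q : (forall n, 0 <= u n) -> 0 <= q ->
  cvgn (pseries u q) ->
  (limn (pseries u q))%:E = (\sum_(n <oo) (u n * q ^+ n)%:E)%E.
Proof.
move=> u0 q0 cu; rewrite -EFin_lim//; apply: congr_lim; apply/funext => n /=.
by rewrite /pseries /series/= -sumEFin.
Qed.

(** Tonelli for series: the triangle k <= n is extended by zeros to the array [a], whose two
    iterated sums agree because its terms are nonnegative. *)
Lemma nneseries_cauchy_prod u v (V : R) : (forall n, 0 <= u n) -> (forall n, 0 <= v n) ->
  (\sum_(n <oo) (v n)%:E)%E = V%:E ->
  (\sum_(n <oo) (\sum_(k < n.+1) u k * v (n - k)%N)%:E)%E =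
  (V%:E * \sum_(n <oo) (u n)%:E)%E.
Proof.
move=> u0 v0 hV.
pose a k n : \bar R := if (k <= n)%N then (u k * v (n - k)%N)%:E else 0%E.
have a0 k n : (0 <= a k n)%E.
  by rewrite /a; case: ifP => // _; rewrite lee_fin mulr_ge0.
transitivity (\sum_(n <oo) \sum_(k <oo) a k n)%E.
  apply: eq_eseriesr => n _.
  rewrite (@nneseries_split _ _ 0%N n.+1)// add0n.
  rewrite [X in (_ = _ + X)%E]eseries0; last first.
    by move=> k nk _; rewrite /a leqNgt nk.
  rewrite adde0 big_mkord -sumEFin; apply: eq_bigr => k _.
  by rewrite /a -ltnS ltn_ord.
rewrite nneseries_interchange; last by [].
rewrite -nneseriesZl; last by move=> i _; rewrite lee_fin.
apply: eq_eseriesr => k _.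
rewrite (@nneseries_split _ _ 0%N k)// add0n big1_seq ?add0e; last first.
  move=> n; rewrite mem_index_iota => /andP[_ /andP[_ nk]].
  by rewrite /a leqNgt nk.
have -> : (\sum_(k <= n <oo) a k n = \sum_(i <oo) a k (i + k)%N)%E.
  by rewrite (nneseries_addn (f := a k)).
transitivity (\sum_(i <oo) ((u k)%:E * (v i)%:E))%E.
  by apply: eq_eseriesr => i _; rewrite /a leq_addl addnK EFinM.
rewrite nneseriesZl; last by move=> i _; rewrite lee_fin.
by rewrite hV muleC.
Qed.

Lemma pseries_cauchy_prod u v q : (forall n, 0 <= u n) -> (forall n, 0 <= v n) ->
  0 <= q -> cvgn (pseries u q) -> cvgn (pseries v q) ->
  (\sum_(n <oo) ((\sum_(k < n.+1) u k * v (n - k)%N) * q ^+ n)%:E)%E =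
  (limn (pseries u q) * limn (pseries v q))%:E.
Proof.
move=> u0 v0 q0 cu cv.
have uq n : 0 <= u n * q ^+ n by rewrite mulr_ge0// exprn_ge0.
have vq n : 0 <= v n * q ^+ n by rewrite mulr_ge0// exprn_ge0.
rewrite mulrC EFinM (pseries_nneseries u0 q0 cu).
rewrite -(nneseries_cauchy_prod uq vq (esym (pseries_nneseries v0 q0 cv))).
apply: eq_eseriesr => n _; congr (_%:E); rewrite big_distrl/=.
apply: eq_bigr => k _; rewrite [RHS]mulrACA -exprD subnKC//.
by rewrite -ltnS.
Qed.

(* Both generating functions are recovered from the two convolution identities:
   the second one is a differential equation for the first. *)
Lemma convolution_power b c (rho q : R) :
  (forall n, 0 <= b n <= 1) -> (forall n, 0 <= c n <= 1) -> b 0%N = 1 ->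
  (forall n, \sum_(k < n.+1) b k * c (n - k)%N = 1) ->
  (forall n, \sum_(k < n.+1) k%:R * (b k * c (n - k)%N) = n%:R * rho) ->
  0 < q < 1 -> (1 - q) * limn (pseries c q) = (1 - q) `^ rho.
Proof.
move=> hb hc b0 hbc hmean q01.
have nb n : `|b n| <= 1 by case/andP: (hb n) => ? ?; rewrite ger0_norm.
have nc n : `|c n| <= 1 by case/andP: (hc n) => ? ?; rewrite ger0_norm.
have b_ge0 n : 0 <= b n by case/andP: (hb n).
have c_ge0 n : 0 <= c n by case/andP: (hc n).
pose B (x : R) : R := limn (pseries b x).
pose C (x : R) : R := limn (pseries c x).
pose B' (x : R) : R := limn (pseries (pseries_diffs b) x).
have BC (x : R) : 0 < x < 1 -> B x * C x = (1 - x)^-1.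
  move=> /andP[x0 x1]; have cb : cvgn (pseries b x).
    by apply: bounded_pseries_cvg => //; rewrite (ltW x0).
  have cc : cvgn (pseries c x).
    by apply: bounded_pseries_cvg => //; rewrite (ltW x0).
  apply: EFin_inj; rewrite -(pseries_cauchy_prod b_ge0 c_ge0 (ltW x0) cb cc).
  under eq_eseriesr do rewrite hbc.
  rewrite -pseries_nneseries//; last 2 first.
  - exact: ltW.
  - by apply: bounded_pseries_cvg => [n|]; rewrite ?normr1 ?(ltW x0).
  congr (_%:E); rewrite -[RHS]mul1r; apply/cvg_lim => //.
  by apply: cvg_geometric_series; rewrite ger0_norm// ltW.
(* The weight k becomes a derivative of the first series, so the coefficient of x^n in B' C is (n +
   1) rho; and sum (n + 1) x^n is the Cauchy square of the geometric series. *)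
have B'C (x : R) : 0 < x < 1 -> B' x * C x = rho / (1 - x) ^+ 2.
  move=> /andP[x0 x1]; have x0' := ltW x0.
  have cb : cvgn (pseries (pseries_diffs b) x).
    by have [] := bounded_pseries_diffs_cvg nb (introT andP (conj x0 x1)).
  have cc : cvgn (pseries c x).
    by apply: bounded_pseries_cvg => //; rewrite x0'.
  have c1 : cvgn (pseries (fun=> 1) x).
    by apply: bounded_pseries_cvg => [n|]; rewrite ?normr1 ?x0'.
  have l1 : limn (pseries (fun=> 1) x) = (1 - x)^-1.
    rewrite -[RHS]mul1r; apply/cvg_lim => //.
    by apply: cvg_geometric_series; rewrite ger0_norm.
  have db0 n : 0 <= pseries_diffs b n by rewrite /pseries_diffs mulr_ge0.
  apply: EFin_inj; rewrite -(pseries_cauchy_prod db0 c_ge0 x0' cb cc).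
  have := @pseries_cauchy_prod (fun=> 1) (fun=> 1) x (fun=> ler01) (fun=> ler01) x0' c1 c1.
  rewrite l1 -invfM -expr2 EFinM => <-.
  rewrite -nneseriesZl; last first.
    by move=> n _; rewrite lee_fin mulr_ge0 ?exprn_ge0// sumr_ge0.
  apply: eq_eseriesr => n _; rewrite -EFinM mulrA; congr (_ * _)%:E.
  rewrite expr1n [in RHS]sumr_const card_ord mulrC -hmean [RHS]big_ord_recl/= mul0r add0r.
  by apply: eq_bigr => k _; rewrite /pseries_diffs mulrA.
have hder (x : R) : `|x| < 1 -> is_derive x (1 : R) B (B' x).
  exact: is_derive_bounded_pseries.
have ODE (x : R) : 0 < x < 1 -> B' x * (1 - x) = rho * B x.
  move=> x01; have C0 : C x != 0.
    apply/eqP => C0; have := BC x x01; rewrite C0 mulr0 => /esym/eqP.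
    by rewrite invr_eq0; case/andP: x01 => ? ?; rewrite subr_eq0 gt_eqF.
  apply: (mulIf C0); rewrite mulrAC B'C// -[RHS]mulrA BC// expr2 invfM.
  by case/andP: x01 => ? ?; rewrite mulrA mulfVK// subr_eq0 gt_eqF.
(* By the differential equation f has derivative 0, and f 0 = 1. Thus B q = (1 - q)^(-rho), and the
   product B C gives C. *)
pose f (x : R) : R := B x * (1 - x) `^ rho.
have df (x : R) : `|x| < 1 -> is_derive x (1 : R) f
    (B' x * (1 - x) `^ rho - B x * (rho * (1 - x) `^ (rho - 1))).
  move=> x1; have := hder x x1 => dB.
  have x1' : 0 < 1 - x by move: x1; rewrite ltr_norml subr_gt0 => /andP[].
  have dp : is_derive x (1 : R) (fun y : R => (1 - y) `^ rho)
      (- (rho * (1 - x) `^ (rho - 1))).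
    have d1 : is_derive x (1 : R) (fun y : R => 1 - y) (- 1 : R).
      by rewrite -[X in is_derive _ _ _ X]add0r; apply: is_deriveB.
    have d2 := is_derive1_powR rho x1'.
    have := @is_derive1_comp _ (fun z : R => z `^ rho) (fun y : R => 1 - y) x _ _ d2 d1.
    by rewrite mulrN1.
  have h := is_deriveM dB dp.
  apply: (is_derive_eq h); rewrite /GRing.scale/=; ring.
have B0 : B 0 = 1.
  rewrite /B; apply/cvg_lim => //; apply: cvg_near_cst.
  exists 1%N => // n /= n0; rewrite /pseries /series/=.
  by rewrite -(prednK n0) big_nat_recl// expr0 mulr1 b0 big1 ?addr0// => i _; rewrite expr0n mulr0.
have [q0 q1] := andP q01.
have [||t _] := @MVT _ f (fun=> 0) 0 q q0.
- move=> x; rewrite in_itv/= => /andP[x0 xq].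
  have x1 : x < 1 by apply: lt_trans q1.
  have nx : `|x| < 1 by rewrite gtr0_norm.
  apply: is_derive_eq; first exact: (df x nx).
  have x1' : 1 - x != 0 by rewrite subr_eq0 gt_eqF.
  rewrite powRB; last by rewrite x1' implybT.
  rewrite powRr1 ?subr_ge0 ?(ltW x1)//.
  have := ODE x; rewrite x0 x1 => /(_ isT) e.
  rewrite [X in _ - X](_ : _ = rho * B x / (1 - x) * (1 - x) `^ rho); last by ring.
  by rewrite -e mulfK// subrr.
- apply: derivable_within_continuous => x; rewrite in_itv/= => /andP[x0 xq].
  have nx : `|x| < 1 by rewrite ger0_norm// (le_lt_trans xq).
  by have [] := df x nx.
rewrite mul0r /f B0 subr0 powR1 mulr1 => /eqP; rewrite subr_eq0 => /eqP e.
have := BC q q01; rewrite -/(C q) => e'.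
have q1' : 1 - q != 0 by rewrite subr_eq0 gt_eqF.
have Bq : B q != 0.
  by apply/eqP => Bq; move: e; rewrite Bq mul0r => /esym/eqP; rewrite oner_eq0.
apply: (mulfI Bq); rewrite mulrCA e' mulfV//.
Qed.

End generating_functions.

(** * The maximum of a random walk at a geometric time *)

Section geometric_time.
Context (d : measure_display) (Omega : measurableType d) (R : realType).
Variables (P : probability Omega R) (xi : nat -> Omega -> R) (rho : R).
Hypothesis ixi : iid P xi.
Hypothesis hrho : forall j, (0 < j)%N -> pr P xi [set f | 0 <= walk f j] = rho.

Local Notation pr := (pr P xi).

(* P(max_{j <= N} walk j <= x) for an independent N with P(N = n) = (1 - q) q^n. *)
Definition geom_max_cdf (q x : R) : R :=
  (1 - q) * limn (pseries (fun n => pr (stay_le n x)) q).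

Let pr01 n A : <<s boxes n >> A -> 0 <= pr A <= 1.
Proof. by move=> sA; rewrite pr_ge0 (pr_le1 ixi sA). Qed.

Let norm_le1 (u : R) : 0 <= u <= 1 -> `|u| <= 1.
Proof. by move=> /andP[u0 u1]; rewrite ger0_norm. Qed.

Let boxes_end_max_le k x :
  <<s boxes k >> (end_max k `&` [set f : nat -> R | walk f k <= x]).
Proof.
apply: boxes_setI; first exact: boxes_end_max.
by apply: boxes_le; [exact: measurable_walk|exact: measurable_cst].
Qed.

(** In the mean of the last argmax each of the n summands is rho, which is the second convolution
    identity required by [convolution_power]. *)
Lemma stay_neg_series q : 0 < q < 1 ->
  (1 - q) * limn (pseries (fun n => pr (stay_neg n)) q) = (1 - q) `^ rho.
Proof.
apply: (@convolution_power _ (fun k => pr (end_max k))).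
- by move=> n; apply: (@pr01 n); exact: boxes_end_max.
- by move=> n; apply: (@pr01 n); exact: boxes_stay_neg.
- rewrite /pr (_ : [set w | _] = setT) ?probability_setT//.
  by apply/seteqP; split => // w _ j; rewrite leqn0 => /eqP ->.
- by move=> n; exact: end_max_stay_neg_sum.
- move=> n.
  have -> : \sum_(k < n.+1) k%:R * (pr (end_max k) * pr (stay_neg (n - k))) =
      \sum_(k < n.+1) k%:R * pr (last_argmax n k).
    by apply: eq_bigr => k _; rewrite pr_last_argmax// -ltnS.
  rewrite mean_last_argmax// big_nat_cond.
  under eq_bigr => j /andP[/andP[j0 _] _] do rewrite hrho//.
  by rewrite -big_nat_cond sumr_const_nat subSS subn0 mulr_natl.
Qed.

Lemma geom_max_cdfE q x : 0 < q < 1 ->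
  geom_max_cdf q x = (1 - q) `^ rho *
    limn (pseries (fun k => pr (end_max k `&` [set f | walk f k <= x])) q).
Proof.
move=> q01; rewrite -stay_neg_series// /geom_max_cdf -mulrA; congr (_ * _).
have [q0 q1] := andP q01; have q01' : 0 <= q < 1 by rewrite ltW.
apply: EFin_inj; rewrite mulrC -pseries_cauchy_prod.
- rewrite pseries_nneseries.
  + by apply: eq_eseriesr => n _; rewrite stay_le_sum.
  + by move=> n; exact: pr_ge0.
  + exact: ltW.
  + by apply: bounded_pseries_cvg => // n; apply: norm_le1; apply: (@pr01 n); exact: boxes_stay_le.
- by move=> n; exact: pr_ge0.
- by move=> n; exact: pr_ge0.
- exact: ltW.
- by apply: bounded_pseries_cvg => // n; apply: norm_le1; apply: (@pr01 n); exact: boxes_end_max_le.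
- by apply: bounded_pseries_cvg => // n; apply: norm_le1; apply: (@pr01 n); exact: boxes_stay_neg.
Qed.

(** After division by the power of 1 - q, only the series of [geom_max_cdfE] remains, and its
    coefficients are nonnegative. *)
Lemma geom_max_cdf_mono q q' x : 0 < q -> q <= q' -> q' < 1 ->
  geom_max_cdf q x / (1 - q) `^ rho <= geom_max_cdf q' x / (1 - q') `^ rho.
Proof.
move=> q0 qq' q1'; have q1 : q < 1 by apply: le_lt_trans q1'.
have q0' : 0 < q' by apply: lt_le_trans qq'.
have pos z : z < 1 -> (1 - z) `^ rho != 0.
  by move=> z1; rewrite gt_eqF// powR_gt0// subr_gt0.
rewrite !geom_max_cdfE ?q0 ?q0'//.
rewrite [X in X / _]mulrC mulfK ?pos// [X in _ <= X / _]mulrC mulfK ?pos//.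
have cv z : 0 < z -> z < 1 ->
    cvgn (pseries (fun k => pr (end_max k `&` [set f | walk f k <= x])) z).
  move=> z0 z1; apply: bounded_pseries_cvg; last by rewrite ltW.
  by move=> n; apply: norm_le1; apply: (@pr01 n); exact: boxes_end_max_le.
apply: ler_lim; [exact: cv|exact: cv|].
apply: nearW => n; apply: ler_sum => i _; apply: ler_wpM2l; first exact: pr_ge0.
by rewrite lerXn2r ?nnegrE ?(ltW q0) ?(ltW q0').
Qed.

Lemma stay_le_bound n x :
  pr [set f | f 0%N < - x] * pr (stay_le n x) <= pr (stay_neg n.+1).
Proof.
have s0 : <<s boxes 1 >> [set f : nat -> R | f 0%N < - x].
  by apply: boxes_lt; [exact: measurable_coord|exact: measurable_cst].
rewrite -(pr_indep ixi s0 (boxes_stay_le x (n := n))).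
have sA : <<s boxes n.+1 >> ([set f : nat -> R | f 0%N < - x] `&`
    (fun f => stay_le n x (shift 1 f))).
  apply: boxes_setI.
    by apply: boxes_lt; [exact: measurable_coord|exact: measurable_cst].
  apply: (@boxes_bigcap _ n.+1 (fun j => (j <= n)%N)
    (fun j => [set f | walk (shift 1 f) j <= x])) => j jn.
  apply: boxes_le; last exact: measurable_cst.
  rewrite (_ : (fun f => walk (shift 1 f) j) = fun f : nat -> R => walk f j.+1 - walk f 1).
    by apply: measurable_funB; apply: measurable_walk.
  by apply/funext => f; rewrite walk_shift add1n.
apply: (pr_le ixi sA (@boxes_stay_neg R n.+1)) => f [/= f0 hf] [//|j] /=.
rewrite ltnS => jn; have := hf j jn.
rewrite walk_shift add1n lerBlDr => /le_lt_trans; apply.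
by rewrite /walk big_ord1 -ltrBrDl sub0r.
Qed.

(** The forced first step turns n steps into n+1, which accounts for the factor q; the term n = 0 of
    the [stay_neg] series is simply dropped. *)
Lemma geom_max_cdf_bound q x : 0 < q < 1 ->
  pr [set f | f 0%N < - x] * q * geom_max_cdf q x <= (1 - q) `^ rho.
Proof.
move=> /andP[q0 q1]; rewrite -stay_neg_series ?q0// /geom_max_cdf.
rewrite mulrCA ler_wpM2l ?subr_ge0 ?(ltW q1)//.
have cN : cvgn (pseries (fun n => pr (stay_neg n)) q).
  apply: bounded_pseries_cvg => [n|]; last by rewrite ltW.
  by apply: norm_le1; apply: (@pr01 n); exact: boxes_stay_neg.
have cL : cvgn (pseries (fun n => pr (stay_le n x)) q).
  apply: bounded_pseries_cvg => [n|]; last by rewrite ltW.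
  by apply: norm_le1; apply: (@pr01 n); exact: boxes_stay_le.
rewrite -lee_fin EFinM !pseries_nneseries ?(ltW q0)//; last 2 first.
- by move=> n; exact: pr_ge0.
- by move=> n; exact: pr_ge0.
rewrite -nneseriesZl; last first.
  by move=> n _; rewrite lee_fin mulr_ge0 ?pr_ge0// exprn_ge0// ltW.
rewrite [leRHS]nneseries_recl//; last first.
  by move=> n _; rewrite lee_fin mulr_ge0 ?pr_ge0// exprn_ge0// ltW.
apply: (@le_trans _ _ (\sum_(1 <= n <oo) (pr (stay_neg n) * q ^+ n)%:E)%E); last first.
  by rewrite leeDr// lee_fin mulr_ge0 ?pr_ge0// exprn_ge0// ltW.
rewrite -(nneseries_addn (f := fun n => (pr (stay_neg n) * q ^+ n)%:E)); last first.
  by move=> n; rewrite lee_fin mulr_ge0 ?pr_ge0// exprn_ge0// ltW.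
apply: lee_nneseries => n _.
  by rewrite -EFinM lee_fin !mulr_ge0 ?pr_ge0// ?exprn_ge0// ltW.
rewrite -EFinM lee_fin addn1 exprS mulrACA ler_wpM2r//; last exact: stay_le_bound.
by rewrite mulr_ge0 ?exprn_ge0// ltW.
Qed.

End geometric_time.

(** * Cadlag paths and grids *)

Section cadlag_paths.
Context (R : realType).
Implicit Types (f : R -> R) (s t x h : R).

Lemma right_near f t e : f s @[s --> t^'+] --> f t -> 0 < e ->
  exists2 d : R, 0 < d & forall s, t < s < t + d -> `|f t - f s| < e.
Proof.
move=> /cvgrPdist_lt/[apply] -[d /= d0 hd]; exists d => // s /andP[ts sd].
by apply: hd => //=; rewrite ltr0_norm ?subr_lt0// opprB ltrBlDl.
Qed.

Lemma left_near f t e : cvg (f s @[s --> t^'-]) -> 0 < e ->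
  exists l d : R, 0 < d /\ forall s, t - d < s < t -> `|l - f s| < e.
Proof.
move=> /cvg_ex[l /cvgrPdist_lt] /[apply] -[d /= d0 hd].
exists l, d; split => // s /andP[ts sd].
by apply: hd => //=; rewrite gtr0_norm ?subr_gt0// ltrBlDl -ltrBlDr.
Qed.

(** Let c be the supremum of the times up to which f is bounded above. The left limit at c extends
    the bound to c, and right-continuity would extend it beyond c if c < T. Without this bound,
    [sup] in [running_sup] could be a default value. *)
Lemma cadlag_ubound f T : cadlag f -> 0 <= T ->
  exists M : R, forall s, 0 <= s <= T -> f s <= M.
Proof.
move=> [fr fl] T0.
pose E := [set t | 0 <= t <= T /\ exists M : R, forall s, 0 <= s <= t -> f s <= M].
have E0 : E 0.
  split; first by rewrite lexx.
  by exists (f 0) => s /andP[s0 s0']; rewrite (_ : s = 0)//; apply/le_anti/andP.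
have supE : has_sup E by split; [exists 0|exists T => t [/andP[]]].
pose c := sup E.
have c0 : 0 <= c by apply: ub_le_sup => //; case: supE.
have cT : c <= T by apply: ge_sup; [exists 0|move=> t [/andP[]]].
have Ec : E c.
  split; first by rewrite c0.
  have [c_gt0|c_le0] := ltP 0 c; last first.
    by have -> : c = 0 by [apply/le_anti/andP]; case: E0.
  have [l [d [d0 hd]]] := left_near (fl c c_gt0) ltr01.
  have [t [_ [M hM]] ct] := sup_adherent d0 supE.
  exists (Num.max M (Num.max (l + 1) (f c))) => s /andP[s0 sc].
  rewrite !le_max; have [st|ts] := leP s t; first by rewrite hM// s0.
  move: sc; rewrite le_eqVlt => /orP[/eqP->|sc]; first by rewrite lexx !orbT.
  have := hd s; rewrite sc (lt_trans ct ts) => /(_ isT).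
  by rewrite ltr_distlC => /andP[_ /ltW]; rewrite addrC => ->; rewrite orbT.
have [/andP[_ _] [M hM]] := Ec.
have [->|cT'] := eqVneq T c; first by exists M.
have {cT'} cT' : c < T by rewrite lt_neqAle eq_sym cT'.
have [d d0 hd] := right_near (fr c c0) ltr01.
pose c' := Num.min T (c + d / 2).
have cc' : c < c' by rewrite lt_min cT' ltrDl divr_gt0.
have c'd : c' < c + d.
  by rewrite gt_min; apply/orP; right; rewrite ltrD2l; lra.
suff : E c' by move=> /(ub_le_sup (proj2 supE)); rewrite leNgt cc'.
split; first by rewrite (le_trans c0 (ltW cc')) ge_min lexx.
exists (Num.max M (f c + 1)) => s /andP[s0 sc']; rewrite le_max.
have [sc|cs] := leP s c; first by rewrite hM// s0.
have := hd s; rewrite cs (le_lt_trans sc' c'd) => /(_ isT).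
by rewrite ltr_distlC => /andP[_ /ltW]; rewrite addrC => ->; rewrite orbT.
Qed.

Lemma exists_invSn_lt (e : R) : 0 < e -> exists p : nat, p.+1%:R^-1 < e.
Proof.
move=> e0; exists (Num.truncn e^-1).
have /truncn_itv/andP[_ hp] : 0 <= e^-1 by rewrite invr_ge0 ltW.
by rewrite -[ltRHS]invrK ltf_pV2// posrE ?invr_gt0.
Qed.

Lemma exists_halving_lt h (e : R) : 0 < h -> 0 < e ->
  exists m : nat, h / 2 ^+ m < e.
Proof.
move=> h0 e0; exists (Num.truncn (h / e)).+1.
rewrite ltr_pdivrMr ?exprn_gt0// mulrC -ltr_pdivrMr//.
have /truncn_itv/andP[_ /lt_trans] : 0 <= h / e by rewrite divr_ge0// ltW.
by apply; rewrite -natrX ltr_nat ltn_expl.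
Qed.

(** Right-continuity sees s only through grid points after s, so the bound has to be known on the
    grid up to some b strictly beyond s. *)
Lemma le_on_grid f h s b x : f u @[u --> s^'+] --> f s ->
  0 < h -> 0 <= s -> s < b ->
  (forall m k : nat, k%:R * (h / 2 ^+ m) <= b -> f (k%:R * (h / 2 ^+ m)) <= x) ->
  f s <= x.
Proof.
move=> fs h0 s0 sb hx; rewrite leNgt; apply/negP => xs.
have fsx : 0 < f s - x by rewrite subr_gt0.
have [d d0 hd] := right_near fs fsx.
have db0 : 0 < Num.min d (b - s) by rewrite lt_min d0 subr_gt0.
have [m] := exists_halving_lt h0 db0; rewrite lt_min => /andP[md mb].
pose g := h / 2 ^+ m; have g0 : 0 < g by rewrite divr_gt0// exprn_gt0.
(* The first grid point strictly after s: within g of s, hence both inside the continuity window and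
   below b. *)
pose k := (Num.truncn (s / g)).+1.
have /truncn_itv/andP[k1 k2] : 0 <= s / g by rewrite divr_ge0// ltW.
have sk : s < k%:R * g by rewrite -ltr_pdivrMr.
have ks : k%:R * g <= s + g.
  by rewrite /k -natr1 mulrDl mul1r lerD2r -ler_pdivlMr.
have := hx m k; rewrite -/g => hk.
have {}hk : f (k%:R * g) <= x.
  by apply: hk; rewrite (le_trans ks)// -lerBrDl ltW.
have := hd (k%:R * g); rewrite sk (le_lt_trans ks) ?ltrD2l// => /(_ isT).
rewrite ltr_distlC => /andP[+ _].
by rewrite subKr ltNge hk.
Qed.

End cadlag_paths.

(** * A countable description of the running supremum *)

Section running_sup_paths.
Context (d : measure_display) (Omega : measurableType d) (R : realType).
Variables (X : R -> Omega -> R) (w : Omega).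
Hypothesis cX : cadlag (sample_path X w).
Hypothesis X0 : X 0 w = 0.

Lemma running_sup_le t x : 0 <= t ->
  running_sup X t w <= x <-> forall s, 0 <= s <= t -> X s w <= x.
Proof.
move=> t0; split=> [Sx s st|hx].
  apply: le_trans Sx; apply: ub_le_sup; last by exists s.
  have [M hM] := cadlag_ubound cX t0.
  by exists M => _ [u /= ut <-]; exact: hM.
apply: ge_sup; first by exists (X 0 w), 0 => //=; rewrite lexx.
by move=> _ [s /= st <-]; exact: hx.
Qed.

Lemma running_sup_neg t : t < 0 -> running_sup X t w = 0.
Proof.
move=> t0; rewrite /running_sup (_ : [set _ | _ in _] = set0) ?sup0//.
by rewrite -subset0 => _ [s /= /andP[s0 st] _]; have := le_lt_trans (le_trans s0 st) t0; rewrite ltxx.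
Qed.

Lemma running_sup_ge0 t : 0 <= running_sup X t w.
Proof.
have [t0|t0] := ltP t 0; first by rewrite running_sup_neg.
have := (running_sup_le (running_sup X t w) t0).1 (lexx _) 0.
by rewrite lexx t0 X0; apply.
Qed.

(** Only countably many times occur, which gives measurability when t is random. The horizon is
    enlarged by 1 / (p + 1) since t need not be a grid point, and the level is raised by 1 / (n + 1)
    since the path may exceed x just after t. *)
Lemma running_sup_le_grid h t x : 0 < h -> 0 <= x ->
  running_sup X t w <= x <-> forall n : nat, exists p : nat,
    forall m k : nat, k%:R * (h / 2 ^+ m) <= t + p.+1%:R^-1 ->
    X (k%:R * (h / 2 ^+ m)) w <= x + n.+1%:R^-1.
Proof.
move=> h0 x0; have gpos (m k : nat) : 0 <= k%:R * (h / 2 ^+ m).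
  by rewrite mulr_ge0// divr_ge0// ?exprn_ge0// ltW.
have [t0|t0] := ltP t 0.
  (* The supremum is here the default 0 <= x, and p is taken so large that t + 1 / (p + 1) < 0,
     which leaves no grid point to test. *)
  rewrite running_sup_neg//; split=> // _ n.
  have t0' : 0 < - t by rewrite oppr_gt0.
  have [p hp] := exists_invSn_lt t0'.
  exists p => m k kt; exfalso.
  have := le_trans (gpos m k) kt; rewrite leNgt.
  by rewrite -ltrBrDl sub0r hp.
rewrite running_sup_le//; split=> [hs n|H s /andP[s0 st]].
  have n0 : 0 < n.+1%:R^-1 :> R by rewrite invr_gt0.
  have [e e0 he] := right_near (cX.1 t t0) n0.
  have [p hp] := exists_invSn_lt e0.
  exists p => m k kt; have [kt'|tk] := leP (k%:R * (h / 2 ^+ m)) t.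
    by rewrite (le_trans (hs _ _))// ?gpos// lerDl invr_ge0.
  have := he (k%:R * (h / 2 ^+ m)); rewrite tk (le_lt_trans kt) ?ltrD2l//.
  move=> /(_ isT); rewrite ltr_distlC => /andP[_ /ltW /le_trans]; apply.
  by rewrite lerD2r hs// t0 lexx.
apply/ler_addgt0Pl => e e0.
have [n hn] := exists_invSn_lt e0.
have [p hp] := H n.
rewrite addrC (@le_trans _ _ (x + n.+1%:R^-1))//; last by rewrite lerD2l ltW.
apply: (@le_on_grid _ (sample_path X w) h s (t + p.+1%:R^-1)) => //.
- exact: cX.1.
- by rewrite (le_lt_trans st)// ltrDl invr_gt0.
Qed.

End running_sup_paths.

(** * Skeletons of stable processes at exponential times *)

Section levy_skeleton.
Context (d : measure_display) (Omega : measurableType d) (R : realType).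
Variables (P : probability Omega R) (X : R -> Omega -> R).
Hypothesis lX : levy_process P X.

Definition increments (h : R) : nat -> Omega -> R :=
  fun i w => X (i.+1%:R * h) w - X (i%:R * h) w.

Lemma walk_increments h w j : walk (increments h ^~ w) j = X (j%:R * h) w.
Proof.
rewrite /walk -(big_mkord xpredT (increments h ^~ w)).
rewrite (@telescope_sumr _ 0 j (fun i => X (i%:R * h) w))//.
by rewrite mul0r (levy_start lX) subr0.
Qed.

Lemma increments_iid h : 0 <= h -> iid P (increments h).
Proof.
move=> h0; have mX t : 0 <= t -> measurable_fun setT (X t) by exact: (levy_measurable lX).
split=> [i|n B mB].
  by apply: measurable_funB; apply: mX; rewrite mulr_ge0.
have hstat i (C : set R) : measurable C ->
    P (increments h i @^-1` C) = P (X h @^-1` C).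
  move=> mC; rewrite -(levy_stationary lX (s := i%:R * h))//; last by rewrite mulr_ge0.
  by congr (P _); apply/seteqP; split => w /=; rewrite /increments -natr1 mulrDl mul1r.
have hmono : {homo (fun i : nat => i%:R * h) : i j / (i <= j)%N >-> i <= j}.
  by move=> i j ij; rewrite ler_wpM2r// ler_nat.
have h00 : 0 <= (fun i : nat => i%:R * h) 0%N by rewrite mul0r.
have := levy_indep lX h00 hmono (n := n) (fun i => mB i).
move=> H; transitivity (P (\bigcap_(i in [set: 'I_n]) (increments h i @^-1` B i))).
  congr (P _); apply/seteqP; split => w /= hw.
    by move=> i _; apply: hw.
  by move=> i lin; apply: (hw (Ordinal lin)).
by rewrite H; apply: eq_bigr => i _; rewrite !hstat.
Qed.

End levy_skeleton.

Section stable_skeleton.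
Context (d : measure_display) (Omega : measurableType d) (R : realType).
Variables (P : probability Omega R) (alpha : R) (X : R -> Omega -> R).
Hypothesis sX : stable_levy_process P alpha X.
Let lX : levy_process P X := stable_levy sX.

Lemma path_sigma_coord t (B : set R) : 0 <= t -> measurable B ->
  path_sigma [set f : R -> R | B (f t)].
Proof.
move=> t0 mB; apply: sub_sigma_algebra; exists t => //.
by exists B => //; rewrite setTI.
Qed.

Lemma path_sigma_bigcap (D : set nat) (F : nat -> set (R -> R)) :
  (forall i, D i -> path_sigma (F i)) ->
  path_sigma [set f | forall i, D i -> F i f].
Proof.
exact: (@bigcap_measurableType _ (g_sigma_algebraType
  (\bigcup_(t in [set t : R | 0 <= t])
        preimage_set_system setT (fun f : R -> R => f t) measurable)) F D).
Qed.

Lemma measurable_path A : path_sigma A -> measurable (sample_path X @^-1` A).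
Proof.
move=> sA.
pose phi (w : Omega) : g_sigma_algebraType (\bigcup_(t in [set t : R | 0 <= t])
        preimage_set_system setT (fun f : R -> R => f t) measurable) := sample_path X w.
have mphi : measurable_fun setT phi.
  apply: (@measurability _ _ _ _ setT phi (\bigcup_(t in [set t : R | 0 <= t])
        preimage_set_system setT (fun f : R -> R => f t) measurable)) => //.
  move=> _ [_ [t t0 [B mB <-]] <-]; rewrite !setTI.
  by have := levy_measurable lX t0 measurableT mB; rewrite setTI.
by have := mphi measurableT _ sA; rewrite setTI.
Qed.

Lemma stable_marginal c (B : set R) : 0 < c -> measurable B ->
  P [set w | B (X c w)] = P [set w | B (c `^ alpha^-1 * X 1 w)].
Proof.
move=> c0 mB.
have := stable_scaling sX c0 (path_sigma_coord ler01 mB).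
by rewrite /preimage /sample_path /= mulr1.
Qed.

(** By scaling X at time j h is in law a positive multiple of X 1, so the probability depends
    neither on j nor on the mesh. *)
Lemma walk_ge0_prob h j : 0 < h -> (0 < j)%N ->
  pr P (increments X h) [set f | 0 <= walk f j] = fine (P [set w | 0 <= X 1 w]).
Proof.
move=> h0 j0; rewrite /pr; congr fine.
have jh0 : 0 < j%:R * h by rewrite mulr_gt0// ltr0n.
transitivity (P [set w | [set x | 0 <= x] (X (j%:R * h) w)]).
  by congr (P _); apply/seteqP; split => w /=; rewrite (walk_increments lX).
have m0 : measurable [set x : R | 0 <= x].
  by rewrite -[X in measurable X]set_itvcy; exact: measurable_itv.
rewrite stable_marginal//; congr (P _); apply/seteqP; split => w /=.
  by rewrite pmulr_rge0// powR_gt0.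
by move=> h1; rewrite pmulr_rge0// powR_gt0.
Qed.

Lemma stay_le_scaling h c n x : 0 < h -> 0 < c ->
  pr P (increments X (h * c)) (stay_le n (c `^ alpha^-1 * x)) =
  pr P (increments X h) (stay_le n x).
Proof.
move=> h0 c0; rewrite /pr; congr fine.
pose A := [set f : R -> R | forall j, (j <= n)%N -> f (j%:R * h) <= c `^ alpha^-1 * x].
have sA : path_sigma A.
  apply: (@path_sigma_bigcap (fun j => (j <= n)%N)
    (fun j => [set f | f (j%:R * h) <= c `^ alpha^-1 * x])) => j jn.
  apply: (@path_sigma_coord _ [set y | y <= c `^ alpha^-1 * x]).
    by rewrite mulr_ge0// ltW.
  by rewrite -[X in measurable X]set_itvNyc; exact: measurable_itv.
transitivity (P (sample_path (fun t => X (c * t)) @^-1` A)).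
  have e (j : nat) : j%:R * (h * c) = c * (j%:R * h) by ring.
  congr (P _); apply/seteqP; split => w /= hw j jn; have := hw j jn;
    by rewrite (walk_increments lX) /sample_path e.
rewrite (stable_scaling sX c0 sA).
congr (P _); apply/seteqP; split => w /= hw j jn; have := hw j jn;
  by rewrite (walk_increments lX) /sample_path ler_pM2l// powR_gt0.
Qed.

End stable_skeleton.

(** * Exponential times *)

Section exponential_tail.
Context (R : realType).

Lemma integral_exp_tail (mu x : R) : 0 < mu ->
  (\int[lebesgue_measure]_(v in `[x, +oo[) (mu * expR (- (mu * v)))%:E)%E =
  (expR (- (mu * x)))%:E.
Proof.
move=> mu0.
have dF (v : R) : is_derive v (1 : R) (fun v : R => - expR (- (mu * v))) (mu * expR (- (mu * v))).
  apply: is_derive_eq; rewrite /GRing.scale/=; ring.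
have cF : continuous (fun v : R => - expR (- (mu * v))).
  by move=> v; apply: differentiable_continuous; apply/derivable1_diffP; have [] := dF v.
have cf : continuous (fun v : R => mu * expR (- (mu * v))).
  move=> v; apply: differentiable_continuous; apply/derivable1_diffP.
  have : is_derive v (1 : R) (fun v : R => mu * expR (- (mu * v)))
      (- (mu * (mu * expR (- (mu * v))))).
    by apply: is_derive_eq; rewrite /GRing.scale/=; ring.
  by case.
rewrite (@ge0_continuous_FTC2y _ _ (fun v => - expR (- (mu * v))) x 0).
- by rewrite -EFinB sub0r opprK.
- by move=> v _; rewrite mulr_ge0 ?expR_ge0// ltW.
- exact: continuous_subspaceT.
- rewrite -oppr0; apply: cvgN.
  apply: (@cvg_comp _ _ _ _ (fun z => expR (- z)) _ (pinfty_nbhs R)); last exact: cvgr_expR.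
  exact: gt0_cvgMry.
- by move=> v _; have [] := dF v.
- apply: cvg_at_right_filter; exact: cF.
- by move=> v _; rewrite derive1E; have [_ ->] := dF v.
Qed.

Lemma exponential_prob_tail (lam x : R) : 0 < lam -> 0 <= x ->
  exponential_prob lam `[x, +oo[ = (expR (- (lam * x)))%:E.
Proof.
move=> lam0 x0; rewrite -integral_exp_tail//; apply: eq_integral => v.
rewrite inE/= in_itv/= andbT => xv.
by rewrite exponential_pdfE ?(le_trans x0)// mulNr.
Qed.

(* Concavity of [a |-> 1 - exp(-a)] along the chord from [0]. *)
Lemma one_sub_exp_ratio (l l' h : R) : 0 < l -> l <= l' -> 0 < h ->
  l / l' <= (1 - expR (- (l * h))) / (1 - expR (- (l' * h))).
Proof.
move=> l0 ll' h0; have l'0 : 0 < l' by apply: lt_le_trans ll'.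
have den : 0 < 1 - expR (- (l' * h)).
  by rewrite subr_gt0 expR_lt1 oppr_lt0 mulr_gt0.
rewrite ler_pdivlMr// mulrBr mulr1.
have t01 : 0 <= l / l' <= 1.
  by rewrite divr_ge0 ?(ltW l0) ?(ltW l'0)//= ler_pdivrMr// mul1r.
case/andP: t01 => t0 t1.
have := @convex_expR R (Itv01 t0 t1) (- (l' * h)) 0.
rewrite !convRE/= mulr0 addr0 expR0 mulr1 mulrN mulrA divfK ?gt_eqF//.
rewrite /unstable.onem; set a := l / l' * _; lra.
Qed.

End exponential_tail.

Section exponential_time.
Context (d : measure_display) (Omega : measurableType d) (R : realType).
Variables (P : probability Omega R) (X : R -> Omega -> R).

(** The law enters only through its tail, the form that [grid_le_prob] consumes and that
    multiplication by a constant preserves. Negative values are allowed on a null event. *)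
Definition exp_time (lam : R) (T : Omega -> R) : Prop :=
  [/\ measurable_fun setT T,
      forall t, 0 <= t -> P [set w | t <= T w] = (expR (- (lam * t)))%:E &
      indep_process_rv P X T].

Lemma exponential_rv_exp_time lam (T : {RV P >-> R}) : 0 < lam ->
  exponential_rv lam T -> indep_process_rv P X T -> exp_time lam T.
Proof.
move=> lam0 hT iT; split => // t t0.
rewrite -exponential_prob_tail// -hT//; congr (P _).
by apply/seteqP; split => w /=; rewrite in_itv/= andbT.
Qed.

Lemma exp_time_scale lam c T : 0 < c -> exp_time lam T ->
  exp_time (lam / c) (fun w => c * T w).
Proof.
move=> c0 [mT hT iT]; split.
- by apply: measurable_funM.
- move=> t t0; rewrite mulrAC -mulrA -hT ?divr_ge0// ?(ltW c0)//.
  by congr (P _); apply/seteqP; split => w /=; rewrite ler_pdivrMr// mulrC.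
- move=> A _ sA [B mB <-]; apply: iT => //.
  exists ((fun x => c * x) @^-1` B) => //.
  rewrite -[X in measurable X]setTI; apply: measurable_funM => //.
Qed.

Lemma exp_time_ge0 lam T : exp_time lam T -> P [set w | 0 <= T w] = 1%E.
Proof. by case=> _ /(_ 0 (lexx _)) -> _; rewrite mulr0 oppr0 expR0. Qed.

Lemma exp_time_itv lam T s t : exp_time lam T -> 0 <= s <= t ->
  P [set w | s <= T w < t] = (expR (- (lam * s)) - expR (- (lam * t)))%:E.
Proof.
move=> [mT hT _] /andP[s0 st]; have t0 := le_trans s0 st.
have mge u : measurable [set w | u <= T w].
  have := mT measurableT `[u, +oo[%classic (measurable_itv _).
  rewrite setTI (_ : _ @^-1` _ = [set w | u <= T w])//.
  by apply/seteqP; split => w /=; rewrite in_itv/= andbT.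
have -> : [set w | s <= T w < t] = [set w | s <= T w] `\` [set w | t <= T w].
  apply/seteqP; split => w /=.
    by move=> /andP[? ?]; split => //; apply/negP; rewrite -ltNge.
  by move=> [? /negP]; rewrite -ltNge => ?; apply/andP.
rewrite measureD; [|exact: mge|exact: mge|by rewrite (le_lt_trans (probability_le1 P (mge s))) ?ltry].
rewrite [X in (_ - P X)%E](_ : _ = [set w | t <= T w]); last first.
  by apply/setIidPr => w /=; apply: le_trans.
by rewrite [X in (X - _)%E](hT s s0) [X in (_ - X)%E](hT t t0) EFinB.
Qed.

End exponential_time.

(** * The skeleton at an exponential time *)

Section grid_events.
Context (d : measure_display) (Omega : measurableType d) (R : realType).
Variables (P : probability Omega R) (alpha : R) (X : R -> Omega -> R).
Hypothesis sX : stable_levy_process P alpha X.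
Let lX : levy_process P X := stable_levy sX.
Let rho : R := fine (P [set w | 0 <= X 1 w]).

Definition grid_le (h x : R) (T : Omega -> R) : set Omega :=
  [set w | forall k : nat, k%:R * h <= T w -> X (k%:R * h) w <= x].

Lemma measurable_le_rv (f : Omega -> R) c :
  measurable_fun setT f -> measurable [set w | f w <= c].
Proof.
move=> mf; have := mf measurableT `]-oo, c]%classic (measurable_itv _).
rewrite setTI (_ : _ @^-1` _ = [set w | f w <= c])//.
Qed.

Lemma measurable_lt_rv (f : Omega -> R) c :
  measurable_fun setT f -> measurable [set w | f w < c].
Proof.
move=> mf; have := mf measurableT `]-oo, c[%classic (measurable_itv _).
rewrite setTI (_ : _ @^-1` _ = [set w | f w < c])//.
Qed.

Lemma measurable_ge_rv (f : Omega -> R) c :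
  measurable_fun setT f -> measurable [set w | c <= f w].
Proof.
move=> mf; have := mf measurableT `[c, +oo[%classic (measurable_itv _).
rewrite setTI (_ : _ @^-1` _ = [set w | c <= f w])//.
by apply/seteqP; split => w /=; rewrite in_itv/= andbT.
Qed.

Lemma measurable_grid_le h x T : 0 <= h -> measurable_fun setT T ->
  measurable (grid_le h x T).
Proof.
move=> h0 mT.
have -> : grid_le h x T = \bigcap_(k in [set: nat])
    ([set w | T w < k%:R * h] `|` [set w | X (k%:R * h) w <= x]).
  apply/seteqP; split => w /= hw k.
    by move=> _; case: (leP (k%:R * h) (T w)) => hk; [right; exact: hw|left].
  by move=> hk; case: (hw k I) => //=; rewrite ltNge hk.
apply: bigcap_measurableType => k _; apply: measurableU.
  exact: measurable_lt_rv.
by apply: measurable_le_rv; apply: (levy_measurable lX); rewrite mulr_ge0.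
Qed.

Lemma probability_setI_full (A E : set Omega) : measurable A -> measurable E ->
  P E = 1%E -> P (A `&` E) = P A.
Proof.
move=> mA mE PE; rewrite [RHS](measureDI P mA mE).
rewrite [X in (_ = X + _)%E](_ : _ = 0%E) ?add0e//.
apply/eqP; rewrite -measure_le0.
have <- : P (~` E) = 0%E by rewrite probability_setC// PE subee.
apply: le_measure; rewrite ?inE; [exact: measurableD|exact: measurableC|].
by move=> w [].
Qed.

(** The event n h <= T < (n + 1) h has probability (1 - q) q^n with q = exp(-lam h) and is
    independent of X, so the skeleton is observed at an independent geometric time. *)
Lemma grid_le_prob h lam x T : 0 < h -> 0 < lam -> exp_time P X lam T ->
  P (grid_le h x T) =
  (geom_max_cdf P (increments X h) (expR (- (lam * h))) x)%:E.
Proof.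
move=> h0 lam0 eT; have [mT hT iT] := eT.
set q := expR _; have q0 : 0 < q by exact: expR_gt0.
have q1 : q < 1 by rewrite expR_lt1 oppr_lt0 mulr_gt0.
have mge0 := measurable_ge_rv 0 mT.
have mgrid := measurable_grid_le x (ltW h0) mT.
rewrite -(probability_setI_full mgrid mge0 (exp_time_ge0 eT)).
pose A (n : nat) := [set f : R -> R | forall j, (j <= n)%N -> f (j%:R * h) <= x].
have sA n : path_sigma (A n).
  apply: (@path_sigma_bigcap _ (fun j => (j <= n)%N)
    (fun j => [set f | f (j%:R * h) <= x])) => j jn.
  apply: (@path_sigma_coord _ _ [set y | y <= x]).
    by rewrite mulr_ge0// ltW.
  by rewrite -[X in measurable X]set_itvNyc; exact: measurable_itv.
pose E (n : nat) := [set w | n%:R * h <= T w < n.+1%:R * h].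
pose F n := (sample_path X @^-1` A n) `&` E n.
have mE n : measurable (E n).
  have -> : E n = [set w | n%:R * h <= T w] `&` [set w | T w < n.+1%:R * h].
    by apply/seteqP; split => w /=; rewrite /E/= => /andP.
  by apply: measurableI; [exact: measurable_ge_rv|exact: measurable_lt_rv].
have mF n : measurable (F n).
  by apply: measurableI => //; exact: (measurable_path sX).
have -> : grid_le h x T `&` [set w | 0 <= T w] = \bigcup_n F n.
  apply/seteqP; split => w /=.
    move=> [hw Tw]; exists (Num.truncn (T w / h)) => //.
    have /truncn_itv/andP[k1 k2] : 0 <= T w / h by rewrite divr_ge0// ltW.
    rewrite ler_pdivlMr// in k1; rewrite ltr_pdivrMr// in k2.
    split; last by rewrite /E/= k1.
    move=> j jn; apply: hw; apply: le_trans k1.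
    by rewrite ler_wpM2r ?(ltW h0)// ler_nat.
  move=> [n _ [/= hA /andP[n1 n2]]]; split; last first.
    by apply: le_trans n1; rewrite mulr_ge0// ltW.
  move=> k kT; apply: hA; have := le_lt_trans kT n2.
  by rewrite ltr_pM2r// ltr_nat.
rewrite measure_bigcup//; last first.
  move=> i j _ _ [w [[_ /= /andP[i1 i2]] [_ /= /andP[j1 j2]]]].
  have := le_lt_trans i1 j2; have := le_lt_trans j1 i2.
  rewrite !ltr_pM2r// !ltr_nat !ltnS => ji ij.
  by apply/eqP; rewrite eqn_leq ij ji.
rewrite (eq_eseriesl (Q := xpredT)); last by move=> n; rewrite in_setT.
have PF n : P (F n) =
    ((1 - q)%:E * (pr P (increments X h) (stay_le n x) * q ^+ n)%:E)%E.
  rewrite /F iT; last 2 first.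
  + by exists (A n) => //; rewrite setTI.
  + exists `[n%:R * h, n.+1%:R * h[%classic; first exact: measurable_itv.
    by rewrite setTI; apply/seteqP; split => w /=; rewrite in_itv.
  rewrite (exp_time_itv eT); last first.
    by rewrite mulr_ge0 ?(ltW h0)//= ler_wpM2r ?(ltW h0)// ler_nat.
  have -> : P (sample_path X @^-1` A n) = (pr P (increments X h) (stay_le n x))%:E.
    rewrite (prK (increments_iid lX (ltW h0)) (boxes_stay_le x (n := n))).
    congr (P _); apply/seteqP; split => w /= hw j jn; have := hw j jn;
    by rewrite (walk_increments lX).
  rewrite -EFinM; congr (_%:E).
  have eq m : expR (- (lam * (m%:R * h))) = q ^+ m.
    by rewrite /q -expRM_natl; congr expR; ring.
  by rewrite !eq exprS; ring.
rewrite /geom_max_cdf EFinM pseries_nneseries.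
- rewrite -nneseriesZl; last first.
    by move=> n _; rewrite lee_fin mulr_ge0 ?pr_ge0// exprn_ge0// ltW.
  by apply: eq_eseriesr => n _; exact: PF.
- by move=> n; exact: pr_ge0.
- exact: ltW.
- apply: bounded_pseries_cvg => [n|]; last by rewrite ltW.
  rewrite ger0_norm ?pr_ge0//.
  exact: (pr_le1 (increments_iid lX (ltW h0)) (boxes_stay_le x (n := n))).
Qed.

(** Monotonicity in q compares the powers (1 - q)^rho; [one_sub_exp_ratio] replaces their ratio by
    that of the rates, so the inequality can pass to the limit of small meshes. *)
Lemma grid_le_ratio h l l' x T T' : 0 < h -> 0 < l -> l <= l' -> 0 <= rho ->
  exp_time P X l T -> exp_time P X l' T' ->
  fine (P (grid_le h x T')) * (l / l') `^ rho <= fine (P (grid_le h x T)).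
Proof.
move=> h0 l0 ll' rho0 eT eT'; have l'0 : 0 < l' by apply: lt_le_trans ll'.
rewrite (grid_le_prob x h0 l0 eT) (grid_le_prob x h0 l'0 eT')/=.
set q := expR (- (l * h)); set q' := expR (- (l' * h)).
have q1 : q < 1 by rewrite expR_lt1 oppr_lt0 mulr_gt0.
have q1' : q' < 1 by rewrite expR_lt1 oppr_lt0 mulr_gt0.
have hr j : (0 < j)%N -> pr P (increments X h) [set f | 0 <= walk f j] = rho.
  exact: (walk_ge0_prob sX h0).
have := geom_max_cdf_mono (increments_iid lX (ltW h0)) hr (q := q') (q' := q) x
  (expR_gt0 _) _ q1.
rewrite ler_expR lerN2 ler_pM2r// => /(_ ll').
set g := geom_max_cdf _ _ q x; set g' := geom_max_cdf _ _ q' x => gg.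
have p1 : 0 < (1 - q) `^ rho by rewrite powR_gt0// subr_gt0.
have p1' : 0 < (1 - q') `^ rho by rewrite powR_gt0// subr_gt0.
have g0 : 0 <= g'.
  by rewrite -lee_fin -(grid_le_prob x h0 l'0 eT') measure_ge0.
have aux (u v y z : R) : 0 < z -> u / y <= v / z -> u * (z / y) <= v.
  by move=> z0 uv; rewrite mulrCA -ler_pdivlMl// [leRHS]mulrC.
have hle : (l / l') `^ rho <= (1 - q) `^ rho / (1 - q') `^ rho.
  have d0 : 0 <= (1 - q) / (1 - q') by rewrite divr_ge0// subr_ge0 ltW.
  have -> : (1 - q) `^ rho = ((1 - q) / (1 - q')) `^ rho * (1 - q') `^ rho.
    by rewrite -powRM ?divfK// ?subr_ge0 ?ltW// subr_eq0 gt_eqF.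
  rewrite mulfK ?gt_eqF// ge0_ler_powR ?nnegrE// ?divr_ge0 ?(ltW l0) ?(ltW l'0)//.
  exact: one_sub_exp_ratio.
apply: (@le_trans _ _ (g' * ((1 - q) `^ rho / (1 - q') `^ rho))).
  by rewrite ler_wpM2l.
exact: (aux _ _ _ _ p1 gg).
Qed.

End grid_events.

(** * The law of the supremum at an exponential time *)

Section supremum_law.
Context (d : measure_display) (Omega : measurableType d) (R : realType).
Variables (P : probability Omega R) (alpha : R) (X : R -> Omega -> R).
Hypothesis sX : stable_levy_process P alpha X.
Let lX : levy_process P X := stable_levy sX.
Let rho : R := fine (P [set w | 0 <= X 1 w]).

Definition sup_le (x : R) (T : Omega -> R) : set Omega :=
  [set w | running_sup X (T w) w <= x].

Lemma rho_ge0 : 0 <= rho. Proof. exact/fine_ge0/measure_ge0. Qed.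

Lemma rho_le1 : rho <= 1.
Proof.
rewrite -lee_fin fineK ?fin_num_measure ?probability_le1//;
  by apply: measurable_ge_rv; apply: (levy_measurable lX).
Qed.

(** The countable description makes the event a countable combination of grid events, at the random
    times T + 1 / (p + 1). *)
Lemma measurable_sup_le x T : 0 <= x -> measurable_fun setT T ->
  measurable (sup_le x T).
Proof.
move=> x0 mT.
have -> : sup_le x T = \bigcap_(n in [set: nat]) \bigcup_(p in [set: nat])
    \bigcap_(m in [set: nat])
    grid_le X (1 / 2 ^+ m) (x + n.+1%:R^-1) (fun w => T w + p.+1%:R^-1).
  apply/seteqP; split => w /=.
    move=> /(running_sup_le_grid (levy_cadlag lX w) _ ltr01 x0) hw n _.
    by have [p hp] := hw n; exists p => // m _ k; exact: hp.
  move=> hw; apply/(running_sup_le_grid (levy_cadlag lX w) _ ltr01 x0) => n.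
  by have [p _ hp] := hw n I; exists p => m k; exact: (hp m I k).
apply: bigcap_measurableType => n _; apply: bigcupT_measurable => p.
apply: bigcap_measurableType => m _; apply: (measurable_grid_le sX).
  by rewrite divr_ge0// exprn_ge0.
by apply: measurable_funD.
Qed.

Lemma sup_le_grid_le h x T : 0 <= h -> sup_le x T `&` [set w | 0 <= T w] `<=` grid_le X h x T.
Proof.
move=> h0 w [/= Sx T0] k kT.
by apply: (running_sup_le (levy_cadlag lX w) x T0).1 => //; rewrite mulr_ge0.
Qed.

(** The factor c > 1 places grid points after T whenever T > 0; at time 0 the path vanishes and x >=
    0 suffices. *)
Lemma grid_le_sup_le h c x T : 0 < h -> 1 < c -> 0 <= x ->
  \bigcap_(m in [set: nat]) grid_le X (h / 2 ^+ m) x (fun w => c * T w) `<=` sup_le x T.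
Proof.
move=> h0 c1 x0 w hw; rewrite /sup_le/=.
have [T0|T0] := ltP (T w) 0; first by rewrite (running_sup_neg X w T0).
rewrite (running_sup_le (levy_cadlag lX w) x T0) => s /andP[s0 sT].
have [sE|sN] := eqVneq s 0; first by rewrite sE (levy_start lX).
have s_gt0 : 0 < s by rewrite lt_neqAle eq_sym sN.
apply: (@le_on_grid _ (sample_path X w) h s (c * T w)) => //.
- exact: (levy_cadlag lX w).1.
- by rewrite (le_lt_trans sT)// ltr_pMl// (lt_le_trans s_gt0).
- by move=> m k; exact: (hw m I k).
Qed.

Lemma grid_le_cvg h x T : 0 < h -> measurable_fun setT T ->
  fine (P (grid_le X (h / 2 ^+ m) x T)) @[m --> \oo] -->
  fine (P (\bigcap_(m in [set: nat]) grid_le X (h / 2 ^+ m) x T)).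
Proof.
move=> h0 mT; have hm m : 0 <= h / 2 ^+ m by rewrite divr_ge0 ?exprn_ge0// ltW.
have mg m : measurable (grid_le X (h / 2 ^+ m) x T) by apply: (measurable_grid_le sX).
have mcap : measurable (\bigcap_(m in [set: nat]) grid_le X (h / 2 ^+ m) x T).
  by apply: bigcap_measurableType.
apply: fine_cvg; rewrite fineK ?fin_num_measure//.
apply: nonincreasing_cvg_mu => //.
- by rewrite (le_lt_trans (probability_le1 P (mg _))) ?ltry.
- apply/nonincreasing_seqP => m; apply/subsetPset => w hw k kT.
  have e : k%:R * (h / 2 ^+ m) = (k * 2)%:R * (h / 2 ^+ m.+1).
    by rewrite natrM exprS invfM; field; rewrite expf_neq0.
  by move: kT; rewrite e => /hw.
Qed.

(** The grid events decrease along dyadic refinement to an intersection of probability L, and L is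
    at least P(S <= x). For the converse the time c T, of rate l / c, is compared with T: the ratio
    bound costs c^(-rho) >= 1 / c because rho <= 1, whence L / c <= P(S <= x). *)
Lemma sup_le_cvg h x l T : 0 < h -> 0 < l -> 0 <= x -> exp_time P X l T ->
  fine (P (grid_le X (h / 2 ^+ m) x T)) @[m --> \oo] --> fine (P (sup_le x T)).
Proof.
move=> h0 l0 x0 eT; have [mT _ _] := eT.
have hm m : 0 < h / 2 ^+ m by rewrite divr_gt0 ?exprn_gt0.
have msup := measurable_sup_le x0 mT.
have fle A B : measurable A -> measurable B -> (P A <= P B)%E -> fine (P A) <= fine (P B).
  by move=> mA mB AB; rewrite fine_le ?fin_num_measure.
have mcap T' : measurable_fun setT T' ->
    measurable (\bigcap_(m in [set: nat]) grid_le X (h / 2 ^+ m) x T').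
  by move=> mT'; apply: bigcap_measurableType => m _; apply: (measurable_grid_le sX); rewrite ?ltW.
set L := fine (P (\bigcap_(m in [set: nat]) grid_le X (h / 2 ^+ m) x T)).
suff <- : L = fine (P (sup_le x T)) by exact: grid_le_cvg.
have mge0 := measurable_ge_rv 0 mT.
apply/le_anti/andP; split; last first.
  apply: fle => //; first exact: mcap.
  rewrite -(probability_setI_full msup mge0 (exp_time_ge0 eT)).
  apply: le_measure; rewrite ?inE; [exact: measurableI|exact: mcap|].
  by move=> w hw m _; apply: sup_le_grid_le hw; rewrite ltW.
apply/ler_addgt0Pl => e e0.
(* With c = 1 + e, the bound L <= c P(S <= x) is within e of P(S <= x), a probability being at most
   1. *)
have [c [c1 ce]] : exists c : R, 1 < c /\ c <= 1 + e.
  by exists (1 + e); rewrite ltrDl.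
have c0 : 0 < c by apply: lt_trans c1.
have eT' := exp_time_scale c0 eT; have [mT' _ _] := eT'.
have Lc : L / c <= fine (P (sup_le x T)).
  apply: (@le_trans _ _ (fine (P (\bigcap_(m in [set: nat]) grid_le X (h / 2 ^+ m) x (fun w => c * T w))))); last first.
    apply: fle => //; first exact: mcap.
    apply: le_measure; rewrite ?inE//; first exact: mcap.
    exact: grid_le_sup_le.
  have cL : fine (P (grid_le X (h / 2 ^+ m) x T)) / c @[m --> \oo] --> L / c.
    by apply: cvgMr_tmp; exact: grid_le_cvg.
  have cR := grid_le_cvg (x := x) h0 mT'.
  apply: (ler_cvg_to cL cR); apply: nearW => m.
    have lc : l / c <= l by rewrite ler_pdivrMr// ler_peMr// ltW.
    have := grid_le_ratio sX x (hm m) (divr_gt0 l0 c0) lc rho_ge0 eT' eT.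
    apply: le_trans; rewrite ler_wpM2l ?fine_ge0 ?measure_ge0//.
    rewrite mulrAC divff ?gt_eqF// mul1r -/rho.
    have ci : 0 < c^-1 <= 1 by rewrite invr_gt0 c0 invf_le1// ltW.
    exact: ger1_powR rho_le1.
have S1 : fine (P (sup_le x T)) <= 1.
  by rewrite -lee_fin fineK ?fin_num_measure// probability_le1.
move: Lc; rewrite ler_pdivrMr// => /le_trans; apply.
have S0 : 0 <= fine (P (sup_le x T)) by rewrite fine_ge0.
apply: (@le_trans _ _ (fine (P (sup_le x T)) * (1 + e))); first by rewrite ler_wpM2l.
by rewrite mulrDr mulr1 addrC lerD2r ler_piMl// ltW.
Qed.

Lemma sup_le_ratio x l l' T T' : 0 < l -> l <= l' -> 0 <= x ->
  exp_time P X l T -> exp_time P X l' T' ->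
  fine (P (sup_le x T')) * (l / l') `^ rho <= fine (P (sup_le x T)).
Proof.
move=> l0 ll' x0 eT eT'; have l'0 : 0 < l' by apply: lt_le_trans ll'.
have c1 := sup_le_cvg ltr01 l0 x0 eT.
have c2 := sup_le_cvg ltr01 l'0 x0 eT'.
have c2' : fine (P (grid_le X (1 / 2 ^+ m) x T')) * (l / l') `^ rho @[m --> \oo] -->
    fine (P (sup_le x T')) * (l / l') `^ rho by exact: cvgMr_tmp.
apply: (ler_cvg_to c2' c1).
apply: nearW => m; apply: (grid_le_ratio sX) => //.
exact: rho_ge0.
Qed.

(** Mesh 1 / 2^m at rate l and mesh c / 2^m at rate l / c give the same geometric parameter, so the
    grid probabilities coincide for each m. [T'] may be any exponential time of its rate, so only
    the rate matters. *)
Lemma sup_le_scaling c l x T T' : 0 < c -> 0 < l -> 0 <= x ->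
  exp_time P X l T -> exp_time P X (l / c) T' ->
  fine (P (sup_le (c `^ alpha^-1 * x) T')) = fine (P (sup_le x T)).
Proof.
move=> c0 l0 x0 eT eT'.
have c1 := sup_le_cvg ltr01 l0 x0 eT.
have x0' : 0 <= c `^ alpha^-1 * x by rewrite mulr_ge0// powR_ge0.
have c2 := sup_le_cvg c0 (divr_gt0 l0 c0) x0' eT'.
suff E : (fun m => fine (P (grid_le X (c / 2 ^+ m) (c `^ alpha^-1 * x) T'))) =
    (fun m => fine (P (grid_le X (1 / 2 ^+ m) x T))).
  by apply: etrans (cvg_lim _ c1) => //; rewrite -E; apply/esym/cvg_lim.
apply/funext => m.
have hm : 0 < 1 / 2 ^+ m :> R by rewrite divr_gt0 ?exprn_gt0.
have e : c / 2 ^+ m = 1 / 2 ^+ m * c by rewrite mul1r mulrC.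
rewrite (grid_le_prob sX _ hm l0 eT) e.
rewrite (grid_le_prob sX _ (mulr_gt0 hm c0) (divr_gt0 l0 c0) eT')/=.
rewrite /geom_max_cdf.
have -> : l / c * (1 / 2 ^+ m * c) = l * (1 / 2 ^+ m).
  by set a := 1 / _; field; rewrite gt_eqF.
congr (_ * limn (pseries _ _)); apply/funext => n.
by rewrite (stay_le_scaling sX).
Qed.

End supremum_law.

(** * Nonnegative variables reproduced by addition up to a factor below 2 *)

Section nonneg_selfsimilar.
Context (d : measure_display) (Omega : measurableType d) (R : realType).
Variables (P : probability Omega R).

Lemma exists_expr_lt (z e : R) : 0 <= z < 1 -> 0 < e -> exists n : nat, z ^+ n < e.
Proof.
move=> /andP[z0 z1] e0.
have : (fun n : nat => z ^+ n) @ \oo --> (0 : R) by apply: cvg_expr; rewrite ger0_norm.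
move=> /cvgr_lt/(_ _ e0)[N _ hN]; exists N; exact: hN N (leqnn N).
Qed.

Lemma exists_probability_gt (F : nat -> set Omega) (E : set Omega) (a : R) :
  (forall n, measurable (F n)) -> (forall n, F n `<=` F n.+1) ->
  \bigcup_n F n = E -> (a%:E < P E)%E -> exists n, (a%:E < P (F n))%E.
Proof.
move=> mF hF FE aE.
have mE : measurable E by rewrite -FE; exact: bigcupT_measurable.
have : P (F n) @[n --> \oo] --> P E.
  rewrite -FE; apply: nondecreasing_cvg_mu => //.
    by rewrite FE.
  by apply/nondecreasing_seqP => n; apply/subsetPset; exact: hF.
rewrite -[P E in X in X -> _]fineK ?fin_num_measure// => /fine_cvgP[_].
have aE' : a < fine (P E) by rewrite -lte_fin fineK ?fin_num_measure.
move=> /cvgr_gt/(_ _ aE')[N _ hN]; exists N.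
have := hN N (leqnn N); rewrite /= => h.
by rewrite -[P (F N)]fineK ?fin_num_measure// lte_fin.
Qed.

Variable xi : nat -> Omega -> R.
Hypothesis ixi : iid P xi.
Variable c : R.
Hypothesis c12 : 1 < c < 2.
Hypothesis hc : forall y, P [set w | xi 0%N w + xi 1%N w < y] = P [set w | c * xi 0%N w < y].
Hypothesis xi_ge0 : P [set w | xi 0%N w < 0] = 0%E.

Let mxi i : measurable_fun setT (xi i). Proof. by case: ixi. Qed.
Let c0 : 0 < c. Proof. by case/andP: c12 => c1 _; apply: lt_trans c1. Qed.

Let G (y : R) := fine (P [set w | xi 0%N w < y]).

Let mlt i y : measurable [set w | xi i w < y].
Proof. exact: measurable_lt_rv. Qed.

Let GE y : (G y)%:E = P [set w | xi 0%N w < y].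
Proof. by rewrite /G fineK// fin_num_measure. Qed.

Let hsum y : P [set w | xi 0%N w + xi 1%N w < y] = (G (y / c))%:E.
Proof.
rewrite hc GE; congr (P _); apply/seteqP; split => w /=; by rewrite ltr_pdivlMr// mulrC.
Qed.

Let hpair (A B : set R) : measurable A -> measurable B ->
  P [set w | A (xi 0%N w) /\ B (xi 1%N w)] = (P (xi 0%N @^-1` A) * P (xi 0%N @^-1` B))%E.
Proof.
move=> mA mB; have [_ /(_ 2 (fun i => if i == 0%N then A else B))] := ixi.
rewrite big_ord_recl big_ord1/= => <-; last by move=> i; case: ifP.
congr (P _); apply/seteqP; split => w /=.
  by move=> [hA hB] [|[|//]].
by move=> h; split; [exact: (h 0%N)|exact: (h 1%N)].
Qed.

Let xi1_law (B : set R) : measurable B -> P (xi 1%N @^-1` B) = P (xi 0%N @^-1` B).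
Proof.
move=> mB; have := hpair measurableT mB.
rewrite preimage_setT probability_setT mul1e => <-; congr (P _).
by apply/seteqP; split => w //= [].
Qed.

Let mitvlt (y : R) : measurable [set x : R | x < y].
Proof. by rewrite -[X in measurable X]set_itvNyo; exact: measurable_itv. Qed.

Let mgeset : measurable [set w | 0 <= xi 0%N w /\ 0 <= xi 1%N w].
Proof. by apply: measurableI; exact: measurable_ge_rv. Qed.

Let fullge : P [set w | 0 <= xi 0%N w /\ 0 <= xi 1%N w] = 1%E.
Proof.
have m0 : measurable [set x : R | 0 <= x].
  by rewrite -[X in measurable X]set_itvcy; exact: measurable_itv.
rewrite (hpair m0 m0).
suff -> : P (xi 0%N @^-1` [set x | 0 <= x]) = 1%E by rewrite mule1.
rewrite (_ : _ @^-1` _ = ~` [set w | xi 0%N w < 0]).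
  by rewrite probability_setC// [X in (_ - X)%E]xi_ge0 sube0.
by apply/seteqP; split => w /=; rewrite leNgt => /negP.
Qed.

(** When two nonnegative terms have a sum below y, both are below y. *)
Let G_sqr y : G (y / c) <= G y ^+ 2.
Proof.
rewrite -lee_fin -hsum.
have ms : measurable [set w | xi 0%N w + xi 1%N w < y].
  by apply: measurable_lt_rv; exact: measurable_funD.
rewrite -(probability_setI_full ms mgeset fullge) expr2 EFinM !GE -(hpair (mitvlt y) (mitvlt y)).
apply: le_measure; rewrite ?inE; [exact: measurableI| |].
  by apply: measurableI; exact: measurable_lt_rv.
move=> w [/= h [h0 h1]]; lra.
Qed.

(** When two terms have a sum below 2 y, at least one is below y. *)
Let G_double y : G (2 * y / c) <= 2 * G y.
Proof.
rewrite -lee_fin -hsum.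
have ms : measurable [set w | xi 0%N w + xi 1%N w < 2 * y].
  by apply: measurable_lt_rv; exact: measurable_funD.
apply: (@le_trans _ _ (P ([set w | xi 0%N w < y] `|` [set w | xi 1%N w < y]))).
  apply: le_measure; rewrite ?inE//; first exact: measurableU.
  move=> w /= h; have [h0|h0] := ltP (xi 0%N w) y; first by left.
  by right => /=; lra.
apply: (@le_trans _ _ (P [set w | (xi 0%N w < y)%R] + P [set w | (xi 1%N w < y)%R])%E).
  exact: measureU2.
by rewrite [X in (_ + X)%E](xi1_law (mitvlt y)) -GE -EFinD lee_fin; lra.
Qed.

Let G_ge0 y : 0 <= G y. Proof. exact/fine_ge0/measure_ge0. Qed.
Let G_le1 y : G y <= 1. Proof. by rewrite -lee_fin GE probability_le1. Qed.

Let G_sqr_iter y k : G (y / c ^+ k) <= G y ^+ (2 ^ k).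
Proof.
elim: k => [|k IH]; first by rewrite expr0 divr1 expn0 expr1.
rewrite exprSr invfM mulrA (le_trans (G_sqr _))// expnSr exprM.
by rewrite lerXn2r ?nnegrE ?exprn_ge0.
Qed.

Let G_double_iter y j : G (y * (2 / c) ^+ j) <= 2 ^+ j * G y.
Proof.
elim: j => [|j IH]; first by rewrite !expr0 mulr1 mul1r.
rewrite [X in G X](_ : _ = 2 * (y * (2 / c) ^+ j) / c); last first.
  by rewrite exprS; ring.
by rewrite (le_trans (G_double _))// exprS -mulrA ler_wpM2l.
Qed.

Let G_mono y z : y <= z -> G y <= G z.
Proof.
move=> yz; rewrite -lee_fin !GE le_measure ?inE//.
by move=> w /= /lt_le_trans; apply.
Qed.

(** If the variable could be positive, [G] would be below 1 at some point; the squaring inequality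
    then makes [G] decay very fast towards 0, and the doubling inequality, effective because 2 / c >
    1, carries this smallness to arbitrarily large arguments, where [G] should approach 1. *)
Lemma nonneg_selfsimilar_zero : P [set w | 0 < xi 0%N w] = 0%E.
Proof.
have [c1 c2] := andP c12.
apply/eqP; rewrite eq_le measure_ge0 andbT leNgt; apply/negP => pos.
have mge y : measurable [set w | y <= xi 0%N w] by exact: measurable_ge_rv.
have [n hn] : exists n : nat, (0%:E < P [set w | (n.+1%:R^-1 <= xi 0%N w)%R])%E.
  apply: exists_probability_gt pos => //.
    move=> n w /= ; apply: le_trans.
    by rewrite lef_pV2 ?posrE// ler_nat.
  apply/seteqP; split => w /=.
    by move=> [n _]; apply: lt_le_trans; rewrite invr_gt0.
  by move=> /exists_invSn_lt[p /ltW hp]; exists p.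
pose y0 : R := n.+1%:R^-1; have y00 : 0 < y0 by rewrite invr_gt0.
have g1 : G y0 < 1.
  rewrite -lte_fin GE (_ : [set w | _] = ~` [set w | y0 <= xi 0%N w]).
    move: hn; rewrite probability_setC// -[P _]fineK ?fin_num_measure//.
    by rewrite -EFinB !lte_fin gtrBl.
  by apply/seteqP; split => w /=; rewrite ltNge => /negP.
(* A moves by the factor 2 / c outweigh c^2 and cost a factor 2^A, so y1 is then chosen with G y1 <=
   2^(-A-1). *)
have [A hA] : exists A : nat, (c / 2) ^+ A < c ^- 2.
  by apply: exists_expr_lt; [lra|rewrite invr_gt0 exprn_gt0].
have hA' : c ^+ 2 <= (2 / c) ^+ A.
  rewrite -[leLHS]invrK -[2 / c]invf_div exprVn lef_pV2 ?posrE ?invr_gt0 ?exprn_gt0//.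
    exact: ltW.
  by rewrite divr_gt0.
have [k0 hk0] : exists k0 : nat, G y0 ^+ k0 < (2 ^+ A.+1)^-1.
  by apply: exists_expr_lt; [rewrite G_ge0|rewrite invr_gt0 exprn_gt0].
pose y1 := y0 / c ^+ k0; have y10 : 0 < y1 by rewrite divr_gt0// exprn_gt0.
have g' : G y1 <= (2 ^+ A.+1)^-1.
  apply: le_trans (G_sqr_iter _ _) _; apply: le_trans (ltW hk0).
  by rewrite ler_wiXn2l// ltnW// ltn_expl.
have [m hm] : exists m : nat, ((2^-1)%:E < P [set w | (xi 0%N w < m%:R)%R])%E.
  apply: (@exists_probability_gt _ setT) => //.
  - by move=> m w /= /lt_trans; apply; rewrite ltr_nat.
  - apply/seteqP; split => // w _; exists (Num.truncn `|xi 0%N w|).+1 => //=.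
    have /truncn_itv/andP[_] := normr_ge0 (xi 0%N w).
    by apply: le_lt_trans; exact: ler_norm.
  - by rewrite probability_setT lte_fin invf_lt1// ltr1n.
have [k hk] : exists k : nat, c^-1 ^+ k < y1 / m.+1%:R.
  apply: exists_expr_lt; last by rewrite divr_gt0.
  by rewrite invr_ge0 (ltW c0) invf_lt1.
have mk : m%:R <= y1 * c ^+ k.+1.
  move: hk; rewrite exprVn ltr_pdivlMr// mulrC ltr_pdivrMr ?exprn_gt0// => hk.
  apply: (@le_trans _ _ m.+1%:R); first by rewrite ler_nat.
  apply: le_trans (ltW hk) _; rewrite ler_wpM2l ?(ltW y10)//.
  by rewrite ler_weXn2l// ltW.
have := G_mono mk; rewrite leNgt => /negP; apply.
apply: (@le_lt_trans _ _ 2^-1); last by rewrite -lte_fin GE.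
(* Descend from y1 by c^(k+1), where squaring leaves at most G(y1)^(2^(k+1)), hence at most
   G(y1)^(k+1); then climb by A (k + 1) doublings. The value stays below (2^A G y1)^(k+1) <= 1/2,
   although the point reached exceeds m. *)
have e : y1 * c ^+ k.+1 <= (y1 / c ^+ k.+1) * (2 / c) ^+ (A * k.+1).
  set C := c ^+ k.+1; have C0 : 0 < C by rewrite exprn_gt0.
  have hC : C * C <= (2 / c) ^+ (A * k.+1).
    rewrite exprM -expr2 /C -exprM mulnC exprM lerXn2r ?nnegrE ?exprn_ge0 ?(ltW c0)//.
    by rewrite divr_ge0// ltW.
  apply: (@le_trans _ _ (y1 / C * (C * C))).
    by rewrite mulrA divfK ?gt_eqF.
  by rewrite ler_wpM2l// divr_ge0// ltW.
apply: le_trans (G_mono e) _; apply: le_trans (G_double_iter _ _) _.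
apply: (@le_trans _ _ ((2 ^+ A * G y1) ^+ k.+1)).
  rewrite exprMn -exprM ler_wpM2l ?exprn_ge0// (le_trans (G_sqr_iter _ _))//.
  by rewrite ler_wiXn2l// ltnW// ltn_expl.
have h2 : 2 ^+ A * G y1 <= 2^-1.
  by rewrite -ler_pdivlMl ?exprn_gt0// -invfM -exprSr.
rewrite exprS; apply: (@le_trans _ _ (2^-1 * 1)); last by rewrite mulr1.
have h3 : 0 <= 2 ^+ A * G y1 by rewrite mulr_ge0// exprn_ge0.
apply: ler_pM => //; first by rewrite exprn_ge0.
by rewrite exprn_ile1// (le_trans h2)// invf_le1// ler1n.
Qed.

End nonneg_selfsimilar.

(** * Both signs have positive probability *)

Section positivity.
Context (d : measure_display) (Omega : measurableType d) (R : realType).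
Variables (P : probability Omega R) (alpha : R) (X : R -> Omega -> R).
Hypothesis halpha : 1 < alpha.
Hypothesis sX : stable_levy_process P alpha X.
Let lX : levy_process P X := stable_levy sX.
Let rho : R := fine (P [set w | 0 <= X 1 w]).

Lemma iid_opp (xi : nat -> Omega -> R) : iid P xi -> iid P (fun i w => - xi i w).
Proof.
move=> [mxi hxi]; split=> [i|n B mB]; first exact: measurable_funN.
have mN i : measurable ((fun x : R => - x) @^-1` B i).
  by rewrite -[X in measurable X]setTI; apply: measurable_funN.
by rewrite -(hxi n _ mN).
Qed.

Let mX t : 0 <= t -> measurable_fun setT (X t).
Proof. exact: (levy_measurable lX). Qed.

(** X 2 is the sum of two independent copies of X 1 and has the law of c X 1; alpha > 1 is what puts
    c below 2. *)
Let c := 2 `^ alpha^-1.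

Let c12 : 1 < c < 2.
Proof.
have a0 : 0 < alpha by apply: lt_trans halpha.
have ln2 : 0 < ln (2 : R) by rewrite ln_gt0// ltr1n.
rewrite /c /powR pnatr_eq0/= expR_gt1 mulr_gt0 ?invr_gt0//=.
by rewrite -[ltRHS](lnK (x := 2)) ?posrE// ltr_expR gtr_pMl// invf_lt1.
Qed.

Let X2 (B : set R) : measurable B -> P [set w | B (X 2 w)] = P [set w | B (c * X 1 w)].
Proof. by move=> mB; rewrite (stable_marginal sX). Qed.

Let inc0 w : increments X 1 0%N w = X 1 w.
Proof. by rewrite /increments mul1r mul0r (levy_start lX) subr0. Qed.

Let inc01 w : increments X 1 0%N w + increments X 1 1%N w = X 2 w.
Proof. by rewrite inc0 /increments mulr1 mul1r addrC subrK. Qed.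

Let mset_lt (y : R) : measurable [set x : R | x < y].
Proof. by rewrite -[X in measurable X]set_itvNyo; exact: measurable_itv. Qed.

Let mset_gt (y : R) : measurable [set x : R | y < x].
Proof. by rewrite -[X in measurable X]set_itvoy; exact: measurable_itv. Qed.

Let mge : measurable [set w | 0 <= X 1 w].
Proof. by apply: measurable_ge_rv; exact: mX. Qed.

(** Otherwise X 1 is almost surely nonnegative, hence zero; scaling makes X vanish almost surely at
    all dyadic times at once, and right-continuity at all times, against the nondegeneracy of X. *)
Lemma neg_prob_gt0 : (0 < P [set w | (X 1 w < 0)%R])%E.
Proof.
rewrite lt0e measure_ge0 andbT; apply/eqP => P0; apply: (stable_nonzero sX).
have Ppos : P [set w | 0 < X 1 w] = 0%E.
  have := nonneg_selfsimilar_zero (increments_iid lX ler01) c12.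
  have -> : [set w | 0 < increments X 1 0%N w] = [set w | 0 < X 1 w].
    by apply/seteqP; split => w /=; rewrite inc0.
  apply.
  - move=> y; transitivity (P [set w | X 2 w < y]).
      by congr (P _); apply/seteqP; split => w /=; rewrite inc01.
    rewrite (X2 (mset_lt y)); congr (P _).
    by apply/seteqP; split => w /=; rewrite inc0.
  - by rewrite -P0; congr (P _); apply/seteqP; split => w /=; rewrite inc0.
have hneg (a : R) (B : set R) : 0 < a -> measurable B ->
    P [set w | B (a `^ alpha^-1 * X 1 w)] = 0%E -> P.-negligible [set w | B (X a w)].
  move=> a0 mB h; exists [set w | B (X a w)]; split => //.
    by have := mX (ltW a0) measurableT mB; rewrite setTI.
  by rewrite (stable_marginal sX).
pose N := \bigcup_m \bigcup_k
  ([set w | X (k.+1%:R * (1 / 2 ^+ m)) w < 0] `|` [set w | 0 < X (k.+1%:R * (1 / 2 ^+ m)) w]).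
have : P.-negligible N.
  apply: negligible_bigcup => m; apply: negligible_bigcup => k.
  have g0 : 0 < k.+1%:R * (1 / 2 ^+ m) :> R by rewrite mulr_gt0// divr_gt0// exprn_gt0.
  apply: negligibleU.
    apply: (hneg _ [set x | x < 0]) => //.
    by rewrite -P0; congr (P _); apply/seteqP; split => w /=; rewrite pmulr_rlt0.
  apply: (hneg _ [set x | 0 < x]) => //.
  by rewrite -Ppos; congr (P _); apply/seteqP; split => w /=; rewrite pmulr_rgt0.
apply: negligibleS => w /=; apply: contra_notP => hN t t0.
have hgrid (m k : nat) : X (k%:R * (1 / 2 ^+ m)) w = 0.
  case: k => [|k]; first by rewrite mul0r (levy_start lX).
  by apply/eqP; case: ltgtP => // h; exfalso; apply: hN; exists m => //; exists k => //; [left|right].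
have ct := (levy_cadlag lX w).1 t t0.
apply/le_anti/andP; split.
  apply: (@le_on_grid _ (sample_path X w) 1 t (t + 1)) => //; first by rewrite ltrDl.
  by move=> m k _; rewrite /sample_path hgrid.
rewrite -oppr_le0.
apply: (@le_on_grid _ (fun t => - sample_path X w t) 1 t (t + 1)) => //.
- exact: cvgN.
- by rewrite ltrDl.
- by move=> m k _; rewrite /sample_path hgrid oppr0.
Qed.

(** If rho = 0, then -X 1 is almost surely positive, and the same vanishing result applied to -X
    contradicts [neg_prob_gt0]. *)
Lemma rho_gt0 : 0 < rho.
Proof.
rewrite lt_neqAle rho_ge0 andbT eq_sym; apply/eqP => rho0.
have Pge : P [set w | 0 <= X 1 w] = 0%E.
  by rewrite -[LHS]fineK ?fin_num_measure// -/rho rho0.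
have : (P [set w | (X 1 w < 0)%R] = 0)%E.
  have := nonneg_selfsimilar_zero (iid_opp (increments_iid lX ler01)) c12.
  have -> : [set w | 0 < - increments X 1 0%N w] = [set w | X 1 w < 0].
    by apply/seteqP; split => w /=; rewrite inc0 oppr_gt0.
  apply.
  - move=> y; transitivity (P [set w | - y < X 2 w]).
      by congr (P _); apply/seteqP; split => w /=; rewrite -opprD inc01 ltrNl.
    rewrite (X2 (mset_gt (- y))); congr (P _).
    by apply/seteqP; split => w /=; rewrite inc0 mulrN ltrNl.
  - apply/eqP; rewrite -measure_le0 -Pge le_measure ?inE//.
      by apply: measurable_lt_rv; apply: measurable_funN; case: (increments_iid lX ler01).
    by move=> w /=; rewrite inc0 oppr_lt0 => /ltW.
by have := neg_prob_gt0; move=> + h; rewrite h ltxx.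
Qed.

(** One fixed grid suffices for an upper bound, provided its mesh h is so large that P(X h < -x) >
    0. *)
Lemma sup_le_bound x : 0 <= x -> exists C : R, forall l T, 0 < l -> l <= 1 ->
  exp_time P X l T -> fine (P (sup_le X x T)) <= C * l `^ rho.
Proof.
move=> x0.
have [n hn] : exists n : nat, (0%:E < P [set w | (X 1 w < - n.+1%:R^-1)%R])%E.
  apply: exists_probability_gt neg_prob_gt0 => //.
  - by move=> n; apply: measurable_lt_rv; exact: mX.
  - by move=> n w /= /lt_trans; apply; rewrite ltrN2 ltf_pV2 ?posrE// ltr_nat.
  - apply/seteqP; split => w /=.
      by move=> [n _] /lt_trans; apply; rewrite oppr_lt0 invr_gt0.
    rewrite -oppr_gt0 => /exists_invSn_lt[p hp]; exists p => //=.
    by rewrite ltrNr.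
pose a : R := n.+1%:R^-1; have a0 : 0 < a by rewrite invr_gt0.
(* X h has the law of (x + 1) / a times X 1, so X 1 < -a puts it below -(x + 1). Using x + 1 keeps h
   positive when x = 0. *)
pose h := ((x + 1) / a) `^ alpha.
have xa0 : 0 < (x + 1) / a by rewrite divr_gt0// ltr_wpDl.
have h0 : 0 < h by exact: powR_gt0.
have alpha0 : alpha != 0 by rewrite gt_eqF// (lt_trans _ halpha).
have ha : h `^ alpha^-1 = (x + 1) / a.
  by rewrite /h -powRrM mulfV// powRr1// ltW.
pose delta := pr P (increments X h) [set f | f 0%N < - x].
have delta0 : 0 < delta.
  rewrite /delta /pr -lte_fin fineK; last first.
    apply: fin_num_measure; apply: measurable_lt_rv.
    by case: (increments_iid lX (ltW h0)).
  apply: lt_le_trans hn _.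
  have -> : P [set w | [set f | f 0%N < - x] (increments X h ^~ w)] =
      P [set w | [set y | y < - x] (X h w)].
    congr (P _); apply/seteqP; split => w /=;
      by rewrite /increments mul1r mul0r (levy_start lX) subr0.
  rewrite (stable_marginal sX h0 (mset_lt _)) le_measure ?inE//.
  - by apply: measurable_lt_rv; exact: mX.
  - by apply: measurable_lt_rv; apply: measurable_funM => //; exact: mX.
  move=> w /= hw; rewrite ha.
  have : (x + 1) / a * X 1 w < (x + 1) / a * - a by rewrite ltr_pM2l.
  rewrite mulrN divfK ?gt_eqF// => /lt_le_trans; apply.
  by rewrite lerN2 lerDl.
(* From 1 - q <= h l for the numerator, and q >= exp(-h), valid for l <= 1, for the denominator. *)
exists (h `^ rho / (delta * expR (- h))) => l T l0 l1 eT.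
have [mT _ _] := eT.
set q := expR (- (l * h)).
have q0 : 0 < q by exact: expR_gt0.
have q1 : q < 1 by rewrite expR_lt1 oppr_lt0 mulr_gt0.
have hr j : (0 < j)%N -> pr P (increments X h) [set f | 0 <= walk f j] = rho.
  exact: (walk_ge0_prob sX h0).
have := geom_max_cdf_bound (increments_iid lX (ltW h0)) hr x (introT andP (conj q0 q1)).
have -> : geom_max_cdf P (increments X h) q x = fine (P (grid_le X h x T)).
  by rewrite (grid_le_prob sX x h0 l0 eT).
rewrite -/delta => hb.
have msup := measurable_sup_le sX x0 mT.
have mgr := measurable_grid_le sX x (ltW h0) mT.
apply: (@le_trans _ _ (fine (P (grid_le X h x T)))).
  rewrite fine_le ?fin_num_measure//.
  rewrite -(probability_setI_full msup (measurable_ge_rv 0 mT) (exp_time_ge0 eT)).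
  apply: le_measure; rewrite ?inE; [|exact: mgr|exact: (sup_le_grid_le sX (ltW h0))].
  by apply: measurableI => //; exact: measurable_ge_rv.
have lq : (1 - q) `^ rho <= h `^ rho * l `^ rho.
  rewrite -powRM ?(ltW l0) ?(ltW h0)// ge0_ler_powR ?nnegrE ?rho_ge0//.
  - by rewrite subr_ge0 ltW.
  - by rewrite mulr_ge0// ltW.
  - by have := expR_ge1Dx (- (l * h)); rewrite -/q [h * l]mulrC; lra.
have qh : expR (- h) <= q by rewrite ler_expR lerN2 ger_pMl.
have P0 : 0 <= fine (P (grid_le X h x T)) by rewrite fine_ge0.
rewrite mulrAC ler_pdivlMr ?mulr_gt0 ?expR_gt0//.
apply: le_trans lq; apply: le_trans hb.
by rewrite mulrC ler_wpM2r// ler_wpM2l// ltW.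
Qed.

(** Right-continuity at 0 keeps the path below x on a short deterministic interval with positive
    probability, and independently T falls before its end. Only dyadic times are tested in [A], so
    that it belongs to [path_sigma]. *)
Lemma sup_le_gt0 x l T : 0 < x -> 0 < l -> exp_time P X l T ->
  0 < fine (P (sup_le X x T)).
Proof.
move=> x0 l0 eT; have [mT hT iT] := eT.
pose A (n : nat) := [set f : R -> R | forall m : nat, setT m -> forall k : nat,
  k%:R * (1 / 2 ^+ m) <= n.+1%:R^-1 :> R -> f (k%:R * (1 / 2 ^+ m)) <= x].
have sA n : path_sigma (A n).
  apply: (@path_sigma_bigcap _ setT (fun m => [set f | forall k : nat,
    k%:R * (1 / 2 ^+ m) <= n.+1%:R^-1 :> R -> f (k%:R * (1 / 2 ^+ m)) <= x])) => m _.
  apply: (@path_sigma_bigcap _ (fun k => k%:R * (1 / 2 ^+ m) <= n.+1%:R^-1 :> R)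
    (fun k => [set f | f (k%:R * (1 / 2 ^+ m)) <= x])) => k _.
  apply: (@path_sigma_coord _ _ [set y | y <= x]).
    by rewrite mulr_ge0// divr_ge0// exprn_ge0.
  by rewrite -[X in measurable X]set_itvNyc; exact: measurable_itv.
have gpos (m k : nat) : 0 <= k%:R * (1 / 2 ^+ m) :> R.
  by rewrite mulr_ge0// divr_ge0// exprn_ge0.
pose F n := sample_path X @^-1` A n.
have mF n : measurable (F n) by exact: (measurable_path sX).
have [n hn] : exists n : nat, (0%:E < P (F n))%E.
  apply: (@exists_probability_gt _ _ _ _ _ setT) => //.
  - move=> n w hw m _ k hk; apply: (hw m) => //; apply: le_trans hk _.
    by rewrite lef_pV2 ?posrE// ler_nat.
  - apply/seteqP; split => // w _.
    have [e e0 he] := right_near ((levy_cadlag lX w).1 0 (lexx 0)) x0.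
    have [n hn] := exists_invSn_lt e0; exists n => // m _ k hk.
    have [->|hk0] := eqVneq (k%:R * (1 / 2 ^+ m)) (0 : R).
      by rewrite /sample_path (levy_start lX) ltW.
    have := he (k%:R * (1 / 2 ^+ m)).
    rewrite add0r (le_lt_trans hk hn) lt_neqAle eq_sym hk0 gpos => /(_ isT).
    by rewrite ltr_distlC /sample_path (levy_start lX) !add0r => /andP[_ /ltW].
  - by rewrite probability_setT lte_fin.
pose E := [set w | T w < n.+1%:R^-1].
have mE : measurable E by exact: measurable_lt_rv.
have msup := measurable_sup_le sX (ltW x0) mT.
have nV0 : 0 < n.+1%:R^-1 :> R by rewrite invr_gt0.
have PE : (0 < P E)%E.
  rewrite (_ : E = ~` [set w | n.+1%:R^-1 <= T w]).
    rewrite probability_setC ?hT ?(ltW nV0)//; last exact: measurable_ge_rv.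
    by rewrite -EFinB lte_fin subr_gt0 expR_lt1 oppr_lt0 mulr_gt0.
  by apply/seteqP; split => w /=; rewrite /E/= ltNge => /negP.
rewrite -lte_fin fineK ?fin_num_measure//.
apply: (@lt_le_trans _ _ (P (F n `&` E))).
  rewrite iT; first by rewrite mule_gt0.
  - by exists (A n) => //; rewrite setTI.
  - exists `]-oo, n.+1%:R^-1[%classic; first exact: measurable_itv.
    by rewrite setTI.
apply: le_measure; rewrite ?inE//; first exact: measurableI.
move=> w [/= hF hE]; rewrite /sup_le/=.
have [T0|T0] := ltP (T w) 0; first by rewrite running_sup_neg// ltW.
apply/(running_sup_le (levy_cadlag lX w) x T0) => s /andP[s0 sT].
apply: (@le_on_grid _ (sample_path X w) 1 s n.+1%:R^-1) => //.
- exact: (levy_cadlag lX w).1.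
- exact: le_lt_trans hE.
- by move=> m k hk; apply: (hF m).
Qed.

End positivity.

(** * The scaling function and its limit at 0 *)

Section regular_variation.
Context (d : measure_display) (Omega : measurableType d) (R : realType).
Variables (P : probability Omega R) (alpha : R) (X : R -> Omega -> R).
Hypothesis halpha : 1 < alpha.
Hypothesis sX : stable_levy_process P alpha X.
Let rho : R := fine (P [set w | 0 <= X 1 w]).

(* [K] is the ratio of the left side of (i) to [l ^ rho * x ^ (alpha * rho)],
   which by scaling is a function of [l * x ^ alpha] only. *)
Lemma supremum_law (e : R -> Omega -> R) :
  (forall l, 0 < l -> exp_time P X l (e l)) ->
  exists (k : R) (K : R -> R),
  [/\ 0 < k, (forall s, 0 < s -> 0 < K s <= k),
      (forall s t, 0 < s -> s <= t -> K t <= K s),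
      (forall eps, 0 < eps -> exists2 s0 : R, 0 < s0 & k - eps < K s0) &
      forall l x T, 0 < l -> 0 < x -> exp_time P X l T ->
        fine (P (sup_le X x T)) = l `^ rho * x `^ (alpha * rho) * K (l * x `^ alpha)].
Proof.
move=> he; pose K s := fine (P (sup_le X 1 (e s))) / s `^ rho.
have Kpos s : 0 < s -> 0 < K s.
  move=> s0; rewrite divr_gt0 ?powR_gt0//.
  exact: (sup_le_gt0 sX ltr01 s0 (he s s0)).
have Kmono s t : 0 < s -> s <= t -> K t <= K s.
  move=> s0 st; have t0 : 0 < t by apply: lt_le_trans st.
  have := sup_le_ratio sX s0 st ler01 (he s s0) (he t t0).
  rewrite -/rho /K ler_pdivlMr ?powR_gt0// mulrAC -mulrA.
  suff -> : (s / t) `^ rho = s `^ rho / t `^ rho by [].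
  have -> : s `^ rho = (s / t) `^ rho * t `^ rho.
    have st0 : 0 <= s / t by rewrite divr_ge0// ltW.
    by rewrite -(powRM _ st0 (ltW t0)) divfK// gt_eqF.
  by rewrite mulfK// gt_eqF// powR_gt0.
have [C hC] := sup_le_bound halpha sX ler01.
pose A := [set K s | s in [set s | 0 < s]].
have A0 : A !=set0 by exists (K 1), 1 => //=.
have ubA : ubound A C.
  (* The bound is known for rates at most 1; monotonicity of [K] carries it to all others. *)
  move=> _ [s /= s0 <-]; apply: (@le_trans _ _ (K (Num.min s 1))).
    by apply: Kmono; rewrite ?lt_min ?s0 ?ltr01// ge_min lexx.
  have m0 : 0 < Num.min s 1 by rewrite lt_min s0 ltr01.
  rewrite ler_pdivrMr ?powR_gt0//; apply: hC => //; last exact: he.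
  by rewrite ge_min lexx orbT.
have supA : has_sup A by split => //; exists C.
have Kle s : 0 < s -> K s <= sup A.
  by move=> s0; apply: ub_le_sup; [exists C|exists s].
exists (sup A), K; split => //.
- exact: lt_le_trans (Kpos 1 ltr01) (Kle 1 ltr01).
- by move=> s s0; rewrite Kpos// Kle.
- by move=> eps eps0; have [_ [s0 /= s00 <-] h] := sup_adherent eps0 supA; exists s0.
move=> l x T l0 x0 eT; have xa0 : 0 < x `^ alpha by exact: powR_gt0.
have alpha0 : alpha != 0 by rewrite gt_eqF// (lt_trans _ halpha).
(* Scaling time by x^(-alpha) brings the level x to 1 and the rate l to l x^alpha. *)
pose c := (x `^ alpha)^-1; have c0 : 0 < c by rewrite invr_gt0.
have lc : l / c = l * x `^ alpha by rewrite invrK.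
have lx0 : 0 < l * x `^ alpha by rewrite mulr_gt0.
have eT' : exp_time P X (l / c) (e (l * x `^ alpha)) by rewrite lc; exact: he.
rewrite -(sup_le_scaling sX c0 l0 (ltW x0) eT eT').
have -> : c `^ alpha^-1 * x = 1.
  rewrite /c -powRN -powRrM mulNr mulfV// powR_inv1 ?(ltW x0)//.
  by rewrite mulVf// gt_eqF.
rewrite powRrM -powRM ?(ltW l0) ?(ltW xa0)//.
by rewrite /K [RHS]mulrC divfK// gt_eqF// powR_gt0.
Qed.

End regular_variation.

(** * Gamma integrals and asymptotics *)

Section gamma_integrals.
Context (R : realType).
Local Notation leb := (@lebesgue_measure R).
Implicit Types (a m x y z v : R).

(** This is ln u <= u at u = m y / a; the constant is (m / a)^(-a). *)
Lemma powR_le_expR a m : 0 < a -> 0 < m ->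
  exists2 C : R, 0 < C & forall y, 0 <= y -> y `^ a <= C * expR (m * y).
Proof.
move=> a0 m0; exists (expR (- (a * ln (m / a)))); first exact: expR_gt0.
move=> y; rewrite le_eqVlt => /orP[/eqP <-|y0].
  by rewrite powR0 ?gt_eqF// mulr_ge0 ?expR_ge0.
rewrite /powR gt_eqF// -expRD ler_expR.
have ma0 : 0 < m / a by rewrite divr_gt0.
have := ln_sublinear (mulr_gt0 ma0 y0).
rewrite [X in X < _]lnM ?posrE// => /ltW h.
have : a * (ln (m / a) + ln y) <= a * (m / a * y) by rewrite ler_wpM2l// ltW.
have -> : a * (m / a * y) = m * y by field; rewrite gt_eqF.
by rewrite mulrDr; lra.
Qed.

Lemma measurable_expRM m (D : set R) : measurable_fun D (fun v => expR (- (m * v))).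
Proof.
apply: (measurableT_comp (@measurable_expR R)).
by apply: measurable_funN; apply: measurable_funM.
Qed.

Lemma integrable_expR_tail m x : 0 < m ->
  leb.-integrable `[x, +oo[ (fun v => (expR (- (m * v)))%:E).
Proof.
move=> m0; apply/integrableP; split.
  by apply/measurable_EFinP; exact: measurable_expRM.
have h : (\int[leb]_(v in `[x, +oo[) (m * expR (- (m * v)))%:E < +oo)%E.
  by rewrite integral_exp_tail// ltry.
move: h; under eq_integral do rewrite EFinM.
rewrite ge0_integralZl//; last 2 first.
- by apply/measurable_EFinP; exact: measurable_expRM.
- by rewrite lee_fin ltW.
move=> h; under eq_integral do rewrite abse_EFin ger0_norm ?expR_ge0//.
rewrite ltey; apply/eqP => e; move: h; rewrite e gt0_muley ?lte_fin//.
Qed.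

Lemma integrable_gamma_density a m x : 0 < a -> 0 < m -> 0 <= x ->
  leb.-integrable `[x, +oo[ (fun v => (expR (- (m * v)) * v `^ a)%:E).
Proof.
move=> a0 m0 x0; have m20 : 0 < m / 2 by rewrite divr_gt0.
have [C C0 hC] := powR_le_expR a0 m20.
have ig : leb.-integrable `[x, +oo[ (fun v => C%:E * (expR (- (m / 2 * v)))%:E)%E.
  by apply: integrableZl => //; exact: integrable_expR_tail.
apply: (le_integrable _ _ _ ig) => //.
- apply/measurable_EFinP; apply: measurable_funM; first exact: measurable_expRM.
  by apply: measurable_funTS; exact: measurable_powR.
- move=> v /=; rewrite in_itv/= andbT => xv; have v0 := le_trans x0 xv.
  rewrite lee_fin !ger0_norm; last 2 first.
  + by rewrite mulr_ge0 ?expR_ge0// ltW.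
  + by rewrite mulr_ge0 ?expR_ge0// powR_ge0.
  have -> : - (m / 2 * v) = - (m * v) + m / 2 * v by lra.
  by rewrite expRD mulrCA ler_wpM2l ?expR_ge0// hC.
Qed.

Lemma integrable_gamma_density1 a x : 0 < a -> 0 <= x ->
  leb.-integrable `[x, +oo[ (fun v => (expR (- v) * v `^ a)%:E).
Proof.
move=> a0 x0; have := integrable_gamma_density a0 ltr01 x0.
rewrite (_ : (fun v => (expR (- (1 * v)) * v `^ a)%:E) =
  (fun v => (expR (- v) * v `^ a)%:E))//.
by apply/funext => v; rewrite mul1r.
Qed.

Lemma continuous_gamma_density_at a y : 0 < y ->
  {for y, continuous (fun y : R => expR (- y) * y `^ a)}.
Proof.
move=> y0; apply: differentiable_continuous; apply/derivable1_diffP.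
by apply: derivableM; [exact: ex_derive|apply: derivable_powR; rewrite in_itv/= y0].
Qed.

Lemma continuous_gamma_density a : 0 < a -> {within `[0, +oo[, continuous (fun y : R => expR (- y) * y `^ a)}.
Proof.
move=> a0; apply/continuous_within_itvcyP; split.
  move=> y; rewrite in_itv/= andbT => y0.
  exact: continuous_gamma_density_at.
rewrite powR0 ?gt_eqF//.
apply: cvgM; last exact: powR_cvg0.
by apply: cvg_at_right_filter; apply: continuous_comp; [exact: oppr_continuous|exact: continuous_expR].
Qed.

Lemma gamma_substitution a m x : 0 < a -> 0 < m -> 0 <= x ->
  \int[leb]_(v in `[x, +oo[) (m * expR (- (m * v)) * v `^ a) =
  (\int[leb]_(y in `[m * x, +oo[) (expR (- y) * y `^ a)) * m `^ (- a).
Proof.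
move=> a0 m0 x0.
have dF v : is_derive v (1 : R) (fun v : R => m * v) m.
  by apply: is_derive_eq; rewrite /GRing.scale/=; ring.
have dFE : (fun v : R => m * v)^`()%classic = cst m.
  by apply/funext => v; rewrite derive1E; have [_ ->] := dF v.
have hsub : (\int[leb]_(y in `[(m * x)%R, +oo[) (expR (- y) * y `^ a)%:E =
    \int[leb]_(v in `[x, +oo[) ((expR (- (m * v)) * (m * v) `^ a) * m)%:E)%E.
  rewrite (@increasing_ge0_integration_by_substitutiony R (fun v => m * v)
    (fun y => expR (- y) * y `^ a) x); rewrite ?dFE//.
  - by move=> y z _ _; rewrite ltr_pM2l.
  - by move=> y _; exact: cst_continuous.
  - exact: is_cvg_cst.
  - exact: is_cvg_cst.
  - split; first by move=> v _; have [] := dF v.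
    apply: cvg_at_right_filter; apply: differentiable_continuous.
    by apply/derivable1_diffP; have [] := dF x.
  - exact: gt0_cvgMry.
  - apply: continuous_subspaceW (continuous_gamma_density a0) => y /=.
    by rewrite !in_itv/= !andbT; apply: le_trans; rewrite mulr_ge0// ltW.
  - by move=> y _; rewrite mulr_ge0 ?expR_ge0// powR_ge0.
have fin : (\int[leb]_(y in `[(m * x)%R, +oo[) (expR (- y) * y `^ a)%:E)%E \is a fin_num.
  apply: integrable_fin_num => //.
  by apply: integrable_gamma_density1 => //; rewrite mulr_ge0// ltW.
rewrite /Rintegral -[m `^ (- a)]/(fine (m `^ (- a))%:E) -fineM// muleC hsub.
rewrite -ge0_integralZl//.
- congr fine; apply: eq_integral => v; rewrite inE/= in_itv/= andbT => xv.
  rewrite -EFinM; congr _%:E.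
  rewrite powRM ?(ltW m0) ?(le_trans x0 xv)// powRN.
  by field; rewrite gt_eqF// powR_gt0.
- apply/measurable_EFinP; apply: measurable_funM => //.
  apply: measurable_funM; first exact: measurable_expRM.
  by apply: (measurableT_comp (measurable_powR _)); apply: measurable_funM.
- by move=> v _; rewrite lee_fin !mulr_ge0 ?expR_ge0 ?powR_ge0// ltW.
- by rewrite lee_fin powR_ge0.
Qed.

(** The exponent a - 1 may be negative; on y >= z > 0 one has y^(a-1) <= y^a / z. *)
Lemma integrable_gamma_density_sub1 a z : 0 < a -> 0 < z ->
  leb.-integrable `[z, +oo[ (fun y => (expR (- y) * y `^ (a - 1))%:E).
Proof.
move=> a0 z0; pose f1 y := expR (- y) * y `^ a.
have i1 : leb.-integrable `[z, +oo[ (EFin \o f1).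
  by apply: integrable_gamma_density1 => //; rewrite ltW.
have i1z : leb.-integrable `[z, +oo[ (fun y => (z^-1)%:E * (f1 y)%:E)%E.
  exact: integrableZl.
apply: (le_integrable _ _ _ i1z) => //.
- apply/measurable_EFinP; apply: measurable_funM.
    apply: measurable_funTS; apply: (measurableT_comp (@measurable_expR R)).
    exact: measurable_funN.
  by apply: measurable_funTS; exact: measurable_powR.
move=> y /=; rewrite in_itv/= andbT => zy; have y0 : 0 < y by apply: lt_le_trans zy.
have f1_ge0 : 0 <= f1 y by rewrite mulr_ge0 ?expR_ge0// powR_ge0.
rewrite lee_fin !ger0_norm.
- have h0 : (a == 1) ==> (y != 0) by rewrite (gt_eqF y0) implybT.
  by rewrite powRB// powRr1 ?(ltW y0)// mulrA mulrC ler_wpM2r// lef_pV2.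
- by rewrite mulr_ge0// invr_ge0 ltW.
- by rewrite mulr_ge0 ?expR_ge0 ?powR_ge0.
Qed.

Lemma gamma_tail_pos a z : 0 < a -> 0 < z ->
  0 < \int[leb]_(y in `[z, +oo[) (expR (- y) * y `^ (a - 1)).
Proof.
move=> a0 z0; have two0 : 0 < 2 :> R by [].
(* On y >= z, y^(a-1) = y^a / y >= z^a exp(-y), which leaves a lower bound with an explicit
   integral. *)
pose c := z `^ a / 2; have c0 : 0 < c by rewrite divr_gt0// powR_gt0.
have ih : leb.-integrable `[z, +oo[ (EFin \o (fun y => 2 * expR (- (2 * y)))).
  have : leb.-integrable `[z, +oo[ (fun y => 2%:E * (expR (- (2 * y)))%:E)%E.
    by apply: integrableZl => //; exact: integrable_expR_tail.
  by rewrite (_ : (fun y => 2%:E * (expR (- (2 * y)))%:E)%E = EFin \o (fun y => 2 * expR (- (2 * y)))).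
have ihc : leb.-integrable `[z, +oo[ (EFin \o (fun y => c * (2 * expR (- (2 * y))))).
  have : leb.-integrable `[z, +oo[ (fun y => c%:E * (EFin \o (fun y => (2 * expR (- (2 * y)))%R)) y)%E.
    exact: integrableZl.
  by rewrite (_ : (fun y => c%:E * _)%E = EFin \o (fun y => c * (2 * expR (- (2 * y))))).
apply: (@lt_le_trans _ _ (\int[leb]_(y in `[z, +oo[) (c * (2 * expR (- (2 * y)))))).
  have -> : \int[leb]_(y in `[z, +oo[) (c * (2 * expR (- (2 * y)))) =
      c * \int[leb]_(y in `[z, +oo[) (2 * expR (- (2 * y))) by exact: RintegralZl.
  by rewrite /Rintegral integral_exp_tail//= mulr_gt0// expR_gt0.
apply: le_Rintegral => //; first exact: integrable_gamma_density_sub1.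
move=> y /=; rewrite in_itv/= andbT => zy; have y0 : 0 < y by apply: lt_le_trans zy.
have h0 : (a == 1) ==> (y != 0) by rewrite (gt_eqF y0) implybT.
rewrite powRB// powRr1 ?(ltW y0)// [leRHS]mulrA ler_pdivlMr//.
have yle : y <= expR y by have := expR_ge1Dx y; lra.
have za : z `^ a <= y `^ a by rewrite ge0_ler_powR ?nnegrE ?(ltW a0) ?(ltW z0) ?(ltW y0).
have -> : c * (2 * expR (- (2 * y))) * y = z `^ a * (expR (- (2 * y)) * y).
  by rewrite /c; field.
have -> : expR (- y) * y `^ a = y `^ a * (expR (- (2 * y)) * expR y).
  by rewrite mulrC; congr (_ * _); rewrite -expRD; congr expR; lra.
apply: ler_pM => //; first exact: powR_ge0.
  by rewrite mulr_ge0 ?expR_ge0// ltW.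
by rewrite ler_wpM2l ?expR_ge0.
Qed.

(** The derivative of -exp(-y) y^a changes sign, while the fundamental theorem used on the half-line
    is for nonnegative integrands. A multiple of the exponential [h] is added to make the integrand
    nonnegative, and its explicit integral is subtracted at the end. *)
Lemma gamma_by_parts a z : 0 < a -> 0 < z ->
  \int[leb]_(y in `[z, +oo[) (expR (- y) * y `^ a) =
  expR (- z) * z `^ a + a * \int[leb]_(y in `[z, +oo[) (expR (- y) * y `^ (a - 1)).
Proof.
move=> a0 z0; have h20 : 0 < 2^-1 :> R by rewrite invr_gt0.
have [C C0 hC] := powR_le_expR a0 h20.
(* Large enough for D h y to dominate a exp(-y) y^(a-1) on y >= z, given y^a <= C exp(y / 2). *)
pose D := 2 * a * C / z; have D0 : 0 < D by rewrite divr_gt0// !mulr_gt0.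
pose f1 y := expR (- y) * y `^ a; pose f2 y := expR (- y) * y `^ (a - 1).
pose h y := 2^-1 * expR (- (2^-1 * y)) .
pose f y := f1 y - a * f2 y + D * h y.
pose F y := - f1 y - D * expR (- (2^-1 * y)).
have expR_half y : expR (- y) * expR (2^-1 * y) = expR (- (2^-1 * y)).
  by rewrite -expRD; congr expR; lra.
have f1_le y : 0 <= y -> f1 y <= C * expR (- (2^-1 * y)).
  by move=> y0; rewrite /f1 -expR_half mulrCA ler_wpM2l ?expR_ge0// hC.
have f1_ge0 y : 0 <= f1 y by rewrite mulr_ge0 ?expR_ge0// powR_ge0.
have f2E y : 0 < y -> f2 y = f1 y / y.
    move=> y0; have h0 : (a == 1) ==> (y != 0) by rewrite (gt_eqF y0) implybT.
    by rewrite /f2 powRB// powRr1 ?(ltW y0)// mulrA.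
have f_ge0 y : z <= y -> 0 <= f y.
  move=> zy; have y0 : 0 < y by apply: lt_le_trans zy.
  have Cz : a * f2 y <= D * h y.
    rewrite f2E// /D /h mulrA ler_pdivrMr//.
    apply: (@le_trans _ _ (a * (C * expR (- (2^-1 * y))))).
      by rewrite ler_wpM2l ?f1_le// ltW.
    have -> : 2 * a * C / z * (2^-1 * expR (- (2^-1 * y))) * y =
        a * (C * expR (- (2^-1 * y))) * (y / z) by field; rewrite gt_eqF.
    rewrite ler_peMr ?ler_pdivlMr ?mul1r// mulr_ge0 ?(ltW a0)// mulr_ge0 ?expR_ge0//.
    exact: ltW.
  by rewrite /f; have := f1_ge0 y; lra.
have dF y : 0 < y -> is_derive y (1 : R) F (f y).
  move=> y0; have := is_derive1_powR a y0 => dp.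
  apply: is_derive_eq.
  rewrite /GRing.scale/= /f /f1 /f2 /h; ring.
have cf : {within `[z, +oo[, continuous f}.
  apply: continuous_in_subspaceT => y; rewrite inE/= in_itv/= andbT => zy.
  have y0 : 0 < y by apply: lt_le_trans zy.
  have ch : {for y, continuous h}.
    apply: differentiable_continuous; apply/derivable1_diffP.
    by apply: derivableM => //; exact: ex_derive.
  apply: (@cvgD _ _ _ _ _ (fun y => f1 y - a * f2 y) (fun y => D * h y)).
    apply: (@cvgB _ _ _ _ _ f1 (fun y => a * f2 y)); first exact: continuous_gamma_density_at.
    by apply: cvgMl_tmp; exact: continuous_gamma_density_at.
  by apply: cvgMl_tmp; exact: ch.
have hF : F y @[y --> +oo] --> 0.
  have he : expR (- (2^-1 * y)) @[y --> +oo] --> (0 : R).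
    apply: (@cvg_comp _ _ _ _ (fun z => expR (- z)) _ (pinfty_nbhs R)); last exact: cvgr_expR.
    exact: gt0_cvgMry.
  have h0 : - 0 - 0 = 0 :> R by rewrite oppr0 addr0.
  rewrite -[X in _ --> X]h0.
  apply: (@cvgB _ _ _ _ _ (fun y => - f1 y) (fun y => D * expR (- (2^-1 * y)))).
    apply: cvgN.
    have hC0 : C * expR (- (2^-1 * y)) @[y --> +oo] --> (0 : R).
      by rewrite -(mulr0 C); apply: cvgMl_tmp.
    apply: (squeeze_cvgr _ (cvg_cst (0 : R)) hC0).
    exists 0; split; first exact: num_real.
    by move=> y /ltW y0; rewrite f1_ge0 f1_le.
  by rewrite -(mulr0 D); apply: cvgMl_tmp.
have FTC : (\int[leb]_(y in `[z, +oo[) (f y)%:E = (0 - F z)%:E)%E.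
  apply: (ge0_continuous_FTC2y f_ge0 cf hF).
  - by move=> y zy; have [] := dF y (lt_trans z0 zy).
  - apply: cvg_at_right_filter; apply: differentiable_continuous.
    by apply/derivable1_diffP; have [] := dF z z0.
  - move=> y; rewrite in_itv/= andbT => zy; rewrite derive1E.
    by have [_ ->] := dF y (lt_trans z0 zy).
have i1 : leb.-integrable `[z, +oo[ (EFin \o f1).
  by apply: integrable_gamma_density1 => //; rewrite ltW.
have i2 : leb.-integrable `[z, +oo[ (EFin \o f2) by exact: integrable_gamma_density_sub1.
have i3 : leb.-integrable `[z, +oo[ (EFin \o h).
  rewrite (_ : EFin \o h = fun y => ((2^-1)%:E * (expR (- (2^-1 * y)))%:E)%E)//.
  by apply: integrableZl => //; exact: integrable_expR_tail.
have e3 : \int[leb]_(y in `[z, +oo[) h y = expR (- (2^-1 * z)).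
  by rewrite /Rintegral integral_exp_tail.
have e : \int[leb]_(y in `[z, +oo[) f y = - F z.
  by rewrite /Rintegral FTC/= sub0r.
have i2a : leb.-integrable `[z, +oo[ (EFin \o (fun y => a * f2 y)).
  have : leb.-integrable `[z, +oo[ (fun y => a%:E * (EFin \o f2) y)%E.
    exact: integrableZl.
  by rewrite (_ : (fun y => a%:E * (EFin \o f2) y)%E = EFin \o (fun y => a * f2 y)).
have i3D : leb.-integrable `[z, +oo[ (EFin \o (fun y => D * h y)).
  have : leb.-integrable `[z, +oo[ (fun y => D%:E * (EFin \o h) y)%E.
    exact: integrableZl.
  by rewrite (_ : (fun y => D%:E * (EFin \o h) y)%E = EFin \o (fun y => D * h y)).
have i12 : leb.-integrable `[z, +oo[ (EFin \o (fun y => f1 y - a * f2 y)).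
  have : leb.-integrable `[z, +oo[ ((EFin \o f1) \- (EFin \o (fun y => (a * f2 y)%R)))%E.
    exact: integrableB.
  by rewrite (_ : (_ \- _)%E = EFin \o (fun y => f1 y - a * f2 y)).
have eD : \int[leb]_(y in `[z, +oo[) f y =
    \int[leb]_(y in `[z, +oo[) (f1 y - a * f2 y) + \int[leb]_(y in `[z, +oo[) (D * h y).
  exact: RintegralD.
have eB : \int[leb]_(y in `[z, +oo[) (f1 y - a * f2 y) =
    \int[leb]_(y in `[z, +oo[) f1 y - \int[leb]_(y in `[z, +oo[) (a * f2 y).
  exact: RintegralB.
have eZ : \int[leb]_(y in `[z, +oo[) (a * f2 y) = a * \int[leb]_(y in `[z, +oo[) f2 y.
  exact: RintegralZl.
have eZ' : \int[leb]_(y in `[z, +oo[) (D * h y) = D * \int[leb]_(y in `[z, +oo[) h y.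
  exact: RintegralZl.
move: e; rewrite eD eB eZ eZ' e3 /F -/(f1 z).
set I1 := \int[leb]_(y in `[z, +oo[) f1 y; set I2 := \int[leb]_(y in `[z, +oo[) f2 y.
by move=> e; change (I1 = f1 z + a * I2); lra.
Qed.

End gamma_integrals.

(** * Passage to the limit under the integral *)

Section abelian_limit.
Context (R : realType).
Local Notation leb := (@lebesgue_measure R).

Lemma abelian_limit (F : R -> R -> R) (K : R -> R) (k a al rho m x : R) :
  0 < a -> 0 < m -> 0 <= x ->
  (forall l, 0 < l -> measurable_fun setT (F l)) ->
  (forall s, 0 < s -> 0 < K s <= k) ->
  (forall s t, 0 < s -> s <= t -> K t <= K s) ->
  (forall eps, 0 < eps -> exists2 s0 : R, 0 < s0 & k - eps < K s0) ->
  (forall l v, 0 < l -> 0 < v -> F l v = l `^ rho * v `^ a * K (l * v `^ al)) ->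
  (\int[leb]_(v in `[x, +oo[) (m * expR (- (m * v)) * F l v)) / l `^ rho
    @[l --> (0 : R)^'+] --> k * \int[leb]_(v in `[x, +oo[) (m * expR (- (m * v)) * v `^ a).
Proof.
move=> a0 m0 x0 mF hK Kmono Ksup hF.
(* Sequences tending to 0 from the right, as dominated convergence is a statement about
   sequences. *)
apply/cvg_at_rightP => u [u0 ucv].
have mexp (D : set R) : measurable_fun D (fun v => m * expR (- (m * v))).
  by apply: measurable_funM => //; exact: measurable_expRM.
have mint l (D : set R) : 0 < l -> measurable_fun D (fun v => m * expR (- (m * v)) * F l v).
  move=> l0; apply: measurable_funM => //.
  by apply: measurable_funTS; exact: mF.
(* Open at x: the formula for [F l v] requires v > 0 and x may be 0. The endpoint is a null set. *)
pose D : set R := `]x, +oo[%classic.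
pose f_ n v := (m * expR (- (m * v)) * F (u n) v / u n `^ rho)%:E.
pose g v := (k * (m * expR (- (m * v)) * v `^ a))%:E.
have mD : measurable D by exact: measurable_itv.
have subD : D `<=` `[x, +oo[%classic.
  by move=> v; rewrite /D/= !in_itv/= !andbT; exact: ltW.
have gint : leb.-integrable D g.
  have i0 : leb.-integrable D (fun v => (expR (- (m * v)) * v `^ a)%:E).
    by apply: (integrableS _ _ _ (integrable_gamma_density a0 m0 x0)).
  have : leb.-integrable D (fun v => (k * m)%:E * (expR (- (m * v)) * v `^ a)%:E)%E.
    exact: integrableZl.
  rewrite (_ : (fun v => (k * m)%:E * _)%E = g)//.
  by apply/funext => v; rewrite /g -EFinM; congr _%:E; ring.
have un0 n : 0 < u n `^ rho by rewrite powR_gt0.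
have f_E n v : D v -> f_ n v = (m * expR (- (m * v)) * v `^ a * K (u n * v `^ al))%:E.
  rewrite /D/= in_itv/= andbT => xv; have v0 := le_lt_trans x0 xv.
  rewrite /f_ hF//; congr _%:E; field; rewrite gt_eqF//.
have KE v : 0 < v -> K (u n * v `^ al) @[n --> \oo] --> k.
  move=> v0; have va0 : 0 < v `^ al by rewrite powR_gt0.
  apply/cvgrPdist_lt => eps eps0; have [s0 s00 hs0] := Ksup eps eps0.
  have s0v : 0 < s0 / v `^ al by rewrite divr_gt0.
  have /cvgr_lt/(_ _ s0v) := ucv; apply: filterS => n.
  rewrite ltr_pdivlMr// => /ltW hn.
  have := Kmono _ _ (mulr_gt0 (u0 n) va0) hn.
  have /andP[_] := hK _ (mulr_gt0 (u0 n) va0) => h1 h2.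
  rewrite ger0_norm ?subr_ge0//; lra.
have mf_ n : measurable_fun D (f_ n).
  by apply/measurable_EFinP; apply: measurable_funM => //; exact: mint.
have f_g n v : D v -> (`|f_ n v| <= g v)%E.
  move=> Dv; rewrite f_E//; have v0 : 0 < v.
    by move: Dv; rewrite /D/= in_itv/= andbT; exact: le_lt_trans.
  have /andP[K0 Kk] := hK _ (mulr_gt0 (u0 n) (powR_gt0 al v0)).
  have w0 : 0 <= m * expR (- (m * v)) * v `^ a.
    by rewrite !mulr_ge0 ?expR_ge0 ?powR_ge0// ltW.
  rewrite abse_EFin lee_fin ger0_norm; last by rewrite mulr_ge0// ltW.
  by rewrite [k * _]mulrC ler_wpM2l.
have i_ n : leb.-integrable D (f_ n).
  apply: (le_integrable _ _ _ gint); [exact: mD|exact: mf_|move=> v Dv].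
  by rewrite (le_trans (f_g n v Dv))// lee_abs.
have [||||_ _] := @dominated_convergence _ _ _ leb D mD f_ g g mf_.
- by case/integrableP: gint.
- apply/aeW => v Dv; rewrite (_ : f_ ^~ v = fun n =>
    (m * expR (- (m * v)) * v `^ a * K (u n * v `^ al))%:E); last first.
    by apply/funext => n; rewrite f_E.
  apply: cvg_EFin; first exact: nearW.
  rewrite [k * _]mulrC; apply: cvgMl_tmp; apply: KE.
  by move: Dv; rewrite /D/= in_itv/= andbT; exact: le_lt_trans.
- exact: gint.
- by apply/aeW => v n; exact: f_g.
move=> lim; have Rg : \int[leb]_(v in D) (k * (m * expR (- (m * v)) * v `^ a)) =
    k * \int[leb]_(v in `[x, +oo[) (m * expR (- (m * v)) * v `^ a).
  have iw : leb.-integrable D (EFin \o (fun v => m * expR (- (m * v)) * v `^ a)).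
    have : leb.-integrable D (fun v => m%:E * (expR (- (m * v)) * v `^ a)%:E)%E.
      apply: integrableZl => //.
      by apply: (integrableS _ _ _ (integrable_gamma_density a0 m0 x0)).
    rewrite (_ : (fun v => m%:E * _)%E = EFin \o (fun v => m * expR (- (m * v)) * v `^ a))//.
    by apply/funext => v; rewrite /= -mulrA.
  have -> : \int[leb]_(v in `[x, +oo[) (m * expR (- (m * v)) * v `^ a) =
      \int[leb]_(v in D) (m * expR (- (m * v)) * v `^ a).
    by apply: esym; apply: Rintegral_itv_obnd_cbnd; exact: iw.
  exact: RintegralZl.
rewrite -Rg.
have Rf n : (\int[leb]_(v in `[x, +oo[) (m * expR (- (m * v)) * F (u n) v)) / u n `^ rho =
    fine (\int[leb]_(v in D) f_ n v)%E.
  have -> : \int[leb]_(v in `[x, +oo[) (m * expR (- (m * v)) * F (u n) v) =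
      \int[leb]_(v in D) (m * expR (- (m * v)) * F (u n) v).
    apply: esym; apply: Rintegral_itv_obnd_cbnd.
    have : leb.-integrable D (fun v => (u n `^ rho)%:E * f_ n v)%E by exact: integrableZl.
    rewrite (_ : (fun v => (u n `^ rho)%:E * f_ n v)%E =
      EFin \o (fun v => m * expR (- (m * v)) * F (u n) v))//.
    by apply/funext => v; rewrite /f_ -EFinM /= mulrC divfK// gt_eqF.
  have -> : \int[leb]_(v in D) (m * expR (- (m * v)) * F (u n) v) =
      \int[leb]_(v in D) (m * expR (- (m * v)) * F (u n) v / u n `^ rho * u n `^ rho).
    by apply: eq_Rintegral => v _; rewrite divfK// gt_eqF.
  have -> : \int[leb]_(v in D) (m * expR (- (m * v)) * F (u n) v / u n `^ rho * u n `^ rho) =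
      \int[leb]_(v in D) (m * expR (- (m * v)) * F (u n) v / u n `^ rho) * u n `^ rho.
    apply: RintegralZr => //; exact: i_.
  by rewrite mulfK// gt_eqF.
under eq_cvg do rewrite Rf.
apply: fine_cvg; rewrite /Rintegral fineK//; last exact: integrable_fin_num.
Qed.

End abelian_limit.

(** * Laplace transforms as integrals of the distribution function *)

Section layer_cake.
Context (d : measure_display) (Omega : measurableType d) (R : realType).
Variables (P : probability Omega R) (S : Omega -> R).
Hypothesis mS : measurable_fun setT S.
Local Notation leb := (@lebesgue_measure R).

(** Tonelli on the set of pairs (w, v) with v >= max(S w, x), each exponential being written as the
    integral of its tail. *)
Lemma expectation_expR_max m x : 0 < m -> 0 <= x ->
  (\int[P]_w (expR (- (m * Num.max (S w) x)))%:E =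
  \int[leb]_(v in `[x, +oo[) (m * expR (- (m * v)) * fine (P [set w | S w <= v]))%:E)%E.
Proof.
move=> m0 x0.
pose A := [set z : Omega * R | x <= z.2 /\ S z.1 <= z.2].
have mA : measurable A.
  have -> : A = [set z | x <= z.2] `&` [set z | S z.1 <= z.2] by [].
  apply: measurableI.
    have /(_ measurableT [set true]) := measurable_fun_ler
      (measurable_cst x : measurable_fun [set: Omega * R] _) measurable_snd.
    by rewrite setTI; apply.
  have /(_ measurableT [set true]) := measurable_fun_ler
    (measurableT_comp mS (@measurable_fst _ _ Omega R)) measurable_snd.
  by rewrite setTI; apply.
pose f (z : Omega * R) : \bar R := (m * expR (- (m * z.2)) * \1_A z)%:E.
have f0 z : (0 <= f z)%E.
  by rewrite lee_fin !mulr_ge0 ?expR_ge0 ?(ltW m0).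
have mf : measurable_fun setT f.
  apply/measurable_EFinP; apply: measurable_funM; last exact: measurable_indic.
  apply: measurable_funM => //; apply: (measurableT_comp (@measurable_expR R)).
  by apply: measurable_funN; apply: measurable_funM.
transitivity (\int[P]_w \int[leb]_v f (w, v))%E.
  apply: eq_integral => w _; rewrite -integral_exp_tail// integral_mkcond.
  apply: eq_integral => v _; rewrite /f /= patchE indicE.
  rewrite (_ : (v \in `[Num.max (S w) x, +oo[%classic) = ((w, v) \in A)).
    by case: ifP => _; rewrite ?mulr1 ?mulr0.
  apply/idP/idP; rewrite !inE /A/= in_itv/= andbT ge_max.
    by move=> /andP[].
  by move=> [-> ->].
transitivity (\int[leb]_v \int[P]_w f (w, v))%E.
  by apply: fubini_tonelli.
rewrite [RHS]integral_mkcond; apply: eq_integral => v _.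
have mSv : measurable [set w | S w <= v] by exact: measurable_le_rv.
rewrite patchE; case: ifPn => [|] hv.
  transitivity (\int[P]_w ((m * expR (- (m * v)))%:E * (\1_[set w | S w <= v] w)%:E))%E.
    apply: eq_integral => w _; rewrite /f -EFinM /=; congr (_ * _)%:E.
    rewrite !indicE; congr (_%:R); congr nat_of_bool.
    apply/idP/idP; rewrite !inE /A/=; first by case.
    by move=> h; split => //; move: hv; rewrite inE/= in_itv/= andbT.
  rewrite ge0_integralZl//; last by rewrite lee_fin mulr_ge0 ?expR_ge0// ltW.
  - by rewrite integral_indic// setIT [RHS]EFinM fineK// fin_num_measure.
  - by apply/measurable_EFinP; exact: measurable_indic.
apply: integral0_eq => w _; rewrite /f/= indicE (_ : _ \in A = false) ?mulr0//.
apply/negP; rewrite inE /A/= => -[h _]; move/negP: hv; apply.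
by rewrite inE/= in_itv/= andbT.
Qed.

End layer_cake.

(** * The four equivalents *)

Section conclusion.
Context (d : measure_display) (Omega : measurableType d) (R : realType).
Variables (P : probability Omega R) (alpha : R) (X : R -> Omega -> R).
Hypothesis sX : stable_levy_process P alpha X.
Let lX : levy_process P X := stable_levy sX.
Local Notation leb := (@lebesgue_measure R).

Lemma equiv_at0_powR (A B : R -> R) (c rho : R) : c != 0 ->
  (forall l, 0 < l -> A l = B l) -> B l / l `^ rho @[l --> (0 : R)^'+] --> c ->
  equiv_at0 A (fun l => c * l `^ rho).
Proof.
move=> c0 AB cB; rewrite /equiv_at0.
have : B l / l `^ rho / c @[l --> (0 : R)^'+] --> c / c by exact: cvgMr_tmp.
rewrite divff//; apply: cvg_trans; apply: near_eq_cvg.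
near=> l; have l0 : 0 < l by near: l; exact: nbhs_right_gt.
by rewrite AB// invfM mulrA mulrAC.
Unshelve. all: by end_near. Qed.

Lemma monotone_ratio_cvg (K : R -> R) (k y : R) : 0 < y ->
  (forall s, 0 < s -> 0 < K s <= k) ->
  (forall s t, 0 < s -> s <= t -> K t <= K s) ->
  (forall eps, 0 < eps -> exists2 s0 : R, 0 < s0 & k - eps < K s0) ->
  K (l * y) @[l --> (0 : R)^'+] --> k.
Proof.
move=> y0 hK Kmono Ksup; apply/cvgrPdist_lt => eps eps0.
have [s0 s00 hs0] := Ksup eps eps0.
near=> l; have l0 : 0 < l by near: l; exact: nbhs_right_gt.
have ly : l * y <= s0.
  rewrite -ler_pdivlMr// ltW//; near: l; apply: nbhs_right_lt.
  by rewrite divr_gt0.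
have := Kmono _ _ (mulr_gt0 l0 y0) ly.
have /andP[_] := hK _ (mulr_gt0 l0 y0) => h1 h2.
by rewrite ger0_norm ?subr_ge0//; lra.
Unshelve. all: by end_near. Qed.

Lemma sup_le_neg T v : v < 0 -> sup_le X v T = set0.
Proof.
move=> v0; rewrite -subset0 => w; rewrite /sup_le/= leNgt => /negP; apply.
apply: lt_le_trans v0 _.
exact: running_sup_ge0 (levy_cadlag lX w) (levy_start lX w) _.
Qed.

Lemma measurable_sup_leT T v : measurable_fun setT T -> measurable (sup_le X v T).
Proof.
move=> mT; have [v0|v0] := ltP v 0; first by rewrite sup_le_neg.
exact: (measurable_sup_le sX v0 mT).
Qed.

Lemma measurable_running_sup T : measurable_fun setT T ->
  measurable_fun setT (fun w => running_sup X (T w) w).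
Proof.
move=> mT mD; apply: (measurability _ (RGenOInfty.measurableE R)) => //.
move=> _ [_ [v ->] <-]; rewrite setTI.
rewrite (_ : _ @^-1` _ = ~` sup_le X v T).
  by apply: measurableC; exact: measurable_sup_leT.
by apply/seteqP; split => w /=; rewrite /sup_le/= in_itv/= andbT ltNge => /negP.
Qed.

Lemma sup_cdf_mono T : measurable_fun setT T ->
  {homo (fun v => fine (P (sup_le X v T))) : v v' / v <= v'}.
Proof.
move=> mT v v' vv'; have mv u := measurable_sup_leT u mT.
rewrite fine_le ?fin_num_measure// le_measure ?inE//.
by move=> w; rewrite /sup_le/= => /le_trans; apply.
Qed.

Let rho : R := fine (P [set w | 0 <= X 1 w]).
Variables (e : R -> Omega -> R) (k : R) (K : R -> R).
Hypothesis he : forall l, 0 < l -> exp_time P X l (e l).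
Hypothesis halpha : 1 < alpha.
Hypothesis k0 : 0 < k.
Hypothesis hK : forall s, 0 < s -> 0 < K s <= k.
Hypothesis Kmono : forall s t, 0 < s -> s <= t -> K t <= K s.
Hypothesis Ksup : forall eps, 0 < eps -> exists2 s0 : R, 0 < s0 & k - eps < K s0.
Hypothesis hF : forall l x T, 0 < l -> 0 < x -> exp_time P X l T ->
  fine (P (sup_le X x T)) = l `^ rho * x `^ (alpha * rho) * K (l * x `^ alpha).
Let a := alpha * rho.
Let F l v := fine (P (sup_le X v (e l))).
Let S l w := running_sup X (e l w) w.

Let mT l : 0 < l -> measurable_fun setT (e l).
Proof. by move=> /he []. Qed.

Let mS l : 0 < l -> measurable_fun setT (S l).
Proof. by move=> /mT; exact: measurable_running_sup. Qed.

Let rho0 : 0 < rho. Proof. exact: (rho_gt0 halpha sX). Qed.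

Let a0 : 0 < a. Proof. by rewrite mulr_gt0// (lt_trans _ halpha). Qed.

Let S_ge0 l w : 0 <= S l w.
Proof. exact: running_sup_ge0 (levy_cadlag lX w) (levy_start lX w) _. Qed.

(* [x |-> x ^ (-a) * P(S <= x)] is nonincreasing, so the law of [S] has no atom. *)
Lemma sup_lt_prob l x : 0 < l -> 0 < x -> fine (P [set w | S l w < x]) = F l x.
Proof.
move=> l0 x0; have mlt : measurable [set w | S l w < x].
  by apply: measurable_lt_rv; exact: mS.
have mle v : measurable (sup_le X v (e l)) by apply: measurable_sup_leT; exact: mT.
have F1 : F l x <= 1 by rewrite -lee_fin fineK ?fin_num_measure// probability_le1.
apply/le_anti/andP; split.
  rewrite fine_le ?fin_num_measure// le_measure ?inE//.
  by move=> w /= /ltW.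
apply/ler_addgt0Pl => eps eps0.
have [t /andP[t0 t1] te] : exists2 t : R, 0 < t < 1 & 1 - t <= eps.
  exists (Num.max 2^-1 (1 - eps)); last by rewrite lerBlDl -lerBlDr le_max lexx orbT.
  by rewrite lt_max invr_gt0 ltr0n/= gt_max invf_lt1// ltr1n/= gtrBl.
(* Chosen so that x'^a = t x^a. Since x' < x and [K] is nonincreasing, F l x' >= t F l x, a loss of
   at most 1 - t. *)
pose x' := t `^ a^-1 * x.
have ta0 : 0 < t `^ a^-1 by exact: powR_gt0.
have x'0 : 0 < x' by rewrite mulr_gt0.
have x'x : x' < x.
  rewrite gtr_pMl// /powR gt_eqF// -expR0 ltr_expR pmulr_rlt0 ?invr_gt0//.
  by rewrite ln_lt0// t0.
have Fx' : t * F l x <= F l x'.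
  rewrite /F (hF l0 x0 (he l0)) (hF l0 x'0 (he l0)).
  have -> : x' `^ (alpha * rho) = t * x `^ (alpha * rho).
    by rewrite powRM ?(ltW ta0) ?(ltW x0)// -powRrM mulVf ?gt_eqF// powRr1// ltW.
  have -> : t * (l `^ rho * x `^ (alpha * rho) * K (l * x `^ alpha)) =
    l `^ rho * (t * x `^ (alpha * rho)) * K (l * x `^ alpha) by ring.
  apply: ler_wpM2l; first by rewrite !mulr_ge0 ?powR_ge0// ltW.
  apply: Kmono; first by rewrite mulr_gt0// powR_gt0.
  rewrite ler_wpM2l ?(ltW l0)// ge0_ler_powR ?nnegrE ?(ltW x0) ?(ltW x'0) ?(ltW x'x)//.
  by rewrite ltW// (lt_trans _ halpha).
apply: (@le_trans _ _ (F l x' + (1 - t))); last first.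
  rewrite addrC lerD// fine_le ?fin_num_measure// le_measure ?inE//.
  by move=> w; rewrite /sup_le/= => /le_lt_trans; apply.
have : (1 - t) * F l x <= 1 - t by rewrite ler_piMr// subr_ge0 ltW.
by move: Fx'; rewrite mulrBl mul1r; lra.
Qed.

Lemma sup_cdf_equiv x : 0 < x ->
  equiv_at0 (fun l => fine (P [set w | S l w <= x]))
    (fun l => k * x `^ a * l `^ rho).
Proof.
move=> x0; apply: (equiv_at0_powR (B := fun l => l `^ rho * x `^ a * K (l * x `^ alpha))).
- by rewrite mulf_neq0// gt_eqF// powR_gt0.
- by move=> l l0; rewrite -(hF l0 x0 (he l0)).
rewrite mulrC; have h := monotone_ratio_cvg (powR_gt0 alpha x0) hK Kmono Ksup.
have : x `^ a * K (l * x `^ alpha) @[l --> (0 : R)^'+] --> x `^ a * k.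
  exact: cvgMl_tmp.
apply: cvg_trans; apply: near_eq_cvg; near=> l.
by field; rewrite gt_eqF// powR_gt0.
Unshelve. all: by end_near. Qed.

Let M m l x := \int[leb]_(v in `[x, +oo[) (m * expR (- (m * v)) * F l v).

Lemma laplace_tail_cvg m x : 0 < m -> 0 <= x ->
  M m l x / l `^ rho @[l --> (0 : R)^'+] -->
  k * (\int[leb]_(y in `[m * x, +oo[) (expR (- y) * y `^ a)) * m `^ (- a).
Proof.
move=> m0 x0; rewrite -mulrA -(gamma_substitution a0 m0 x0).
apply: (abelian_limit (K := K) (al := alpha)) => //.
  move=> l l0; apply: nondecreasing_measurable => //.
  by apply: sup_cdf_mono; exact: mT.
by move=> l v l0 v0; rewrite /F (hF l0 v0 (he l0)).
Qed.

(** The case z = 0 is included, so the integral is compared with its part beyond z + 1, where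
    [gamma_tail_pos] applies with a + 1. *)
Lemma gamma_tail_gt0 z : 0 <= z -> 0 < \int[leb]_(y in `[z, +oo[) (expR (- y) * y `^ a).
Proof.
move=> z0; have z1 : 0 < z + 1 by rewrite ltr_wpDl.
have a1 : 0 < a + 1 by rewrite addr_gt0.
have := gamma_tail_pos a1 z1; rewrite addrK => /lt_le_trans; apply.
rewrite /Rintegral fine_le//.
- by apply: integrable_fin_num => //; apply: integrable_gamma_density1 => //; exact: ltW.
- by apply: integrable_fin_num => //; exact: integrable_gamma_density1.
apply: ge0_subset_integral => //.
- by have /integrableP[] := integrable_gamma_density1 a0 z0.
- by move=> y _; rewrite lee_fin mulr_ge0 ?expR_ge0 ?powR_ge0.
- by move=> y; rewrite /= !in_itv/= !andbT; lra.
Qed.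

Lemma laplace_tail_equiv m x : 0 < m -> 0 < x ->
  equiv_at0 (fun l => M m l x)
    (fun l => k * (\int[leb]_(y in `[m * x, +oo[) (expR (- y) * y `^ a))
      * m `^ (- a) * l `^ rho).
Proof.
move=> m0 x0; have mx0 : 0 <= m * x by rewrite mulr_ge0// ltW.
apply: (equiv_at0_powR (B := fun l => M m l x)) => //.
  by rewrite !mulf_neq0// gt_eqF// ?powR_gt0// gamma_tail_gt0.
by apply: laplace_tail_cvg; rewrite ?ltW.
Qed.

Lemma expectation_M m l x : 0 < m -> 0 < l -> 0 <= x ->
  fine (\int[P]_w (expR (- (m * Num.max (S l w) x)))%:E)%E = M m l x.
Proof. by move=> m0 l0 x0; rewrite (expectation_expR_max P (mS l0) m0 x0). Qed.

Lemma laplace_equiv m : 0 < m ->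
  equiv_at0 (fun l => fine 'E_P[fun w => expR (- (m * S l w))])
    (fun l => k * Gamma (1 + a) * m `^ (- a) * l `^ rho).
Proof.
move=> m0.
have -> : Gamma (1 + a) = \int[leb]_(y in `[m * 0, +oo[) (expR (- y) * y `^ a).
  rewrite mulr0 /Gamma.
  transitivity (\int[leb]_(y in `]0, +oo[) (expR (- y) * y `^ a)).
    by apply: eq_Rintegral => y _; rewrite addrAC subrr add0r mulrC.
  apply: Rintegral_itv_obnd_cbnd.
  apply: (integrableS _ _ _ (integrable_gamma_density1 a0 (lexx 0))) => // y /=.
  by rewrite !in_itv/= !andbT; exact: ltW.
apply: (equiv_at0_powR (B := fun l => M m l 0)) => //.
- by rewrite !mulf_neq0// gt_eqF// ?powR_gt0// gamma_tail_gt0 ?mulr0.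
- move=> l l0; rewrite -expectation_M// expectation.unlock; congr fine.
  by apply: eq_integral => w _; rewrite /= max_l.
- exact: laplace_tail_cvg.
Qed.

(** The part of E[exp(-m max(S, x))] on {S < x} is exp(-m x) P(S < x), and P(S < x) equals [F l x]
    by [sup_lt_prob]. The asked expectation is thus a difference of two quantities with known
    limits. *)
Lemma laplace_restricted_equiv m x : 0 < m -> 0 < x ->
  equiv_at0 (fun l => fine 'E_P[fun w =>
      expR (- (m * S l w)) * \1_[set w' | x <= S l w'] w])
    (fun l => k * a * (\int[leb]_(y in `[m * x, +oo[) (expR (- y) * y `^ (a - 1)))
      * m `^ (- a) * l `^ rho).
Proof.
move=> m0 x0; have mx0 : 0 < m * x by rewrite mulr_gt0.
apply: (equiv_at0_powR (B := fun l => M m l x - expR (- (m * x)) * F l x)) => //.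
- have I0 := gamma_tail_pos a0 mx0; have ma0 := powR_gt0 (- a) m0.
  by rewrite gt_eqF// mulr_gt0// mulr_gt0// mulr_gt0.
- move=> l l0; rewrite -(expectation_M m0 l0 (ltW x0)) -(sup_lt_prob l0 x0) expectation.unlock.
  have mlt : measurable [set w | S l w < x] by apply: measurable_lt_rv; exact: mS.
  have mge : measurable [set w | x <= S l w] by apply: measurable_ge_rv; exact: mS.
  have mexp : measurable_fun setT (fun w => expR (- (m * S l w))).
    apply: (measurableT_comp (@measurable_expR R)).
    by apply: measurable_funN; apply: measurable_funM => //; exact: mS.
  pose g1 w := expR (- (m * S l w)) * \1_[set w' | x <= S l w'] w.
  pose g2 w := expR (- (m * x)) * \1_[set w' | S l w' < x] w.
  have g10 w : 0 <= g1 w by rewrite mulr_ge0 ?expR_ge0.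
  have g20 w : 0 <= g2 w by rewrite mulr_ge0 ?expR_ge0.
  have mg1 : measurable_fun setT (EFin \o g1).
    by apply/measurable_EFinP; apply: measurable_funM => //; exact: measurable_indic.
  have mg2 : measurable_fun setT (EFin \o g2).
    by apply/measurable_EFinP; apply: measurable_funM => //; exact: measurable_indic.
  have E12 : (\int[P]_w (expR (- (m * Num.max (S l w) x)))%:E =
      \int[P]_w (g1 w)%:E + \int[P]_w (g2 w)%:E)%E.
    rewrite -ge0_integralD//; last 2 first.
    + by move=> w _; rewrite lee_fin.
    + by move=> w _; rewrite lee_fin.
    apply: eq_integral => w _; rewrite -EFinD /g1 /g2 !indicE; congr _%:E.
    case: (leP x (S l w)) => h.
    + by rewrite mem_set// memNset ?mulr1 ?mulr0 ?addr0//= ltNge h.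
    + by rewrite memNset ?mulr0 ?add0r ?mem_set ?mulr1//= leNgt h.
  have E2 : (\int[P]_w (g2 w)%:E = (expR (- (m * x)) * fine (P [set w | S l w < x]))%:E)%E.
    transitivity (\int[P]_w ((expR (- (m * x)))%:E * (\1_[set w' | (S l w' < x)%R] w)%:E))%E.
      by apply: eq_integral => w _; rewrite -EFinM.
    rewrite ge0_integralZl//.
    + by rewrite integral_indic// setIT [RHS]EFinM fineK// fin_num_measure.
    + by apply/measurable_EFinP; exact: measurable_indic.
  have fin1 : (\int[P]_w (g1 w)%:E)%E \is a fin_num.
    rewrite ge0_fin_numE; last by apply: integral_ge0 => w _; rewrite lee_fin.
    apply: (@le_lt_trans _ _ (\int[P]_w (cst 1%:E w))%E); last first.
      by rewrite integral_cst// mul1e (le_lt_trans (probability_le1 P _)) ?ltry.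
    apply: ge0_le_integral => //.
      by move=> w _; rewrite lee_fin.
    move=> w _; rewrite lee_fin /g1 indicE.
    by case: (_ \in _); rewrite ?mulr0 ?mulr1// -expR0 ler_expR oppr_le0 mulr_ge0// ltW.
  have fineDB (u : \bar R) (v : R) : u \is a fin_num -> fine (u + v%:E)%E - v = fine u.
    by case: u => // u _; rewrite /= addrK.
  by rewrite E12 E2 (fineDB _ _ fin1).
(* The boundary term of the integration by parts is exactly the limit contributed by {S < x}, and
   cancels it. *)
have -> : k * a * (\int[leb]_(y in `[m * x, +oo[) (expR (- y) * y `^ (a - 1))) * m `^ (- a) =
    k * (\int[leb]_(y in `[m * x, +oo[) (expR (- y) * y `^ a)) * m `^ (- a) -
    expR (- (m * x)) * (x `^ a * k).
  rewrite (gamma_by_parts a0 mx0) (powRM a (ltW m0) (ltW x0)) powRN.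
  by field; rewrite gt_eqF// powR_gt0.
have cF : F l x / l `^ rho @[l --> (0 : R)^'+] --> x `^ a * k.
  have h := monotone_ratio_cvg (powR_gt0 alpha x0) hK Kmono Ksup.
  have : x `^ a * K (l * x `^ alpha) @[l --> (0 : R)^'+] --> x `^ a * k.
    exact: cvgMl_tmp.
  apply: cvg_trans; apply: near_eq_cvg; near=> l.
  have l0 : 0 < l by near: l; exact: nbhs_right_gt.
  rewrite /F (hF l0 x0 (he l0)) -/a; field; by rewrite gt_eqF// powR_gt0.
have cM := laplace_tail_cvg m0 (ltW x0).
have cE : expR (- (m * x)) * (F l x / l `^ rho) @[l --> (0 : R)^'+] -->
    expR (- (m * x)) * (x `^ a * k) by exact: cvgMl_tmp.
have : M m l x / l `^ rho - expR (- (m * x)) * (F l x / l `^ rho) @[l --> (0 : R)^'+] -->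
    k * (\int[leb]_(y in `[m * x, +oo[) (expR (- y) * y `^ a)) * m `^ (- a) -
    expR (- (m * x)) * (x `^ a * k) by exact: cvgB.
apply: cvg_trans; apply: near_eq_cvg; near=> l.
by rewrite /= mulrBl mulrA.
Unshelve. all: by end_near. Qed.

End conclusion.

Theorem proposition6 (R : realType) (d : measure_display)
    (Omega : measurableType d) (P : probability Omega R)
    (alpha : R) (halpha : 1 < alpha <= 2)
    (X : R -> Omega -> R) (hX : stable_levy_process P alpha X)
    (rho : R) (hrho : rho = fine (P [set w | 0 <= X 1 w])) :
  exists2 k : R, 0 < k &
  forall (e : R -> {RV P >-> R}),
  (forall l, 0 < l -> exponential_rv l (e l) /\ indep_process_rv P X (e l)) ->
  let S (l : R) (w : Omega) : R := running_sup X (e l w) w in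
  forall x mu : R, 0 < x -> 0 < mu ->
  [/\ equiv_at0 (fun l => fine (P [set w | S l w <= x]))
        (fun l => k * x `^ (alpha * rho) * l `^ rho),
      equiv_at0 (fun l => \int[lebesgue_measure]_(v in `[x, +oo[)
            (mu * expR (- (mu * v)) * fine (P [set w | S l w <= v])))
        (fun l => k * (\int[lebesgue_measure]_(y in `[(mu * x), +oo[)
                         (expR (- y) * y `^ (alpha * rho)))
                  * mu `^ (- (alpha * rho)) * l `^ rho),
      equiv_at0 (fun l => fine 'E_P[fun w => expR (- (mu * S l w))])
        (fun l => k * Gamma (1 + alpha * rho)
                  * mu `^ (- (alpha * rho)) * l `^ rho) &
      equiv_at0 (fun l => fine 'E_P[fun w =>
            expR (- (mu * S l w)) * \1_[set w' | x <= S l w'] w])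
        (fun l => k * (alpha * rho)
                  * (\int[lebesgue_measure]_(y in `[(mu * x), +oo[)
                       (expR (- y) * y `^ (alpha * rho - 1)))
                  * mu `^ (- (alpha * rho)) * l `^ rho)].
Proof.
have [alpha1 _] := andP halpha; rewrite {}hrho.
(* The constant precedes the family of exponential times. If the space carries none, the claim is
   vacuous for k = 1; otherwise any such family [e0] yields k and [K], and [hF] then holds for every
   exponential time, in particular for [e]. *)
have [[e0 he0]|noexp] := pselect (exists e0 : R -> Omega -> R,
    forall l, 0 < l -> exp_time P X l (e0 l)); last first.
  exists 1 => // e he; exfalso; apply: noexp; exists (fun l => e l : Omega -> R).
  by move=> l l0; have [h1 h2] := he l l0; exact: exponential_rv_exp_time.
have [k [K [k0 hK Kmono Ksup hF]]] := supremum_law alpha1 hX he0.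
exists k => // e he S x mu x0 mu0.
have heT l : 0 < l -> exp_time P X l (e l).
  by move=> l0; have [h1 h2] := he l l0; exact: exponential_rv_exp_time.
split.
- exact: (sup_cdf_equiv (e := fun l => e l : Omega -> R) heT k0 hK Kmono Ksup hF x0).
- exact: (laplace_tail_equiv hX (e := fun l => e l : Omega -> R) heT alpha1 k0 hK Kmono Ksup hF mu0 x0).
- exact: (laplace_equiv hX (e := fun l => e l : Omega -> R) heT alpha1 k0 hK Kmono Ksup hF mu0).
- exact: (laplace_restricted_equiv hX (e := fun l => e l : Omega -> R) heT alpha1 k0 hK Kmono Ksup hF mu0 x0).
Qed.
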